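(* Let $n\ge2$ and let $\lambda,\mu$ be dominant weights of type $A_{n-1}$ with $\lambda-\mu$ a non-negative integer combination of simple roots. Each connected component $C$ of the graph on $S_{\lambda,\mu}$ given by the $\phi_i$ operators is isomorphic to a subgraph $\Gamma$ of the Cayley graph of a parabolic subgroup of $S_n$ determined by the source vertex $(\mathrm{id},\boldsymbol\alpha)$ of $C$ (namely the subgroup generated by the $s_i$ with $\phi_i(\mathrm{id},\boldsymbol\alpha)\neq0$), such that $w\in\Gamma$ implies $u\in\Gamma$ for any $u\le w$ in the weak Bruhat order.
   Context: **Type $A_{n-1}$.** $V=\mathbb R^n/\mathbb R(1,\dots,1)$, $\varepsilon_1,\dots,\varepsilon_n\in V$ are the images of the coordinate vectors, $\Lambda=\mathbb Z^n/\mathbb Z(1,\dots,1)$ is the weight lattice, $\alpha_i=\varepsilon_i-\varepsilon_{i+1}$ ($1\le i\le n-1$) are the simple roots, and the positive roots are $\varepsilon_i-\varepsilon_j$, $1\le i<j\le n$, denoted $(i,j)$; so $(i,i+1)$ is the simple root $\alpha_i$. $\langle x,\alpha_i^\vee\rangle=x_i-x_{i+1}$. The Weyl group $W=S_n$ permutes coordinates, with simple reflections $s_i$. $\rho=(n-1,n-2,\dots,0)$. A weight $x$ is dominant if $\langle x,\alpha_i^\vee\rangle\ge 0$ for all $i$. **Kostant partitions.** $\mathcal K$ is the set of finite multisets $\boldsymbol\alpha$ of positive roots; $\overline{\boldsymbol\alpha}$ is the sum (with multiplicity) of the roots of $\boldsymbol\alpha$. Let $S_{\lambda,\mu}=\{(w,\boldsymbol\alpha):w\in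 W,\ \boldsymbol\alpha\in\mathcal K,\ \overline{\boldsymbol\alpha}=w(\lambda+\rho)-(\mu+\rho)\}$. **Words.** Let $\boldsymbol\alpha\in\mathcal K$, $1\le i\le n-1$. The word $W_i$: order the roots $(a,b)$ of $\boldsymbol\alpha$ (with multiplicity) from left to right, decreasing in $a$ and, for equal $a$, increasing in $b$; place $+$ below each $(h,i)$ and $-$ below each $(h,i+1)$ (other roots give no symbol). The word $W_i^*$: order the roots from left to right, increasing in $b$ and, for equal $b$, decreasing in $a$; place $+$ below each $(i+1,j)$ and $-$ below each $(i,j)$. The reduced words $W_i^{r}=(+)^{a_i}(-)^{b_i}$ and $W_i^{*,r}=(+)^{a_i^*}(-)^{b_i^*}$ are obtained by repeatedly cancelling pairs consisting of a $-$ and a $+$ where the $-$ is immediately to the left of the $+$ (ignoring already cancelled symbols); the remaining symbols remember the roots they lie below. **Operators on $\mathcal K$** (with values in $\mathcal K\sqcup\{0\}$, and sending $0$ to $0$): - $f_i(\boldsymbol\alpha)$: if $b_i^*<a_i$, replace the root $(h,i)$ above the rightmost $+$ of $W_i^r$ by $(h,i+1)$; if $b_i^*\ge a_i$ and $a_i^*>0$, replace the root $(i+1,j)$ above the rightmost $+$ of $W_i^{*,r}$ by $(i,j)$; otherwise $f_i(\boldsymbol\alpha)=0$. - $e_i(\boldsymbol\alpha)$: if $b_i^*\le a_i$, $b_i>0$ and the root $(h,i+1)$ above the leftmost $-$ of $W_i^r$ is not $(i,i+1)$, replace that root by $(h,i)$; if $b_i^*>a_i$ and the root $(i,j)$ above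 the leftmost $-$ of $W_i^{*,r}$ is not $(i,i+1)$, replace that root by $(i+1,j)$; otherwise $e_i(\boldsymbol\alpha)=0$. **The operators $\phi_i$ and the graph.** For $(w,\boldsymbol\alpha)\in S_{\lambda,\mu}$ let $k_i=\langle w(\lambda+\rho),\alpha_i^\vee\rangle$, which is nonzero. Put $\phi_i(\boldsymbol\alpha)=f_i^{-k_i}(\boldsymbol\alpha)$ if $k_i<0$, and $\phi_i(\boldsymbol\alpha)=e_i^{k_i}(\boldsymbol\alpha)$ if $k_i>0$. On pairs, $\phi_i(w,\boldsymbol\alpha)=(s_iw,\phi_i(\boldsymbol\alpha))\in S_{\lambda,\mu}$ if $\phi_i(\boldsymbol\alpha)\ne0$ and $\phi_i(w,\boldsymbol\alpha)=0$ otherwise. The graph on vertex set $S_{\lambda,\mu}$ has an edge labelled $i$ from $(w,\boldsymbol\alpha)$ to $(s_iw,\boldsymbol\beta)$ iff $k_i<0$ and $\boldsymbol\beta=f_i^{-k_i}(\boldsymbol\alpha)\neq 0$; connected components are those of the underlying undirected graph. The source vertex of a component is its vertex whose first entry is $\mathrm{id}$. **Cayley graph and order.** The Cayley graph of $S_n$ (or of a parabolic subgroup, i.e. one generated by a subset of the $s_i$) has edges labelled $i$ between $w$ and $s_iw$. The isomorphism is given by $(w,\boldsymbol\beta)\mapsto w$ and respects edge labels. The weak Bruhat order is the one generated by left multiplication by simple reflections: $u\le w$ iff $w=vu$ with $\ell(w)=\ell(v)+\ell(u)$. *)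

(* Defs.v *)
From HB Require Import structures.
From Stdlib Require Export Relation_Operators.
From mathcomp Require Export all_boot all_order all_fingroup all_algebra.
From mathcomp Require Export finmap multiset.

Set Implicit Arguments.
Unset Strict Implicit.
Unset Printing Implicit Defensive.

Import GroupScope GRing.Theory Num.Theory.

Local Open Scope ring_scope.

(* Indices are 0-based: coordinates are indexed by 'I_n, and i : 'I_n.-1      *)
(* stands for the simple root alpha_i = eps_(lo i) - eps_(hi i), where        *)
(* hi i = lo i + 1.                                                           *)
Definition lo n (i : 'I_n.-1) : 'I_n := widen_ord (leq_pred n) i.

Lemma hi_subproof n (i : 'I_n.-1) : (i.+1 < n)%N.
Proof. by rewrite -ltn_predRL. Qed.

Definition hi n (i : 'I_n.-1) : 'I_n := Ordinal (hi_subproof i).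

(* The weight lattice Z^n / Z(1,...,1): elements are given by representatives *)
(* in Z^n, and x =L y is equality of the classes of x and y in the quotient.  *)
Definition eqL n (x y : 'rV[int]_n) : Prop := exists c : int, x - y = const_mx c.

Notation "x =L y" := (eqL x y) (at level 70, no associativity) : ring_scope.

Definition eps n (j : 'I_n) : 'rV[int]_n := delta_mx 0 j.

Definition simple_root n (i : 'I_n.-1) : 'rV[int]_n := eps (lo i) - eps (hi i).

(* <x, alpha_i^vee>, which depends only on the class of x. *)
Definition pairing n (x : 'rV[int]_n) (i : 'I_n.-1) : int :=
  x 0 (lo i) - x 0 (hi i).

Definition dominant n (x : 'rV[int]_n) : Prop := forall i, 0 <= pairing x i.

Definition rho n : 'rV[int]_n := \row_(j < n) (n.-1 - j)%N%:Z.

(* lambda - mu lies in the cone of non-negative integer combinations of the   *)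
(* simple roots.                                                              *)
Definition root_ge n (lambda mu : 'rV[int]_n) : Prop :=
  exists c : 'I_n.-1 -> nat, lambda - mu =L \sum_i simple_root i *+ c i.

(* Products in the Weyl group are compositions of functions, applied right to *)
(* left, whereas (u * v)%g in 'S_n applies u first.                           *)
Definition wmul n (v u : 'S_n) : 'S_n := (u * v)%g.

Lemma wmulE n (v u : 'S_n) j : wmul v u j = v (u j).
Proof. by rewrite permM. Qed.

Definition simple_refl n (i : 'I_n.-1) : 'S_n := tperm (lo i) (hi i).

(* w sends eps_j to eps_(w j). *)
Definition wact n (w : 'S_n) (x : 'rV[int]_n) : 'rV[int]_n :=
  col_perm w^-1%g x.

Lemma wact_eps n (w : 'S_n) j : wact w (eps j) = eps (w j).
Proof.
apply/rowP=> k; rewrite !mxE !eqxx /=.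
by rewrite -(inj_eq (@perm_inj _ w)) permKV.
Qed.

Lemma wact_mul n (v u : 'S_n) x : wact (wmul v u) x = wact v (wact u x).
Proof. by apply/rowP=> k; rewrite !mxE /wmul invMg permM. Qed.

Lemma simple_word_ex n (w : 'S_n) :
  exists k, [exists s : k.-tuple 'I_n.-1, w == \prod_(i <- s) simple_refl i]%g.
Proof.
suff: w \in <<[set simple_refl i | i : 'I_n.-1]>>%g.
  move=> /gen_prodgP[k [c cS ->]]; exists k.
  have cP j : exists i, simple_refl i == c j.
    by have /imsetP[i _ ->] := cS j; exists i.
  apply/existsP; exists [tuple xchoose (cP j) | j < k].
  rewrite big_tuple; apply/eqP/eq_bigr => j _.
  by rewrite tnth_mktuple (eqP (xchooseP (cP j))).
have tp d (a b : 'I_n) : (b = a + d.+1 :> nat)%N ->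
    tperm a b \in <<[set simple_refl i | i : 'I_n.-1]>>%g.
  elim: d b => [|d IHd] b ab.
    have an : (a < n.-1)%N by rewrite ltn_predRL; have := ltn_ord b; rewrite ab addn1.
    have -> : tperm a b = simple_refl (Ordinal an).
      by congr tperm; apply: val_inj => //=; rewrite ab addn1.
    by apply/mem_gen/imset_f.
  have cn : (a + d.+1 < n.-1)%N by rewrite ltn_predRL; have := ltn_ord b; rewrite ab addnS.
  have ca : tperm a (lo (Ordinal cn)) \in
      <<[set simple_refl i | i : 'I_n.-1]>>%g by exact: IHd.
  have sc : simple_refl (Ordinal cn) \in
      <<[set simple_refl i | i : 'I_n.-1]>>%g by apply/mem_gen/imset_f.
  have -> : tperm a b = (tperm a (lo (Ordinal cn)) ^ simple_refl (Ordinal cn))%g.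
    have hb : hi (Ordinal cn) = b by apply: val_inj; rewrite /= ab !addnS.
    have lo_hi : lo (Ordinal cn) != hi (Ordinal cn).
      by rewrite -val_eqE /= neq_ltn ltnSn.
    have a_lo : lo (Ordinal cn) != a.
      by rewrite -val_eqE /= neq_ltn addnS ltnS leq_addr orbT.
    have a_hi : hi (Ordinal cn) != a.
      by rewrite -val_eqE /= neq_ltn ltnS leq_addr orbT.
    by rewrite tpermJ tpermL tpermD // hb.
  by rewrite groupJ.
have [ts -> _] := prod_tpermP w; apply: group_prod => -[a b] _ /=.
have [ab|ba|/val_inj->] := ltngtP a b; last by rewrite tperm1 group1.
  by apply: (tp (b - a).-1); rewrite prednK ?subn_gt0 // subnKC // ltnW.
by rewrite tpermC; apply: (tp (a - b).-1); rewrite prednK ?subn_gt0 // subnKC // ltnW.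
Qed.

(* The least number of factors in an expression of w as a product of simple   *)
(* reflections; reversing words makes the order of the factors irrelevant.    *)
Definition wlength n (w : 'S_n) : nat := ex_minn (simple_word_ex w).

Definition weak_le n (u w : 'S_n) : Prop :=
  exists2 v, w = wmul v u & wlength w = (wlength v + wlength u)%N.

Definition parabolic n (J : {set 'I_n.-1}) : {set 'S_n} :=
  <<[set simple_refl i | i in J]>>%g.

(* The positive root eps_a - eps_b, a < b, is the pair (a, b). *)
Record root n := Root {
  root_pair : 'I_n * 'I_n;
  _ : (root_pair.1 < root_pair.2)%N
}.

HB.instance Definition _ n := [isSub for @root_pair n].
HB.instance Definition _ n := [Finite of root n by <:].

Definition fst_ix n (r : root n) : 'I_n := (root_pair r).1.
Definition snd_ix n (r : root n) : 'I_n := (root_pair r).2.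

Definition kostant n : Type := {mset (root n)}%mset.

Definition kostant_sum n (alpha : kostant n) : 'rV[int]_n :=
  \sum_(r <- enum_mset alpha) (eps (fst_ix r) - eps (snd_ix r)).

Definition vertex n : Type := 'S_n * kostant n.

Definition in_S n (lambda mu : 'rV[int]_n) (x : vertex n) : Prop :=
  kostant_sum x.2 =L wact x.1 (lambda + rho n) - (mu + rho n).

(* Words: a symbol is a pair of a sign (true for +, false for -) and the root *)
(* it lies below.                                                             *)
Definition word n := seq (bool * root n).

Definition ord_W n (r r' : root n) : bool :=
  (fst_ix r' < fst_ix r)%N ||
  ((fst_ix r == fst_ix r') && (snd_ix r <= snd_ix r')%N).

Definition ord_Wstar n (r r' : root n) : bool :=
  (snd_ix r < snd_ix r')%N ||
  ((snd_ix r == snd_ix r') && (fst_ix r' <= fst_ix r)%N).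

Definition symb n (i : 'I_n.-1) (r : root n) : option (bool * root n) :=
  if snd_ix r == lo i then Some (true, r)
  else if snd_ix r == hi i then Some (false, r) else None.

Definition symb_star n (i : 'I_n.-1) (r : root n) : option (bool * root n) :=
  if fst_ix r == hi i then Some (true, r)
  else if fst_ix r == lo i then Some (false, r) else None.

Definition W n (i : 'I_n.-1) (alpha : kostant n) : word n :=
  pmap (symb i) (sort (@ord_W n) (enum_mset alpha)).

Definition Wstar n (i : 'I_n.-1) (alpha : kostant n) : word n :=
  pmap (symb_star i) (sort (@ord_Wstar n) (enum_mset alpha)).

(* Deletes the first occurrence of a - immediately followed by a +, if any. *)
Fixpoint cancel1 n (w : word n) : word n :=
  match w with
  | x :: (y :: t) as w' => if ~~ x.1 && y.1 then t else x :: cancel1 w'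
  | _ => w
  end.

(* size w steps are enough to reach a word of the form (+)^a (-)^b. *)
Definition reduce n (w : word n) : word n := iter (size w) (@cancel1 n) w.

Definition pluses n (w : word n) : seq (root n) := [seq x.2 | x <- w & x.1].
Definition minuses n (w : word n) : seq (root n) := [seq x.2 | x <- w & ~~ x.1].

(* The default value r is never used below: the new pair is always a root. *)
Definition replace n (alpha : kostant n) (r : root n) (p : 'I_n * 'I_n) :
    kostant n :=
  (insubd r p +` (alpha `\ r))%mset.

Definition is_simple n (i : 'I_n.-1) (r : root n) : bool :=
  root_pair r == (lo i, hi i).

(* Operators take values in option (kostant n), None being 0. *)
Definition f_op n (i : 'I_n.-1) (alpha : kostant n) : option (kostant n) :=
  let plus := pluses (reduce (W i alpha)) in
  let plus_star := pluses (reduce (Wstar i alpha)) in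
  let minus_star := minuses (reduce (Wstar i alpha)) in
  if (size minus_star < size plus)%N then
    if rev plus is r :: _ then Some (replace alpha r (fst_ix r, hi i)) else None
  else
    if rev plus_star is r :: _ then Some (replace alpha r (lo i, snd_ix r))
    else None.

Definition e_op n (i : 'I_n.-1) (alpha : kostant n) : option (kostant n) :=
  let plus := pluses (reduce (W i alpha)) in
  let minus := minuses (reduce (W i alpha)) in
  let minus_star := minuses (reduce (Wstar i alpha)) in
  if (size minus_star <= size plus)%N then
    if minus is r :: _ then
      if is_simple i r then None else Some (replace alpha r (fst_ix r, lo i))
    else None
  else
    if minus_star is r :: _ then
      if is_simple i r then None else Some (replace alpha r (hi i, snd_ix r))
    else None.

Definition iter_op n (op : kostant n -> option (kostant n)) (k : nat)
    (alpha : kostant n) : option (kostant n) :=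
  iter k (obind op) (Some alpha).

Definition k_ix n (lambda : 'rV[int]_n) (w : 'S_n) (i : 'I_n.-1) : int :=
  pairing (wact w (lambda + rho n)) i.

(* k is nonzero when lambda is dominant, as lambda + rho is then regular. *)
Definition phi n (lambda : 'rV[int]_n) (i : 'I_n.-1) (x : vertex n) :
    option (vertex n) :=
  let k := k_ix lambda x.1 i in
  omap (fun beta => (wmul (simple_refl i) x.1, beta))
    (if k < 0 then iter_op (f_op i) `|k|%N x.2 else iter_op (e_op i) `|k|%N x.2).

(* Undirected graphs with edges labelled by L. *)
Record lgraph (L V : Type) := LGraph {
  vert : V -> Prop;
  edge : L -> V -> V -> Prop;
  edge_sym : forall i x y, edge i x y -> edge i y x;
  edge_vert : forall i x y, edge i x y -> vert x /\ vert y
}.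

Definition subgraph L V (G H : lgraph L V) : Prop :=
  (forall x, vert G x -> vert H x) /\
  (forall i x y, edge G i x y -> edge H i x y).

Definition is_iso L V V' (f : V -> V') (G : lgraph L V) (H : lgraph L V') : Prop :=
  [/\ forall x, vert G x -> vert H (f x),
      forall x y, vert G x -> vert G y -> f x = f y -> x = y,
      forall z, vert H z -> exists2 x, vert G x & f x = z &
      forall i x y, vert G x -> vert G y ->
        (edge G i x y <-> edge H i (f x) (f y))].

Section Component.
Variables (L V : Type) (G : lgraph L V) (x : V).

Definition reachable (y : V) : Prop :=
  clos_refl_trans V (fun a b => exists i, edge G i a b) x y.

Definition comp_vert y := vert G y /\ reachable y.
Definition comp_edge i y z := [/\ edge G i y z, comp_vert y & comp_vert z].

Lemma comp_edge_sym i y z : comp_edge i y z -> comp_edge i z y.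
Proof. by case=> e vy vz; split=> //; apply: edge_sym. Qed.

Lemma comp_edge_vert i y z : comp_edge i y z -> comp_vert y /\ comp_vert z.
Proof. by case. Qed.

Definition component : lgraph L V := LGraph comp_edge_sym comp_edge_vert.
End Component.

Definition is_component L V (G C : lgraph L V) : Prop :=
  exists2 x, vert G x & C = component G x.

Section PhiGraph.
Variables (n : nat) (lambda mu : 'rV[int]_n).

Definition phi_arrow (i : 'I_n.-1) (x y : vertex n) : Prop :=
  [/\ in_S lambda mu x, in_S lambda mu y,
      k_ix lambda x.1 i < 0,
      y.1 = wmul (simple_refl i) x.1 &
      iter_op (f_op i) `|k_ix lambda x.1 i|%N x.2 = Some y.2].

Definition phi_adj i x y := phi_arrow i x y \/ phi_arrow i y x.

Lemma phi_adj_sym i x y : phi_adj i x y -> phi_adj i y x.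
Proof. by case; [right | left]. Qed.

Lemma phi_adj_vert i x y :
  phi_adj i x y -> in_S lambda mu x /\ in_S lambda mu y.
Proof. by case=> -[]. Qed.

Definition phi_graph : lgraph 'I_n.-1 (vertex n) :=
  LGraph phi_adj_sym phi_adj_vert.
End PhiGraph.

Section Cayley.
Variables (n : nat) (J : {set 'I_n.-1}).

Definition cayley_vert (w : 'S_n) : Prop := w \in parabolic J.
Definition cayley_adj (i : 'I_n.-1) (w w' : 'S_n) : Prop :=
  [/\ i \in J, w \in parabolic J & w' = wmul (simple_refl i) w].

Lemma cayley_adj_sym i w w' : cayley_adj i w w' -> cayley_adj i w' w.
Proof.
move=> [iJ wJ ->]; split=> //; last by rewrite /wmul -mulgA tperm2 mulg1.
by rewrite groupM // mem_gen // imset_f.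
Qed.

Lemma cayley_adj_vert i w w' :
  cayley_adj i w w' -> cayley_vert w /\ cayley_vert w'.
Proof. by move=> a; have [_ wJ _] := a; have [_ w'J _] := cayley_adj_sym a. Qed.

Definition cayley : lgraph 'I_n.-1 'S_n := LGraph cayley_adj_sym cayley_adj_vert.
End Cayley.

Definition is_source n (C : lgraph 'I_n.-1 (vertex n)) (alpha : kostant n) : Prop :=
  unique (fun beta => vert C (1%g, beta)) alpha.

Definition source_labels n (lambda : 'rV[int]_n) (alpha : kostant n) :
    {set 'I_n.-1} :=
  [set i | isSome (phi lambda i (1%g, alpha))].

(* Main.v *)
(* The word W_i^* W_i turns f_i into the signature rule of crystal theory, and *)
(* phi_i into an analogue of the Weyl group action on a crystal. On a vertex   *)
(* (w, alpha) with k_i < 0 the weight of alpha forces f_i^(-k_i) to be defined *)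
(* (this is where mu dominant is used), so that from any vertex one can        *)
(* descend to one above the identity. These descents are confluent: f_i and    *)
(* f_j commute for orthogonal simple roots, and for adjacent ones              *)
(* f_i^a f_j^(a+b) f_i^b = f_j^b f_i^(a+b) f_j^a on the relevant partitions.   *)
(* For the latter identity the Kostant partition is encoded as a word in three *)
(* letters on which f_i and f_j act by the signature rule; column insertion    *)
(* transports these operators to tableaux with entries in {0, 1, 2}, where     *)
(* they are given by explicit formulas. By Newman's lemma every vertex lies    *)
(* above a unique source, and since each f_i is injective a vertex is          *)
(* determined by its source and its first entry. Descending along reduced      *)
(* words gives closure under the weak order. Finally, f_j decreases by at most *)
(* 1 the number of times that e_i applies when i and j are adjacent; this      *)
(* lets one push any label down to the source, whence the parabolic subgroup.  *)

(* Read [W_i^*] followed by [W_i] as a single sign word. Comparing [b_i^*] with [a_i] only decides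
   in which of the two parts the rightmost uncancelled + lies, so [f_i] is the signature rule on
   this word ([f_opP]): it turns one uncancelled + into an uncancelled - ([f_op_Ksig]) and is undone
   by [e_i] ([f_op_e_op]). Cancellation preserves the difference between the numbers of - and +,
   which is the pairing of the weight with the coroot ([pairing_kostant_sum]). With [mu] dominant, a
   vertex with k_i < 0 therefore has at least -k_i more uncancelled + than - ([in_S_weight]), so an
   arrow leaves it for every left descent of its first entry. Arrows shorten that entry by one, and
   all descents end above the identity.

   By Newman's lemma the end is unique ([source_uniq]) once two arrows out of one vertex can be
   joined ([confluence]). For orthogonal roots this is the commutation [f_op_comm]; the two words
   share only a 2 x 2 block of multiplicities. For adjacent roots it is the braid identity
   [f_op_braid]. There the partition becomes a word in three letters on which both operators act by
   the signature rule ([rank2_word_act]). Column insertion is injective and carries the operators to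
   the insertion tableau while fixing the recording data ([insertion_act], [insertion_inj]), and on
   three-row tableaux the identity is one about minima ([braid_arith]). It relies on the
   inequalities of [in_S_weight].

   Within a component a vertex is determined by its first entry, since one can descend with the same
   labels from two candidates and each arrow is injective ([vertC_inj]). Descending along a reduced
   expression gives closure under the weak order ([vertC_weak_le]). For the parabolic subgroup it
   must be shown that every label occurring in the component already occurs at the source
   ([arrow_label]). The difficulty is that [e_i] stops at a simple root; [elen] counts how often it
   applies, and an adjacent [f_j] lowers this count by at most 1, which is exactly what is needed to
   move an arrow labelled i closer to the source. *)
From HB Require Import structures.
Require Import Defs.
From mathcomp Require Import zify.

Set Implicit Arguments.
Unset Strict Implicit.
Unset Printing Implicit Defensive.

Import GRing.Theory Num.Theory.

Local Open Scope nat_scope.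

(** * Sign words and the bicyclic monoid *)

(* (p, q) stands for the reduced word (+)^p(-)^q, and the product for          *)
(* concatenation followed by reduction: this is the bicyclic monoid.           *)
Definition bmul (x y : nat * nat) : nat * nat :=
  (x.1 + (y.1 - x.2), y.2 + (x.2 - y.1)).

Lemma bmulA : associative bmul.
Proof. by move=> [a b] [c d] [e f]; congr pair => /=; lia. Qed.

Lemma bmul1x : left_id (0, 0) bmul.
Proof. by move=> [a b]; congr pair => /=; lia. Qed.

Lemma bmulx1 : right_id (0, 0) bmul.
Proof. by move=> [a b]; congr pair => /=; lia. Qed.

HB.instance Definition _ := Monoid.isLaw.Build (nat * nat)%type (0, 0) bmul bmulA bmul1x bmulx1.

(** The opposite monoid: a big operator over increasing indices then describes a word listed by
    decreasing index, as [W_i] is. *)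
Definition bmulr (x y : nat * nat) := bmul y x.
Lemma bmulrA : associative bmulr.
Proof. by move=> x y z; rewrite /bmulr bmulA. Qed.
HB.instance Definition _ := Monoid.isLaw.Build (nat * nat)%type (0, 0) bmulr bmulrA bmulx1 bmul1x.

Notation "\bprod_ ( i <- r ) F" := (\big[bmul/(0,0)]_(i <- r) F) (at level 36, F at level 36, i, r at level 50).

Section Red.
Variable T : Type.
Implicit Types (w : seq (bool * T)) (x : bool * T).

Definition sgn x : nat * nat := (nat_of_bool x.1, nat_of_bool (~~ x.1)).
Definition wsig w := \bprod_(x <- w) sgn x.

Lemma wsig_cons x w : wsig (x :: w) = bmul (sgn x) (wsig w).
Proof. by rewrite /wsig big_cons. Qed.
Lemma wsig_cat w w' : wsig (w ++ w') = bmul (wsig w) (wsig w').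
Proof. by rewrite /wsig big_cat. Qed.
Lemma wsig_nseq k (b : bool) (t : T) : wsig (nseq k (b, t)) = if b then (k, 0) else (0, k).
Proof.
elim: k => [|k IHk]; first by rewrite /wsig big_nil; case: b.
by rewrite /= wsig_cons IHk; case: b {IHk}; congr pair => /=; lia.
Qed.

(** The labels of the uncancelled + and -, computed from the right: a new - cancels the head of the
    list of pluses, that is, the nearest surviving + on its right. *)
Fixpoint red w : seq T * seq T :=
  if w is x :: w' then
    let: (P, M) := red w' in
    if x.1 then (x.2 :: P, M) else if P is _ :: P' then (P', M) else ([::], x.2 :: M)
  else ([::], [::]).

Lemma size_red w : (size (red w).1, size (red w).2) = wsig w.
Proof.
elim: w => [|[s t] w IHw] /=; first by rewrite /wsig big_nil.
rewrite wsig_cons -IHw /sgn /=; case: (red w) => P M /=.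
by case: s; case: P => [|p P]; congr pair => /=; lia.
Qed.

(** No - on the left can reach this + and no + on the right survives, so it is the rightmost
    uncancelled one. This is how the root chosen by [f_op] gets identified; [red_minus] does the
    same for [e_op]. *)
Lemma red_plus w1 w2 t : (wsig w1).2 = 0 -> (wsig w2).1 = 0 ->
  exists P, (red (w1 ++ (true, t) :: w2)).1 = rcons P t.
Proof.
rewrite -(size_red w1) -(size_red w2) /=.
case E2: (red w2) => [[|//] M] /=.
elim: w1 => [|[s y] w1 IHw] /=; first by rewrite E2 => _ _; exists [::].
have := size_red (w1 ++ (true, t) :: w2).
rewrite wsig_cat wsig_cons -(size_red w1) -(size_red w2) E2 /bmul /=.
case: (red w1) IHw => P1 M1 /= IHw; case: (red _) IHw => P2 M2 /= IHw.
case: s => /=; first by move=> _ M10 _; have [//|P ->] := IHw M10; exists (y :: P).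
case: P1 IHw => [|p P1] //= IHw; case; move=> sP _ M10 _.
have [//|P EP] := IHw M10.
case: P2 EP sP {IHw} => [|p2 P2]; first by case: P.
case: P => [|p3 P] //= [_ ->]; last by exists P.
by move=> /=; lia.
Qed.

Lemma red_minus w1 w2 t : (wsig w1).2 = 0 -> (wsig w2).1 = 0 ->
  exists M, (red (w1 ++ (false, t) :: w2)).2 = t :: M.
Proof.
rewrite -(size_red w1) -(size_red w2) /=.
case E2: (red w2) => [[|//] M] /=.
elim: w1 => [|[s y] w1 IHw] /=; first by rewrite E2 => _ _; exists M.
have := size_red (w1 ++ (false, t) :: w2).
rewrite wsig_cat wsig_cons -(size_red w1) -(size_red w2) E2 /bmul /=.
case: (red w1) IHw => P1 M1 /= IHw; case: (red _) IHw => P2 M2 /= IHw.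
case: s => /=; first by move=> _ M10 _; have [//|M' ->] := IHw M10; exists M'.
case: P1 IHw => [|p P1] //= IHw; case; move=> sP _ M10 _.
have [//|M' EM] := IHw M10.
case: P2 sP {IHw} => [|p2 P2] /= sP; first by lia.
by exists M'.
Qed.

End Red.

Lemma red_map T T' (g : T -> T') (w : seq (bool * T)) :
  red [seq (x.1, g x.2) | x <- w] = (map g (red w).1, map g (red w).2).
Proof.
by elim: w => [|[s t] w IHw] //=; rewrite IHw; case: (red w) => -[|p P] M /=; case: s.
Qed.

(** * The cancellation procedure computes the reduced word *)

Section Reduce.
Variable n : nat.
Implicit Type w : word n.

Lemma cancel1_cons x y w :
  cancel1 [:: x, y & w] = if ~~ x.1 && y.1 then w else x :: cancel1 (y :: w).
Proof. by []. Qed.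

Lemma red_cancel1 w : red (cancel1 w) = red w.
Proof.
elim: w => [|x [|y w] IHw] //.
rewrite cancel1_cons; case: ifP => [/andP[nx yT]|_].
  by rewrite /= yT (negPf nx); case: (red w).
by move: (cancel1 _) IHw => v /= ->.
Qed.

Definition wnf w := [seq (true, x) | x <- (red w).1] ++ [seq (false, x) | x <- (red w).2].

Lemma cancel1_fix w : cancel1 w = w \/ (size (cancel1 w)).+2 = size w.
Proof.
elim: w => [|x [|y w] IHw]; [by left | by left |].
rewrite cancel1_cons; case: ifP => _; first by right.
by case: IHw => [->|E]; [left | right; rewrite /= E].
Qed.

Lemma cancel1_wnf w : cancel1 w = w -> w = wnf w.
Proof.
rewrite /wnf; elim: w => [|[s x] [|y w] IHw] //; first by case: s.
rewrite cancel1_cons; case: ifP => [_ E|ns [/IHw]].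
  by have := leqnSn (size w).+1; rewrite -[_.+2]/(size [:: (s, x), y & w]) -E ltnn.
move: {IHw} ns; move E: (y :: w) => t; rewrite /=.
case: (red t) => P M /= ns Et; case: s ns => /= ns; first by rewrite -Et.
case: P Et => [|p P] /= Et; first by rewrite -Et.
by move: E ns; rewrite Et => -[->].
Qed.

Lemma reduceE w : reduce w = wnf w.
Proof.
have redi k : red (iter k (@cancel1 n) w) = red w.
  by elim: k => //= k; rewrite red_cancel1.
rewrite -(_ : wnf (reduce w) = wnf w); last by rewrite /wnf redi.
apply: cancel1_wnf; rewrite /reduce.
(* A pass that changes the word shortens it by two, so [size w] passes reach a fixed point or leave
   the empty word, which is one. *)
suff H k : cancel1 (iter k (@cancel1 n) w) = iter k (@cancel1 n) w \/
    size (iter k (@cancel1 n) w) + k <= size w.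
  have [//|] := H (size w); move: (iter _ _ _) => -[|x u] //= le_uw.
  by move: le_uw; rewrite addSn ltnNge leq_addl.
elim: k => [|k [IHk|IHk]]; first by right; rewrite addn0.
  by left; rewrite /= !IHk.
rewrite iterS; have [E|E] := cancel1_fix (iter k (@cancel1 n) w); first by left; rewrite !E.
by right; move: E IHk; lia.
Qed.

Lemma pluses_reduce w : pluses (reduce w) = (red w).1.
Proof.
rewrite reduceE /pluses /wnf; case: (red w) => P M /=; elim: P => /= [|x P ->] //.
by elim: M.
Qed.

Lemma minuses_reduce w : minuses (reduce w) = (red w).2.
Proof.
rewrite reduceE /minuses /wnf; case: (red w) => P M /=; elim: P => //=.
by elim: M => //= x M ->.
Qed.

End Reduce.

(** * Letter words and column insertion *)

Section LetterWords.
Implicit Types (k : nat) (x : nat * nat) (w : seq (nat * nat)).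

Definition lsgn k x : nat * nat := (nat_of_bool (x.1 == k), nat_of_bool (x.1 == k.+1)).
Definition lsig k w := \bprod_(x <- w) lsgn k x.

Lemma lsig_cons k x w : lsig k (x :: w) = bmul (lsgn k x) (lsig k w).
Proof. by rewrite /lsig big_cons. Qed.

Lemma lsig_cat k w w' : lsig k (w ++ w') = bmul (lsig k w) (lsig k w').
Proof. by rewrite /lsig big_cat. Qed.

(** The signature rule on letters: the rightmost uncancelled k becomes k+1. The test asks whether
    some + of the tail survives the head; if none does, the head is the pivot. The value is
    meaningful when [(lsig k w).1] is positive. *)
Fixpoint act k w :=
  if w is x :: w' then
    if nat_of_bool (x.1 == k.+1) < (lsig k w').1 then x :: act k w' else (k.+1, x.2) :: w'
  else [::].

Lemma act_pivot k w1 w2 t : (lsig k w1).2 = 0 -> (lsig k w2).1 = 0 ->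
  act k (w1 ++ (k, t) :: w2) = w1 ++ (k.+1, t) :: w2.
Proof.
elim: w1 => [|x w1 IHw] /=; first by move=> _ ->.
rewrite lsig_cons lsig_cat lsig_cons /bmul /lsgn /= eqxx (ltn_eqF (ltnSn k)) => w10 w20.
by rewrite IHw ?ifT //; move: w10 w20; lia.
Qed.

Lemma act_lsig k w : 0 < (lsig k w).1 ->
  lsig k (act k w) = ((lsig k w).1.-1, (lsig k w).2.+1).
Proof.
elim: w => [|x w IHw]; first by rewrite /lsig big_nil.
rewrite /= lsig_cons /bmul /= => w0; case: ifP => [xw|].
  by rewrite lsig_cons IHw /bmul /=; [congr pair; move: w0 xw => /=; lia | lia].
rewrite lsig_cons /bmul /lsgn /=; move: w0; rewrite /lsgn /= eqxx.
case: (x.1 =P k) => [->|_] /=; last by lia.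
rewrite !(eqn_leq k.+1) !(eqn_leq k) ltnn leqnSn /= => _ /negbT; rewrite -leqNgt.
by case: (lsig k w) => a b /=; rewrite leqn0 => /eqP ->; congr pair; lia.
Qed.

End LetterWords.

(* A pattern records the semistandard tableau with entries 0, 1, 2 and row    *)
(* lengths l1, l2, l3: m1 and m2 are the numbers of entries < 2 in its first  *)
(* two rows, t is the number of entries 0.                                    *)
Record pat := Pat { l1 : nat; l2 : nat; l3 : nat; m1 : nat; m2 : nat; t0 : nat }.

Definition patP P := [&& l3 P <= m2 P, m2 P <= l2 P, l2 P <= m1 P, m1 P <= l1 P,
  m2 P <= t0 P & t0 P <= m1 P].

(** The signature of the row reading word, bottom row first. For k = 0 the 1s of the second row all
    cancel against 0s of the first, since [m2 <= t0]. *)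
Definition psig k P : nat * nat :=
  if k == 0 then (t0 P - m2 P, m1 P - t0 P)
  else bmul (m2 P - l3 P, l2 P - m2 P) (m1 P - t0 P, l1 P - m1 P).

(** For k = 1 the test decides whether the rightmost uncancelled 1 lies in the first row: there must
    be more 1s there than 2s in the second row. *)
Definition pat_f k P :=
  let: Pat l1 l2 l3 m1 m2 t := P in
  if k == 0 then Pat l1 l2 l3 m1 m2 t.-1
  else if l2 - m2 < m1 - t then Pat l1 l2 l3 m1.-1 m2 t else Pat l1 l2 l3 m1 m2.-1 t.

(* The first component is the row in which the shape grows. *)
Definition col_insert v P : nat * pat :=
  let: Pat l1 l2 l3 m1 m2 t := P in
  match v with
  | 0 => (0, Pat l1.+1 l2 l3 m1.+1 m2 t.+1)
  | 1 => if m2 < t then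
           if l2 < m1 then (1, Pat l1 l2.+1 l3 m1 m2.+1 t) else (0, Pat l1.+1 l2 l3 m1 m2.+1 t)
         else (0, Pat l1.+1 l2 l3 m1.+1 m2 t)
  | _ => if l3 < m2 then (2, Pat l1 l2 l3.+1 m1 m2 t)
         else if l2 < m1 then (1, Pat l1 l2.+1 l3 m1 m2 t) else (0, Pat l1.+1 l2 l3 m1 m2 t)
  end.

Ltac pat_cases :=
  repeat match goal with
  | |- context [if ?b then _ else _] => let E := fresh "E" in case E: b => /=
  end.

Lemma col_insert_patP v P : patP P -> patP (col_insert v P).2.
Proof.
case: P => a b c d e f; rewrite /patP /=.
by case: v => [|[|v]] /=; pat_cases; lia.
Qed.

Lemma col_insert_psig k v P : k < 2 -> v < 3 -> patP P ->
  psig k (col_insert v P).2 = bmul (lsgn k (v, 0)) (psig k P).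
Proof.
case: P => a b c d e f; rewrite /patP /psig /bmul /lsgn /=.
case: v => [|[|[|//]]]; case: k => [|[|//]] _ _ /=; pat_cases => H; congr pair; lia.
Qed.

(** Column insertion commutes with the crystal operators and the box is added in the same row. The
    two branches are those of [act]: the pivot lies in the tableau, or it is the inserted letter
    itself. *)
Lemma col_insert_pat_f k v P : k < 2 -> v < 3 -> patP P -> 0 < (bmul (lsgn k (v, 0)) (psig k P)).1 ->
  if nat_of_bool (v == k.+1) < (psig k P).1 then col_insert v (pat_f k P) = ((col_insert v P).1, pat_f k (col_insert v P).2)
  else col_insert k.+1 P = ((col_insert v P).1, pat_f k (col_insert v P).2).
Proof.
case: P => a b c d e f; rewrite /patP /psig /bmul /lsgn /=.
case: v => [|[|[|//]]]; case: k => [|[|//]] _ _ /=; pat_cases => /= H H';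
  try (exfalso; lia); rewrite /=; pat_cases; try (exfalso; lia); congr (_, Pat _ _ _ _ _ _); lia.
Qed.

(** Reverse bumping: the row where the shape grew tells which box to remove. *)
Lemma col_insert_inj v v' P P' : v < 3 -> v' < 3 -> patP P -> patP P' ->
  col_insert v P = col_insert v' P' -> v = v' /\ P = P'.
Proof.
case: P => a b c d e f; case: P' => a' b' c' d' e' f'; rewrite /patP /=.
case: v => [|[|[|//]]]; case: v' => [|[|[|//]]] _ _ /=; pat_cases => /= H H' [] *;
  try (exfalso; lia); split=> //; congr Pat; lia.
Qed.

Lemma iter_pf0 c P : patP P -> c <= (psig 0 P).1 ->
  iter c (pat_f 0) P = Pat (l1 P) (l2 P) (l3 P) (m1 P) (m2 P) (t0 P - c).
Proof.
case: P => a b d e f g; rewrite /patP /psig /= => HP.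
elim: c => [_|c IHc lec] /=; first by rewrite subn0.
by rewrite IHc; [congr Pat; lia | lia].
Qed.

(** The operator acts on the first row until the 1s there no longer outnumber the 2s of the second
    row, and on the second row from then on; [u] is the number of steps of the first kind. *)
Lemma iter_pf1 c P : patP P -> c <= (psig 1 P).1 ->
  iter c (pat_f 1) P =
    let u := minn c ((m1 P - t0 P) - (l2 P - m2 P)) in
    Pat (l1 P) (l2 P) (l3 P) (m1 P - u) (m2 P - (c - u)) (t0 P).
Proof.
case: P => a b d e f g; rewrite /patP /psig /bmul /= => HP.
elim: c => [_|c IHc lec] /=; first by rewrite min0n !subn0.
rewrite IHc; last by lia.
rewrite /=; move: lec; set D := (e - g) - (b - f) => lec; have [Dc|cD] := leqP D c.
  rewrite (minn_idPr (leqW Dc)) ifF; first by congr Pat; lia.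
  by apply/negbTE; rewrite -leqNgt; lia.
rewrite (minn_idPl cD) subnn subn0 ifT; last by lia.
by congr Pat; lia.
Qed.

(** Here (x, y, z, d, e, f) are the entries of a pattern. On one side of the braid identity the
    first row is changed [u] times by the operator 1, on the other [v] times and then [w] times. The
    two weight inequalities keep the truncated subtractions under control. *)
Lemma braid_arith a b x y z d e f : 
  [&& z <= e, e <= y, y <= d, d <= x, e <= f & f <= d] ->
  b + (d-f) <= f - e ->
  a + (x - d + ((y-e) - (d-f))) <= e - z + ((d-f) - (y-e)) ->
 let u := minn (a + b) (d - (f - b) - (y - e)) in
 let v := minn a (d - f - (y-e)) in 
 let w := minn b ((d-v) - (f-(a+b)) - (y - (e - (a-v)))) in
 d - u = d - v - w /\ e - (a+b-u) = e - (a-v) - (b-w).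
Proof.
have L g q c : c <= g -> g + q - (g - c) = q + c by lia.
case/and5P=> h1 h2 h3 h4 /andP[h5 h6].
have [p Ep] : exists p, y = e + p by exists (y-e); lia.
have [q Eq] : exists q, d = f + q by exists (d-f); lia.
rewrite Ep Eq !addKn => h7 h8.
have bf : b <= f by lia.
have abf : a + b <= f by clear L h1; lia.
move=> u v.
have va : v <= a by apply: geq_minl.
have Ev : v = minn a (q - p) by [].
clearbody v.
have vq : v <= q by clear L h1; lia.
have ave : a - v <= e by lia.
move=> w.
have {u}-> : u = minn (a + b) (q + b - p) by rewrite /u L.
have {w}-> : w = minn b (q - v + (a + b) - (p + (a - v))) by rewrite /w -addnBA // !L.
(* With p = y - e and q = d - f this is u = v + w; both branches of v = min(a, q - p) are linear. *)
have E : minn (a + b) (q + b - p) = v + minn b (q - v + (a + b) - (p + (a - v))).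
  by rewrite Ev; clear; case: (leqP q p) => ?; lia.
rewrite E; set w := minn _ _; have wb : w <= b by apply: geq_minl.
by split; clear -wb va; lia.
Qed.

Lemma pat_braid a b P : patP P ->
  b + (psig 0 P).2 <= (psig 0 P).1 -> a + (psig 1 P).2 <= (psig 1 P).1 ->
  a + b <= (psig 1 (iter b (pat_f 0) P)).1 -> a <= (psig 0 (iter (a + b) (pat_f 1) (iter b (pat_f 0) P))).1 ->
  a + b <= (psig 0 (iter a (pat_f 1) P)).1 -> b <= (psig 1 (iter (a + b) (pat_f 0) (iter a (pat_f 1) P))).1 ->
  patP (iter b (pat_f 0) P) -> patP (iter (a + b) (pat_f 1) (iter b (pat_f 0) P)) ->
  patP (iter a (pat_f 1) P) -> patP (iter (a + b) (pat_f 0) (iter a (pat_f 1) P)) ->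
  iter a (pat_f 0) (iter (a + b) (pat_f 1) (iter b (pat_f 0) P)) =
  iter b (pat_f 1) (iter (a + b) (pat_f 0) (iter a (pat_f 1) P)).
Proof.
move=> HP wb wa g1 g2 g1' g2' P1 P2 P1' P2'.
have gb : b <= (psig 0 P).1 := leq_trans (leq_addr _ _) wb.
have ga : a <= (psig 1 P).1 := leq_trans (leq_addr _ _) wa.
rewrite [iter a (pat_f 0) _]iter_pf0 // [iter (a + b) (pat_f 1) _]iter_pf1 //.
rewrite [iter b (pat_f 0) _]iter_pf0 //.
rewrite [iter b (pat_f 1) _]iter_pf1 // [iter (a + b) (pat_f 0) _]iter_pf0 //.
rewrite [iter a (pat_f 1) _]iter_pf1 //.
case: P HP wb wa {g1 g2 g1' g2' P1 P2 P1' P2' gb ga} => x y z d e f.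
rewrite /patP /psig /bmul /= => HP wb wa.
have [-> ->] := braid_arith HP wb wa.
by congr Pat; rewrite -subnDA addnC.
Qed.

(** * Column insertion as an injective encoding of words *)

Section Kappa.
Implicit Types (k : nat) (w : seq (nat * nat)).

Definition letters w := all (fun x => x.1 < 3) w.

(** The Robinson-Schensted correspondence, letters being inserted from right to left. The first
    component is the recording data, with the tags added; the second is the insertion tableau. *)
Fixpoint insertion w : seq (nat * nat) * pat :=
  if w is x :: w' then
    let: (Q, P) := insertion w' in (((col_insert x.1 P).1, x.2) :: Q, (col_insert x.1 P).2)
  else ([::], Pat 0 0 0 0 0 0).

Lemma insertion_cons x w : insertion (x :: w) =
  (((col_insert x.1 (insertion w).2).1, x.2) :: (insertion w).1, (col_insert x.1 (insertion w).2).2).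
Proof. by rewrite /=; case: (insertion w). Qed.

Lemma insertion_patP w : patP (insertion w).2.
Proof. by elim: w => [|x w IHw] //; rewrite insertion_cons col_insert_patP. Qed.

Lemma insertion_psig k w : k < 2 -> letters w -> psig k (insertion w).2 = lsig k w.
Proof.
move=> k2; elim: w => [_|x w IHw]; first by rewrite /lsig big_nil; case: k k2 => [|[|]].
rewrite lsig_cons /= => /andP[x3 lw]; rewrite -IHw //.
rewrite -[lsgn k x]/(lsgn k (x.1, 0)) -col_insert_psig //; last exact: insertion_patP.
by case: (insertion w).
Qed.

Lemma letters_act k w : k < 2 -> letters w -> letters (act k w).
Proof.
move=> k2; elim: w => //= x w IHw /andP[x3 lw].
by case: ifP => _ /=; rewrite ?x3 ?IHw // lw; rewrite /= ltnS k2.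
Qed.

Lemma insertion_act k w : k < 2 -> letters w -> 0 < (lsig k w).1 ->
  insertion (act k w) = ((insertion w).1, pat_f k (insertion w).2).
Proof.
move=> k2; elim: w => [_|x w IHw]; first by rewrite /lsig big_nil.
move=> /[dup] lxw /=/andP[x3 lw].
rewrite lsig_cons -(insertion_psig k2 lw) => w0.
have := @col_insert_pat_f k x.1 _ k2 x3 (insertion_patP w) w0.
case: ifP => [xw E|_ E].
  rewrite insertion_cons IHw //=; last by move: xw; rewrite (insertion_psig k2 lw); case: (lsig k w) => [[]].
  by rewrite E /=; case: (insertion w).
by rewrite insertion_cons /= E /=; case: (insertion w).
Qed.

Lemma insertion_inj w w' : letters w -> letters w' -> insertion w = insertion w' -> w = w'.
Proof.
elim: w w' => [|[v t] w IHw] [|[v' t'] w'] //; try by rewrite insertion_cons.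
move=> /=/andP[v3 lw] /andP[v3' lw'].
rewrite -/(insertion ((v, t) :: w)) -/(insertion ((v', t') :: w')) !insertion_cons /= => -[E1 -> EQ E2].
have [] := @col_insert_inj v v' (insertion w).2 (insertion w').2 v3 v3'; try exact: insertion_patP.
  by move: E1 E2; case: (col_insert v _) => ? ? /= -> ->; case: (col_insert v' _).
move=> -> EP; rewrite (IHw w') //.
by move: EQ EP; case: (insertion w) => ? ? /= -> ->; case: (insertion w').
Qed.

Lemma iter_act k c w : k < 2 -> letters w -> c <= (lsig k w).1 ->
  [/\ letters (iter c (act k) w), lsig k (iter c (act k) w) = ((lsig k w).1 - c, (lsig k w).2 + c) &
      insertion (iter c (act k) w) = ((insertion w).1, iter c (pat_f k) (insertion w).2)].
Proof.
move=> k2 lw; elim: c => [_|c IHc cw].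
  by split; rewrite //= ?subn0 ?addn0 -?surjective_pairing.
have [lc pc kc] := IHc (ltnW cw); have pc0 : 0 < (lsig k (iter c (act k) w)).1.
  by rewrite pc /= subn_gt0.
rewrite !iterS; split; first exact: letters_act.
  by rewrite act_lsig // pc /=; congr pair; lia.
by rewrite insertion_act // kc.
Qed.

(** Both sides have the recording data of [w], so by [insertion_inj] only the tableaux have to be
    compared. *)
Lemma word_braid a b w : letters w ->
  b + (lsig 0 w).2 <= (lsig 0 w).1 -> a + (lsig 1 w).2 <= (lsig 1 w).1 ->
  let w1 := iter b (act 0) w in let w2 := iter (a + b) (act 1) w1 in
  let w1' := iter a (act 1) w in let w2' := iter (a + b) (act 0) w1' in
  a + b <= (lsig 1 w1).1 -> a <= (lsig 0 w2).1 -> a + b <= (lsig 0 w1').1 -> b <= (lsig 1 w2').1 ->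
  iter a (act 0) w2 = iter b (act 1) w2'.
Proof.
move=> lw wb wa w1 w2 w1' w2' g1 g2 g1' g2'.
have [l1 _ k1] := @iter_act 0 b w isT lw (leq_trans (leq_addr _ _) wb).
have [l2 _ k2] := @iter_act 1 (a + b) w1 isT l1 g1.
have [l3 _ k3] := @iter_act 0 a w2 isT l2 g2.
have [l1' _ k1'] := @iter_act 1 a w isT lw (leq_trans (leq_addr _ _) wa).
have [l2' _ k2'] := @iter_act 0 (a + b) w1' isT l1' g1'.
have [l3' _ k3'] := @iter_act 1 b w2' isT l2' g2'.
apply: insertion_inj => //; rewrite k3 k3' k2 k2' k1 k1' /=; congr pair.
have e1 : iter b (pat_f 0) (insertion w).2 = (insertion w1).2 by rewrite k1.
have e1' : iter a (pat_f 1) (insertion w).2 = (insertion w1').2 by rewrite k1'.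
have e2 : iter (a + b) (pat_f 1) (insertion w1).2 = (insertion w2).2 by rewrite k2.
have e2' : iter (a + b) (pat_f 0) (insertion w1').2 = (insertion w2').2 by rewrite k2'.
by apply: pat_braid; rewrite ?e1 ?e1' ?e2 ?e2' ?insertion_patP ?insertion_psig.
Qed.

End Kappa.

(** * The operators on multiplicity matrices *)

Section TagWords.
Variables p q : nat -> nat.

(** Model of [W_i] and [W_i^*] in which a root is remembered only through its index that varies.
    Among roots sharing that index both orders put + before -. *)
Definition tagseg k := nseq (p k) (true, k) ++ nseq (q k) (false, k).
Definition tagw (L : seq nat) := flatten (map tagseg L).

Lemma tagw_cat L L' : tagw (L ++ L') = tagw L ++ tagw L'.
Proof. by rewrite /tagw map_cat flatten_cat. Qed.

Lemma wsig_tagseg k : wsig (tagseg k) = (p k, q k).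
Proof. by rewrite wsig_cat !wsig_nseq; congr pair => /=; lia. Qed.

Lemma wsig_tagw L : wsig (tagw L) = \bprod_(k <- L) (p k, q k).
Proof.
by rewrite /wsig /tagw big_flatten big_map; apply: eq_bigr => k _; rewrite -wsig_tagseg.
Qed.

Lemma count_tagw L s k : uniq L ->
  count_mem (s, k) (tagw L) = if k \in L then (if s then p k else q k) else 0.
Proof.
elim: L => [|h L IHL] //= /andP[hL uL].
rewrite /tagw /= !count_cat -/(tagw L) IHL // !count_nseq /= !xpair_eqE inE (eq_sym k h).
case: (h =P k) hL => [->|_ _]; last by rewrite !andbF.
by move=> /negPf->; clear IHL; case: s => /=; lia.
Qed.

Definition tag_le (lt : rel nat) (x y : bool * nat) :=
  lt x.2 y.2 || (x.2 == y.2) && (y.1 ==> x.1).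

Lemma pairwise_nseq T (r : rel T) k x : r x x -> pairwise r (nseq k x).
Proof. by move=> rx; elim: k => //= k ->; rewrite all_nseq rx orbT. Qed.

Lemma pairwise_tagw (lt : rel nat) L : pairwise lt L -> pairwise (tag_le lt) (tagw L).
Proof.
elim: L => [|h L IHL] //= /andP[hL /IHL pL].
have le_h s s' : (s' ==> s) -> tag_le lt (s, h) (s', h).
  by rewrite /tag_le eqxx => ->; rewrite orbT.
rewrite /tagw /= -/(tagw L) !pairwise_cat pL !pairwise_nseq ?le_h ?implybb // !andbT.
apply/andP; split.
  apply/allrelP => x [s k]; rewrite mem_cat => hx /flattenP[_ /mapP[h' h'L ->]] hk.
  have -> : k = h' by move: hk; rewrite mem_cat => /orP[] /nseqP[[]].
  have -> : x = (x.1, h) by case/orP: hx => /nseqP[->].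
  by rewrite /tag_le /= (allP hL).
by apply/allrelP => x y /nseqP[-> _] /nseqP[-> _]; apply: le_h.
Qed.

End TagWords.

(** * Kostant partitions as multiplicity matrices *)

Section Mult.
Variable n : nat.
Implicit Types (alpha beta : kostant n) (r : root n).

Definition mult alpha (a b : nat) : nat :=
  count (fun r => (fst_ix r == a :> nat) && (snd_ix r == b :> nat)) (enum_mset alpha).

Lemma root_inj r r' : fst_ix r = fst_ix r' -> snd_ix r = snd_ix r' -> r = r'.
Proof. by move=> e1 e2; apply: val_inj; apply: injective_projections. Qed.

Lemma mult_root alpha r : mult alpha (fst_ix r) (snd_ix r) = alpha r.
Proof.
rewrite /mult -count_mem_mset; apply: eq_count => r' /=.
by apply/andP/eqP => [[/eqP/val_inj e1 /eqP/val_inj e2]|->]; [apply: root_inj | rewrite !eqxx].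
Qed.

Lemma fst_lt_snd r : fst_ix r < snd_ix r. Proof. exact: (valP r). Qed.

Lemma mult_valid alpha a b : 0 < mult alpha a b -> (a < b) && (b < n).
Proof.
rewrite -has_count => /hasP[r _ /andP[/eqP <- /eqP <-]].
by rewrite fst_lt_snd ltn_ord.
Qed.

Lemma root_ex a b : a < b < n -> exists r : root n, fst_ix r = a :> nat /\ snd_ix r = b :> nat.
Proof.
case/andP=> ab bn; have an := ltn_trans ab bn.
by exists (@Root n (Ordinal an, Ordinal bn) ab).
Qed.

Lemma mult_inj alpha beta : mult alpha =2 mult beta -> alpha = beta.
Proof. by move=> E; apply/msetP => r; rewrite -!mult_root E. Qed.

Definition shift_root (a b a' b' : nat) (m : nat -> nat -> nat) x y :=
  m x y + ((x == a') && (y == b')) - ((x == a) && (y == b)).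

Lemma mult_replace alpha r (u : 'I_n * 'I_n) : r \in alpha -> u.1 < u.2 ->
  u != root_pair r ->
  mult (replace alpha r u) =2 shift_root (fst_ix r) (snd_ix r) u.1 u.2 (mult alpha).
Proof.
move=> ra u12 ur a b; have [ab|/negPf ab] := boolP (a < b < n); last first.
  rewrite /shift_root; have -> : mult (replace alpha r u) a b = 0.
    by apply/eqP; rewrite -leqn0 leqNgt; apply/negP => /mult_valid; rewrite ab.
  have -> : mult alpha a b = 0.
    by apply/eqP; rewrite -leqn0 leqNgt; apply/negP => /mult_valid; rewrite ab.
  suff -> : (a == u.1) && (b == u.2) = false by [].
  by apply/negP => /andP[/eqP Ea /eqP Eb]; move: ab; rewrite Ea Eb u12 ltn_ord.
have [r' [<- <-]] := root_ex ab.
rewrite /replace /shift_root !mult_root mset1DE msetB1E.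
have -> : (r' == insubd r u) = (fst_ix r' == u.1 :> nat) && (snd_ix r' == u.2 :> nat).
  rewrite -val_eqE val_insubd u12 /=; case: u {u12 ur} => u1 u2 /=.
  by rewrite /fst_ix /snd_ix; case: (root_pair r').
have <- : (r' == r) = (fst_ix r' == fst_ix r :> nat) && (snd_ix r' == snd_ix r :> nat).
  by apply/eqP/andP => [->|[/eqP/val_inj e1 /eqP/val_inj e2]]; [rewrite !eqxx | apply: root_inj].
have: 0 < alpha r by rewrite -in_mset.
by case: (r' =P r) => [->|_] /=; move: (_ && _) => c; case: c => /=; lia.
Qed.

End Mult.

Lemma red_sub (T : eqType) (w : seq (bool * T)) t :
  (t \in (red w).1 -> (true, t) \in w) /\ (t \in (red w).2 -> (false, t) \in w).
Proof.
elim: w => [|[s x] w [IHp IHm]] //=; case: (red w) IHp IHm => P M /= IHp IHm.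
case: s => /=.
  split; rewrite !inE !xpair_eqE /=; last by move=> /IHm->.
  by case/orP => [->//|/IHp->]; rewrite orbT.
case: P IHp => [|p P] /= IHp; split=> //.
- by rewrite !inE xpair_eqE /= => /orP[->//|/IHm->]; rewrite orbT.
- by move=> tP; rewrite inE IHp ?orbT // inE tP orbT.
- by move=> /IHm tw; rewrite inE tw orbT.
Qed.

(** * The words [W_i] and [W_i^*] in terms of multiplicities *)

Section Words.
Variables (n : nat) (i : 'I_n.-1).
Implicit Types (alpha beta : kostant n) (r : root n).

Lemma lo_hi : lo i == hi i = false.
Proof. by rewrite -val_eqE /= ltn_eqF. Qed.

Lemma symbE r : symb i r = if (snd_ix r == lo i) || (snd_ix r == hi i)
  then Some (snd_ix r == lo i, r) else None.
Proof. by rewrite /symb; case: (_ == lo i) => //=; case: (_ == hi i). Qed.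

Lemma symb_starE r : symb_star i r = if (fst_ix r == hi i) || (fst_ix r == lo i)
  then Some (fst_ix r == hi i, r) else None.
Proof. by rewrite /symb_star; case: (_ == hi i) => //=; case: (_ == lo i). Qed.

Lemma pmap_filter_map T U (P : pred T) (f : T -> U) s :
  pmap (fun x => if P x then Some (f x) else None) s = [seq f x | x <- s & P x].
Proof. by elim: s => //= x s ->; case: (P x). Qed.

Lemma WE alpha : W i alpha = [seq (snd_ix r == lo i, r) | r <- sort (@ord_W n) (enum_mset alpha)
  & (snd_ix r == lo i) || (snd_ix r == hi i)].
Proof. by rewrite /W (eq_pmap symbE) pmap_filter_map. Qed.

Lemma WstarE alpha : Wstar i alpha =
  [seq (fst_ix r == hi i, r) | r <- sort (@ord_Wstar n) (enum_mset alpha)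
  & (fst_ix r == hi i) || (fst_ix r == lo i)].
Proof. by rewrite /Wstar (eq_pmap symb_starE) pmap_filter_map. Qed.

Lemma ord_W_total : total (@ord_W n).
Proof. by move=> r r'; rewrite /ord_W -!val_eqE /=; lia. Qed.

Lemma ord_W_trans : transitive (@ord_W n).
Proof. by move=> r r' r''; rewrite /ord_W -!val_eqE /=; lia. Qed.

Lemma ord_Wstar_total : total (@ord_Wstar n).
Proof. by move=> r r'; rewrite /ord_Wstar -!val_eqE /=; lia. Qed.

Lemma ord_Wstar_trans : transitive (@ord_Wstar n).
Proof. by move=> r r' r''; rewrite /ord_Wstar -!val_eqE /=; lia. Qed.

Lemma tag_le_trans (lt : rel nat) : transitive lt -> transitive (tag_le lt).
Proof.
move=> tr [b y] [a x] [c z]; rewrite /tag_le /=.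
case/orP => [xy|/andP[/eqP -> ba]] /orP[yz|/andP[/eqP <- cb]].
- by rewrite (tr _ _ _ xy yz).
- by rewrite xy.
- by rewrite yz.
- by rewrite eqxx /=; case: a b c ba cb => [] [] []; rewrite ?orbT.
Qed.

Lemma tag_le_anti (lt : rel nat) : (forall x y, lt x y -> lt y x = false) ->
  antisymmetric (tag_le lt).
Proof.
move=> anti [a x] [b y]; rewrite /tag_le /= [y == x]eq_sym => /andP[].
case: (x =P y) => [->|_]; last by rewrite !orbF => /anti->.
have -> /= : lt y y = false by apply/negP => /[dup] /anti ->.
by case: a b => [] [].
Qed.

(** Both words are sorted for the antisymmetric relation [tag_le] and contain each tagged sign
    equally often, hence coincide. [Wstar_tagw] is proved in the same way. *)
Lemma W_tagw alpha :
  [seq (x.1, val (fst_ix x.2)) | x <- W i alpha] =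
  tagw ((mult alpha)^~ i) ((mult alpha)^~ i.+1) (rev (iota 0 n)).
Proof.
apply: (@sorted_eq _ (tag_le gtn)).
- by apply: tag_le_trans => x y z /= yx zx; apply: ltn_trans yx.
- by apply: tag_le_anti => x y /=; lia.
- rewrite WE -map_comp; pose P r := (snd_ix r == lo i) || (snd_ix r == hi i).
  apply: (@homo_sorted_in _ _ P _ (@ord_W n)); last 2 first.
  + by apply/allP => r; rewrite mem_filter => /andP[].
  + by apply: (sorted_filter ord_W_trans); apply: sort_sorted; exact: ord_W_total.
  move=> r r'; rewrite /P /ord_W /tag_le /= -!val_eqE /= => /orP[] /eqP -> /orP[] /eqP -> /=; lia.
- rewrite sorted_pairwise; last by apply: tag_le_trans => x y z /= yx zx; apply: ltn_trans yx.
  apply: pairwise_tagw; rewrite -sorted_pairwise; last by move=> x y z /= yx zx; apply: ltn_trans yx.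
  by rewrite rev_sorted; exact: iota_ltn_sorted.
apply/allP => -[s k] _ /=; rewrite count_tagw ?rev_uniq ?iota_uniq //.
rewrite mem_rev mem_iota add0n /= WE -map_comp count_map count_filter.
rewrite (seq.permP (permEl (perm_sort _ _))).
have -> : (if k < n then if s then mult alpha k i else mult alpha k i.+1 else 0) =
  mult alpha k (if s then i : nat else i.+1).
  case: ltnP => [_|nk]; first by case: s.
  by apply/esym/eqP; rewrite -leqn0 leqNgt; apply/negP => /mult_valid; lia.
apply/eqP/eq_count => r /=; rewrite xpair_eqE -!val_eqE /=.
by case: s => /=; lia.
Qed.

Lemma Wstar_tagw alpha :
  [seq (x.1, val (snd_ix x.2)) | x <- Wstar i alpha] = tagw (mult alpha i.+1) (mult alpha i) (iota 0 n).
Proof.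
apply: (@sorted_eq _ (tag_le ltn)).
- by apply: tag_le_trans => x y z /= ; apply: ltn_trans.
- by apply: tag_le_anti => x y /=; lia.
- rewrite WstarE -map_comp; pose P r := (fst_ix r == hi i) || (fst_ix r == lo i).
  apply: (@homo_sorted_in _ _ P _ (@ord_Wstar n)); last 2 first.
  + by apply/allP => r; rewrite mem_filter => /andP[].
  + by apply: (sorted_filter ord_Wstar_trans); apply: sort_sorted; exact: ord_Wstar_total.
  move=> r r'; rewrite /P /ord_Wstar /tag_le /= -!val_eqE /= => /orP[] /eqP -> /orP[] /eqP -> /=; lia.
- rewrite sorted_pairwise; last by apply: tag_le_trans => x y z /=; apply: ltn_trans.
  apply: pairwise_tagw; rewrite -sorted_pairwise; last exact: ltn_trans.
  exact: iota_ltn_sorted.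
apply/allP => -[s k] _ /=; rewrite count_tagw ?iota_uniq //.
rewrite mem_iota add0n /= WstarE -map_comp count_map count_filter.
rewrite (seq.permP (permEl (perm_sort _ _))).
have -> : (if k < n then if s then mult alpha i.+1 k else mult alpha i k else 0) =
  mult alpha (if s then i.+1 : nat else i) k.
  case: ltnP => [_|nk]; first by case: s.
  by apply/esym/eqP; rewrite -leqn0 leqNgt; apply/negP => /mult_valid; lia.
apply/eqP/eq_count => r /=; rewrite xpair_eqE -!val_eqE /=.
by case: s => /=; lia.
Qed.

End Words.

(* Reduced forms of the parts of the words W_i^* and W_i coming from the roots *)
(* (., b), resp. (h, .), with lo <= b < hi, resp. lo <= h < hi; W_i lists the  *)
(* roots by decreasing h, whence the opposite product.                         *)
Definition Ssig (m : nat -> nat -> nat) i lo hi :=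
  \big[bmul/(0, 0)]_(lo <= b < hi) (m i.+1 b, m i b).
Definition Rsig (m : nat -> nat -> nat) i lo hi :=
  \big[bmulr/(0, 0)]_(lo <= h < hi) (m h i, m h i.+1).

Lemma Ssig_cat m i a b c : a <= b <= c -> Ssig m i a c = bmul (Ssig m i a b) (Ssig m i b c).
Proof. by case/andP=> ab bc; rewrite /Ssig (big_cat_nat ab bc). Qed.

Lemma Rsig_cat m i a b c : a <= b <= c -> Rsig m i a c = bmul (Rsig m i b c) (Rsig m i a b).
Proof. by case/andP=> ab bc; rewrite /Rsig (big_cat_nat ab bc). Qed.

Lemma Ssig1 m i a : Ssig m i a a.+1 = (m i.+1 a, m i a).
Proof. exact: big_nat1. Qed.

Lemma Rsig1 m i a : Rsig m i a a.+1 = (m a i, m a i.+1).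
Proof. exact: big_nat1. Qed.

Lemma Ssig_split m i b n : b < n ->
  Ssig m i 0 n = bmul (Ssig m i 0 b) (bmul (m i.+1 b, m i b) (Ssig m i b.+1 n)).
Proof.
move=> bn; rewrite (@Ssig_cat _ _ 0 b n) ?(@Ssig_cat _ _ b b.+1 n) ?Ssig1 //; first by rewrite leqnSn.
exact: ltnW.
Qed.

Lemma Rsig_split m i h n : h < n ->
  Rsig m i 0 n = bmul (Rsig m i h.+1 n) (bmul (m h i, m h i.+1) (Rsig m i 0 h)).
Proof.
move=> hn; rewrite (@Rsig_cat _ _ 0 h n) ?(@Rsig_cat _ _ h h.+1 n) ?Rsig1 ?bmulA //; first by rewrite leqnSn.
exact: ltnW.
Qed.

Lemma wsig_tagw_iota m i b d : wsig (tagw (m i.+1) (m i) (iota b d)) = Ssig m i b (b + d).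
Proof. by rewrite wsig_tagw /Ssig /index_iota addKn. Qed.

Lemma wsig_tagw_rev m i b d :
  wsig (tagw (m^~ i) (m^~ i.+1) (rev (iota b d))) = Rsig m i b (b + d).
Proof. by rewrite wsig_tagw /Rsig /index_iota addKn rev_big_rev. Qed.

Lemma iota_split n b : b < n -> iota 0 n = iota 0 b ++ b :: iota b.+1 (n - b.+1).
Proof. by move=> bn; rewrite -{1}(subnKC bn) addSnnS iotaD add0n. Qed.

(* f_i at the level of multiplicities: in both cases the hypotheses locate     *)
(* the rightmost uncancelled + of the word W_i^* W_i.                          *)
Variant fstep n i m m' : Prop :=
| FStar b of b < n & (Ssig m i 0 b).2 < m i.+1 b
    & (bmul (Ssig m i b.+1 n) (Rsig m i 0 n)).1 <= m i b
    & m' =2 shift_root i.+1 b i b m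
| FNons h of h < n & (bmul (Ssig m i 0 n) (Rsig m i h.+1 n)).2 < m h i
    & (Rsig m i 0 h).1 <= m h i.+1
    & m' =2 shift_root h i h i.+1 m.

(* Likewise for e_i and the leftmost uncancelled -, which must not lie below   *)
(* the simple root.                                                            *)
Variant estep n i m m' : Prop :=
| EStar b of b < n & b != i.+1 & (Ssig m i 0 b).2 <= m i.+1 b
    & (bmul (Ssig m i b.+1 n) (Rsig m i 0 n)).1 < m i b
    & m' =2 shift_root i b i.+1 b m
| ENons h of h < n & h != i & (bmul (Ssig m i 0 n) (Rsig m i h.+1 n)).2 <= m h i
    & (Rsig m i 0 h).1 < m h i.+1
    & m' =2 shift_root h i.+1 h i m.

(** Locates the rightmost uncancelled + of a word preceded by [c] symbols -. Either the first
    segment contains it, or the segment is absorbed into a new value of [c]. *)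
Lemma Rsig_pivot m i c k : c < (Rsig m i 0 k).1 ->
  exists2 h, h < k & (bmul (0, c) (Rsig m i h.+1 k)).2 < m h i /\ (Rsig m i 0 h).1 <= m h i.+1.
Proof.
elim: k c => [|k IHk] c; first by rewrite /Rsig big_geq.
rewrite (@Rsig_cat _ _ 0 k) ?leqnSn // Rsig1 /bmul /= => ck.
have [Rq|qR] := leqP (Rsig m i 0 k).1 (m k i.+1).
  exists k => //; split=> //; rewrite /Rsig big_geq //=; lia.
have [|h hk [E1 E2]] := IHk (m k i.+1 + (c - m k i)); first by lia.
exists h; first exact: ltnW; split=> //.
by rewrite (@Rsig_cat _ _ h.+1 k) ?Rsig1 ?hk ?leqnSn //; move: E1; rewrite /bmul /=; lia.
Qed.

(** The analogue for increasing indices, with a word [T] on the right; the bound on [T.1] says that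
    every + of [T] is cancelled, so the pivot lies to its left. *)
Lemma Ssig_pivot m i n T d lo c : lo + d = n ->
  c < (bmul (Ssig m i lo n) T).1 -> T.1 <= (bmul (0, c) (Ssig m i lo n)).2 ->
  exists2 b, lo <= b < n & (bmul (0, c) (Ssig m i lo b)).2 < m i.+1 b /\
    (bmul (Ssig m i b.+1 n) T).1 <= m i b.
Proof.
elim: d lo c => [|d IHd] lo c.
  by rewrite addn0 => ->; rewrite /Ssig big_geq // /bmul /=; lia.
move=> En; have ln : lo < n by lia.
rewrite (@Ssig_cat _ _ lo lo.+1 n) ?leqnSn // Ssig1 => c1 c2.
have [Tq|qT] := leqP (bmul (Ssig m i lo.+1 n) T).1 (m i lo).
  exists lo; rewrite ?leqnn //; split=> //; rewrite /Ssig big_geq //=.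
  by move: c1 Tq; rewrite /bmul /=; lia.
have [|||b /andP[lb bn] [E1 E2]] := IHd lo.+1 (m i lo + (c - m i.+1 lo)); first by lia.
- by move: c1 qT; rewrite /bmul /=; lia.
- by move: c2; rewrite /bmul /=; lia.
exists b; first by rewrite bn ltnW.
split=> //; rewrite (@Ssig_cat _ _ lo lo.+1 b) ?Ssig1 ?leqnSn //.
by move: E1; rewrite /bmul /=; lia.
Qed.

Lemma fstep_ex n i m :
  0 < (bmul (Ssig m i 0 n) (Rsig m i 0 n)).1 -> exists m', fstep n i m m'.
Proof.
have [sr|rs] := ltnP (Ssig m i 0 n).2 (Rsig m i 0 n).1 => tot0.
  have [h hn [E1 E2]] := Rsig_pivot sr.
  by exists (shift_root h i h i.+1 m); apply: (FNons hn).
have [|||b /andP[_ bn] [E1 E2]] := @Ssig_pivot m i n (Rsig m i 0 n) n 0 0 => //.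
- by move: rs; rewrite /bmul /=; lia.
by exists (shift_root i.+1 b i b m); apply: (FStar bn) => //; move: E1; rewrite /bmul /=; lia.
Qed.

Lemma tagw_plus p q L1 L2 k : (\bprod_(x <- L1) (p x, q x)).2 < p k ->
  (\bprod_(x <- L2) (p x, q x)).1 <= q k ->
  exists P, (red (tagw p q (L1 ++ k :: L2))).1 = rcons P k.
Proof.
rewrite -!wsig_tagw tagw_cat => E1 E2; rewrite -cat1s tagw_cat /tagw /= cats0 /tagseg.
rewrite -!/(tagw p q _); move: E1 E2; case: (p k) => // p'; rewrite ltnS => E1 E2.
have -> : nseq p'.+1 (true, k) = nseq p' (true, k) ++ [:: (true, k)].
  by rewrite -[[:: _]]/(nseq 1 (true, k)) -nseqD addn1.
rewrite -!catA /= catA; apply: red_plus.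
  by rewrite wsig_cat wsig_nseq /bmul /=; lia.
by rewrite wsig_cat wsig_nseq /bmul /=; lia.
Qed.

Lemma tagw_minus p q L1 L2 k : (\bprod_(x <- L1) (p x, q x)).2 <= p k ->
  (\bprod_(x <- L2) (p x, q x)).1 < q k ->
  exists M, (red (tagw p q (L1 ++ k :: L2))).2 = k :: M.
Proof.
rewrite -!wsig_tagw tagw_cat => E1 E2; rewrite -cat1s tagw_cat /tagw /= cats0 /tagseg.
rewrite -!/(tagw p q _); move: E1 E2; case: (q k) => // q'; rewrite ltnS => E1 E2.
rewrite -!catA /= catA; apply: red_minus.
  by rewrite wsig_cat wsig_nseq /bmul /=; lia.
by rewrite wsig_cat wsig_nseq /bmul /=; lia.
Qed.

Lemma mem_rcons_last (T : eqType) (s : seq T) x : x \in rcons s x.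
Proof. by rewrite mem_rcons mem_head. Qed.

(** * The operators on partitions agree with the steps on matrices *)

Section Bridge.
Variables (n : nat) (i : 'I_n.-1).
Implicit Types (alpha beta : kostant n) (r : root n).

Lemma wsig_map T T' (g : T -> T') (w : seq (bool * T)) : wsig [seq (x.1, g x.2) | x <- w] = wsig w.
Proof. by rewrite /wsig big_map. Qed.

Lemma size_W alpha :
  (size (pluses (reduce (W i alpha))), size (minuses (reduce (W i alpha)))) =
  Rsig (mult alpha) i 0 n.
Proof.
rewrite pluses_reduce minuses_reduce size_red -(wsig_map (fun r => val (fst_ix r))).
by rewrite W_tagw wsig_tagw_rev.
Qed.

Lemma size_Wstar alpha :
  (size (pluses (reduce (Wstar i alpha))), size (minuses (reduce (Wstar i alpha)))) =
  Ssig (mult alpha) i 0 n.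
Proof.
rewrite pluses_reduce minuses_reduce size_red -(wsig_map (fun r => val (snd_ix r))).
by rewrite Wstar_tagw wsig_tagw_iota.
Qed.

Lemma red_W alpha : red (tagw ((mult alpha)^~ i) ((mult alpha)^~ i.+1) (rev (iota 0 n))) =
  ([seq val (fst_ix r) | r <- pluses (reduce (W i alpha))],
   [seq val (fst_ix r) | r <- minuses (reduce (W i alpha))]).
Proof.
by rewrite -W_tagw (red_map (fun r => val (fst_ix r))) pluses_reduce minuses_reduce.
Qed.

Lemma red_Wstar alpha : red (tagw (mult alpha i.+1) (mult alpha i) (iota 0 n)) =
  ([seq val (snd_ix r) | r <- pluses (reduce (Wstar i alpha))],
   [seq val (snd_ix r) | r <- minuses (reduce (Wstar i alpha))]).
Proof.
by rewrite -Wstar_tagw (red_map (fun r => val (snd_ix r))) pluses_reduce minuses_reduce.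
Qed.

Lemma mem_W alpha s r : (s, r) \in W i alpha ->
  r \in alpha /\ snd_ix r = if s then lo i else hi i.
Proof.
rewrite WE => /mapP[r']; rewrite mem_filter mem_sort => /andP[/orP rP ra] [-> ->].
by split=> //; case: eqP rP => // _ [//|/eqP].
Qed.

Lemma mem_Wstar alpha s r : (s, r) \in Wstar i alpha ->
  r \in alpha /\ fst_ix r = if s then hi i else lo i.
Proof.
rewrite WstarE => /mapP[r']; rewrite mem_filter mem_sort => /andP[/orP rP ra] [-> ->].
by split=> //; case: eqP rP => // _ [//|/eqP].
Qed.

Lemma f_op_fstep alpha m' : fstep n i (mult alpha) m' ->
  exists2 beta, f_op i alpha = Some beta & mult beta =2 m'.
Proof.
set m := mult alpha; rewrite /f_op.
have := red_Wstar alpha; have := red_W alpha.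
have := size_Wstar alpha; have := size_W alpha; rewrite -/m.
have memW r : r \in pluses (reduce (W i alpha)) -> r \in alpha /\ snd_ix r = lo i.
  by rewrite pluses_reduce => /(proj1 (red_sub _ _))/mem_W.
have memS r : r \in pluses (reduce (Wstar i alpha)) -> r \in alpha /\ fst_ix r = hi i.
  by rewrite pluses_reduce => /(proj1 (red_sub _ _))/mem_Wstar.
move: (pluses (reduce (W i alpha))) (minuses (reduce (W i alpha))) memW => PW MW memW.
move: (pluses (reduce (Wstar i alpha))) (minuses (reduce (Wstar i alpha))) memS => PS MS memS.
move=> sW sS rW rS; case=> [b bn E1 E2 Em'|h hn E1 E2 Em'].
  have [||P] := @tagw_plus (m i.+1) (m i) (iota 0 b) (iota b.+1 (n - b.+1)) b.
  - by rewrite -wsig_tagw wsig_tagw_iota.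
  - rewrite -wsig_tagw wsig_tagw_iota subnKC //; apply: leq_trans E2; exact: leq_addr.
  rewrite -iota_split // rS /=; case/lastP: PS memS sS {rS} => [|PS r] memS sS.
    by case: P.
  rewrite map_rcons rev_rcons => /rcons_inj[_ Eb].
  have [ra fr] := memS r (mem_rcons_last _ _).
  (* The pivot inequalities force at least as many surviving - in [W_i^*] as surviving + in [W_i],
     which is the branch of [f_op] acting through [W_i^*]. *)
  rewrite ifF; last first.
    move: (Ssig_split m i bn); rewrite -sS => /(congr1 snd).
    by move: E1 E2; rewrite -sW /bmul /=; lia.
  exists (replace alpha r (lo i, snd_ix r)) => // x y.
  rewrite Em' mult_replace //=; first by rewrite fr Eb.
    by rewrite (leq_trans _ (fst_lt_snd r)) // fr /=.
  by apply/eqP => Er; move: fr; rewrite /fst_ix -Er => /(congr1 val)/=; lia.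
have [||P] := @tagw_plus (m^~ i) (m^~ i.+1) (rev (iota h.+1 (n - h.+1))) (rev (iota 0 h)) h.
- rewrite -wsig_tagw wsig_tagw_rev subnKC //; apply: leq_ltn_trans E1; exact: leq_addr.
- by rewrite -wsig_tagw wsig_tagw_rev.
rewrite -cat_rcons -rev_cons -rev_cat -iota_split // rW /=.
case/lastP: PW memW sW {rW} => [|PW r] memW sW.
  by case: P.
rewrite map_rcons rev_rcons => /rcons_inj[_ Eb].
have [ra fr] := memW r (mem_rcons_last _ _).
rewrite ifT; last first.
  move: (Rsig_split m i hn); rewrite -sW => /(congr1 fst).
  by move: E1 E2; rewrite -sS /bmul /=; lia.
exists (replace alpha r (fst_ix r, hi i)) => // x y.
rewrite Em' mult_replace //=; first by rewrite fr Eb.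
  by have := fst_lt_snd r; rewrite fr /=; lia.
by apply/eqP => Er; move: fr; rewrite /snd_ix -Er => /(congr1 val)/=; lia.
Qed.

Lemma e_op_estep alpha m' : estep n i (mult alpha) m' ->
  exists2 beta, e_op i alpha = Some beta & mult beta =2 m'.
Proof.
set m := mult alpha; rewrite /e_op.
have := red_Wstar alpha; have := red_W alpha.
have := size_Wstar alpha; have := size_W alpha; rewrite -/m.
have memW r : r \in minuses (reduce (W i alpha)) -> r \in alpha /\ snd_ix r = hi i.
  by rewrite minuses_reduce => /(proj2 (red_sub _ _))/mem_W.
have memS r : r \in minuses (reduce (Wstar i alpha)) -> r \in alpha /\ fst_ix r = lo i.
  by rewrite minuses_reduce => /(proj2 (red_sub _ _))/mem_Wstar.
move: (pluses (reduce (W i alpha))) (minuses (reduce (W i alpha))) memW => PW MW memW.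
move: (pluses (reduce (Wstar i alpha))) (minuses (reduce (Wstar i alpha))) memS => PS MS memS.
move=> sW sS rW rS; case=> [b bn nb E1 E2 Em'|h hn nh E1 E2 Em'].
  have [||M] := @tagw_minus (m i.+1) (m i) (iota 0 b) (iota b.+1 (n - b.+1)) b.
  - by rewrite -wsig_tagw wsig_tagw_iota.
  - rewrite -wsig_tagw wsig_tagw_iota subnKC //; apply: leq_ltn_trans E2; exact: leq_addr.
  rewrite -iota_split // rS /=; case: MS memS sS {rS} => [//|r MS] memS sS [Eb _].
  have [ra fr] := memS r (mem_head _ _).
  rewrite ifF; last first.
    move: (Ssig_split m i bn); rewrite -sS => /(congr1 snd).
    by move: E1 E2; rewrite -sW /bmul /=; lia.
  rewrite ifF; last by apply/negP => /eqP Er; move: nb; rewrite -Eb /snd_ix Er /= eqxx.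
  have lt_hi : hi i < snd_ix r.
    by have := fst_lt_snd r; move: nb; rewrite fr -Eb /=; lia.
  exists (replace alpha r (hi i, snd_ix r)) => // x y.
  rewrite Em' mult_replace //=; first by rewrite fr Eb.
  by apply/eqP => Er; move: fr; rewrite /fst_ix -Er => /(congr1 val)/=; lia.
have [||M] := @tagw_minus (m^~ i) (m^~ i.+1) (rev (iota h.+1 (n - h.+1))) (rev (iota 0 h)) h.
- rewrite -wsig_tagw wsig_tagw_rev subnKC //; apply: leq_trans E1; exact: leq_addr.
- by rewrite -wsig_tagw wsig_tagw_rev.
rewrite -cat_rcons -rev_cons -rev_cat -iota_split // rW /=.
case: MW memW sW {rW} => [//|r MW] memW sW [Eb _].
have [ra fr] := memW r (mem_head _ _).
rewrite ifT; last first.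
  move: (Rsig_split m i hn); rewrite -sW => /(congr1 fst).
  by move: E1 E2; rewrite -sS /bmul /=; lia.
rewrite ifF; last by apply/negP => /eqP Er; move: nh; rewrite -Eb /fst_ix Er /= eqxx.
have lt_lo : fst_ix r < lo i.
  by have := fst_lt_snd r; move: nh; rewrite fr -Eb /=; lia.
exists (replace alpha r (fst_ix r, lo i)) => // x y.
rewrite Em' mult_replace //=; first by rewrite fr Eb.
by apply/eqP => Er; move: fr; rewrite /snd_ix -Er => /(congr1 val)/=; lia.
Qed.

End Bridge.

Lemma eq_Ssig m m' i lo hi :
  (forall b, lo <= b < hi -> m i.+1 b = m' i.+1 b /\ m i b = m' i b) ->
  Ssig m i lo hi = Ssig m' i lo hi.
Proof. by move=> E; apply: eq_big_nat => b /E[-> ->]. Qed.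

Lemma eq_Rsig m m' i lo hi :
  (forall h, lo <= h < hi -> m h i = m' h i /\ m h i.+1 = m' h i.+1) ->
  Rsig m i lo hi = Rsig m' i lo hi.
Proof. by move=> E; apply: eq_big_nat => b /E[-> ->]. Qed.

Lemma shift_rootK a b a' b' m : 0 < m a b -> ~~ ((a == a') && (b == b')) ->
  shift_root a' b' a b (shift_root a b a' b' m) =2 m.
Proof.
move=> m0 ne x y; rewrite /shift_root.
by case: (x =P a) => [->|_]; case: (y =P b) => [->|_]; lia.
Qed.

Lemma eq_shift_root a b a' b' m m' : m =2 m' -> shift_root a b a' b' m =2 shift_root a b a' b' m'.
Proof. by move=> E x y; rewrite /shift_root E. Qed.

Definition valid n (m : nat -> nat -> nat) := forall a b, 0 < m a b -> a < b < n.
Definition Tsig n i m := bmul (Ssig m i 0 n) (Rsig m i 0 n).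

Lemma valid0 n m a b : valid n m -> ~~ (a < b < n) -> m a b = 0.
Proof. by move=> vm; apply: contraNeq; rewrite -lt0n => /vm. Qed.

(** Changing the pivot from + to - turns the inequalities locating the rightmost uncancelled + into
    those locating the leftmost uncancelled -. That - is not below the simple root, as validity of
    [m] separates the indices of the root moved. *)
Lemma fstep_estep n i m m' : valid n m -> fstep n i m m' -> estep n i m' m.
Proof.
move=> vm [b bn E1 E2 Em|h hn E1 E2 Em].
  have ib : i.+1 < b by have := vm i.+1 b; case: (m i.+1 b) E1 => // k _ /(_ isT) /andP[].
  have ES lo hi : (b < lo) || (hi <= b) -> Ssig m' i lo hi = Ssig m i lo hi.
    by move=> lohi; apply: eq_Ssig => c lhc; rewrite !Em /shift_root; split; lia.
  have ER lo hi : Rsig m' i lo hi = Rsig m i lo hi.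
    by apply: eq_Rsig => h _; rewrite !Em /shift_root; split; lia.
  apply: (@EStar _ _ _ _ b); rewrite ?ES ?ER ?Em ?leqnn ?orbT ?ltnSn //; try by rewrite /shift_root; lia.
  by move=> x y; rewrite (eq_shift_root _ _ _ _ Em) shift_rootK //; lia.
have hi : h < i by have := vm h i; case: (m h i) E1 => // k _ /(_ isT) /andP[].
have ER lo hi' : (h < lo) || (hi' <= h) -> Rsig m' i lo hi' = Rsig m i lo hi'.
  by move=> lohi; apply: eq_Rsig => c lhc; rewrite !Em /shift_root; split; lia.
have ES lo hi' : Ssig m' i lo hi' = Ssig m i lo hi'.
  by apply: eq_Ssig => c _; rewrite !Em /shift_root; split; lia.
apply: (@ENons _ _ _ _ h); rewrite ?ES ?ER ?Em ?leqnn ?orbT ?ltnSn //; try by rewrite /shift_root; lia.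
by move=> x y; rewrite (eq_shift_root _ _ _ _ Em) shift_rootK //; lia.
Qed.

Lemma fstep_Tsig n i m m' : valid n m -> fstep n i m m' ->
  0 < (Tsig n i m).1 /\ Tsig n i m' = ((Tsig n i m).1.-1, (Tsig n i m).2.+1).
Proof.
rewrite /Tsig => vm [b bn E1 E2 Em|h hn E1 E2 Em].
  have ib : i.+1 < b by have := vm i.+1 b; case: (m i.+1 b) E1 => // k _ /(_ isT) /andP[].
  rewrite !(Ssig_split _ _ bn) -!bmulA.
  have -> : Ssig m' i 0 b = Ssig m i 0 b.
    by apply: eq_Ssig => c lhc; rewrite !Em /shift_root; split; lia.
  have -> : Ssig m' i b.+1 n = Ssig m i b.+1 n.
    by apply: eq_Ssig => c lhc; rewrite !Em /shift_root; split; lia.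
  have -> : Rsig m' i 0 n = Rsig m i 0 n.
    by apply: eq_Rsig => h _; rewrite !Em /shift_root; split; lia.
  have [-> ->] : m' i.+1 b = (m i.+1 b).-1 /\ m' i b = (m i b).+1.
    by rewrite !Em /shift_root; split; lia.
  by move: E1 E2; rewrite /bmul /= => *; split; [lia | congr pair; lia].
have hi : h < i by have := vm h i; case: (m h i) E1 => // k _ /(_ isT) /andP[].
rewrite !(Rsig_split _ _ hn) !bmulA.
have -> : Ssig m' i 0 n = Ssig m i 0 n.
  by apply: eq_Ssig => c lhc; rewrite !Em /shift_root; split; lia.
have -> : Rsig m' i 0 h = Rsig m i 0 h.
  by apply: eq_Rsig => c lhc; rewrite !Em /shift_root; split; lia.
have -> : Rsig m' i h.+1 n = Rsig m i h.+1 n.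
  by apply: eq_Rsig => c lhc; rewrite !Em /shift_root; split; lia.
have [-> ->] : m' h i = (m h i).-1 /\ m' h i.+1 = (m h i.+1).+1.
  by rewrite !Em /shift_root; split; lia.
by move: E1 E2; rewrite -bmulA /bmul /= => *; split; [lia | congr pair; lia].
Qed.

Section FOp.
Variables (n : nat) (i : 'I_n.-1).
Implicit Types (alpha beta : kostant n) (r : root n).

Lemma mult_validP alpha : valid n (mult alpha).
Proof. by move=> a b /mult_valid. Qed.

(** If [f_op] is defined then some + survives, so a step exists by [fstep_ex]; by [f_op_fstep] its
    target is the value of the function [f_op]. *)
Lemma f_opP alpha beta : f_op i alpha = Some beta <-> fstep n i (mult alpha) (mult beta).
Proof.
split=> [fab|/f_op_fstep[b' -> /mult_inj ->]//].
have [|m' Hm'] := @fstep_ex n i (mult alpha).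
  move: fab; rewrite /f_op -size_W -size_Wstar /bmul /=.
  case: ifP => [|_]; first by lia.
  by case: (pluses (reduce (Wstar i alpha))) => [|r s].
have [b' Eb' Em'] := f_op_fstep Hm'.
have -> : beta = b' by move: fab; rewrite Eb' => -[].
case: Hm' => [b|h] H1 H2 H3 H4; [apply: (FStar H1) | apply: (FNons H1)] => // x y; by rewrite Em' H4.
Qed.

Lemma f_op_e_op alpha beta : f_op i alpha = Some beta -> e_op i beta = Some alpha.
Proof.
move/f_opP/(fstep_estep (mult_validP (alpha := alpha))) => /e_op_estep[a' -> /mult_inj ->] //.
Qed.

Lemma f_op_ex alpha : 0 < (Tsig n i (mult alpha)).1 -> exists beta, f_op i alpha = Some beta.
Proof. by case/fstep_ex => m' /f_op_fstep[b ->]; exists b. Qed.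

End FOp.

(** * Commutation for orthogonal simple roots *)

Lemma shift_rootC a b a' b' c d c' d' m : 0 < m a b -> 0 < m c d ->
  ~~ ((a == c) && (b == d)) ->
  shift_root a b a' b' (shift_root c d c' d' m) =2 shift_root c d c' d' (shift_root a b a' b' m).
Proof.
move=> ab cd ne x y; rewrite /shift_root.
case: (x =P a) => [->|_]; case: (y =P b) => [->|_];
case: (_ =P c) => [?|_]; case: (_ =P d) => [?|_]; subst; lia.
Qed.

Section Commute.
Variables (n i j : nat).
Hypotheses (ij : i.+1 < j) (jn : j.+1 < n).
Implicit Types m : nat -> nat -> nat.

(* The block of entries (i or i+1, j or j+1), read along columns and along    *)
(* rows, is the only data shared by the words of f_i and f_j.                 *)
Lemma Rsig_block m : Rsig m j i i.+2 = bmul (m i.+1 j, m i.+1 j.+1) (m i j, m i j.+1).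
Proof. by rewrite (@Rsig_cat _ _ i i.+1) ?leqnSn // !Rsig1. Qed.

Lemma Ssig_block m : Ssig m i j j.+2 = bmul (m i.+1 j, m i j) (m i.+1 j.+1, m i j.+1).
Proof. by rewrite (@Ssig_cat _ _ j j.+1) ?leqnSn // !Ssig1. Qed.

(** The interval from a to b, with b excluded, does not separate c from c+1. *)
Definition out a b c := (b <= c) || (c.+2 <= a) || ((a <= c) && (c.+2 <= b)).

(** A step of [f_i] reaches the word of [f_j] only inside the block, and there the pivot
    inequalities make the product of the two segments i and i+1 invariant. [fstep_j_Ssig] is the
    dual statement. *)
Lemma fstep_i_Rsig m m1 : valid n m -> fstep n i m m1 ->
  (forall b, m1 j b = m j b /\ m1 j.+1 b = m j.+1 b) /\
  (forall lo hi, out lo hi i -> Rsig m1 j lo hi = Rsig m j lo hi).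
Proof.
move=> vm [k kn E1 E2 Em|h hn E1 E2 Em]; last first.
  have hi : h < i by have := vm h i; case: (m h i) E1 => // c _ /(_ isT) /andP[].
  split=> [b|lo hi' _]; first by rewrite !Em /shift_root; split; lia.
  by apply: eq_Rsig => b _; rewrite !Em /shift_root; split; lia.
split=> [b|lo hi olh]; first by rewrite !Em /shift_root; split; lia.
have same a b : (b <= i) || (i.+2 <= a) -> Rsig m1 j a b = Rsig m j a b.
  by move=> ab; apply: eq_Rsig => c cab; rewrite !Em /shift_root; split; lia.
have blk : Rsig m1 j i i.+2 = Rsig m j i i.+2.
  rewrite !Rsig_block !Em /shift_root !eqxx ![i.+1 == i]eq_sym (ltn_eqF (ltnSn i)) /= !addn0 !subn0.
  case: (j =P k) => [jk|_]; case: (j.+1 =P k) => [jk'|_]; first by lia.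
  - subst k; have := E2; rewrite (@Ssig_cat _ _ j.+1 j.+2 n) ?leqnSn //= Ssig1.
    by move: E1; rewrite /bmul /= => *; congr pair; lia.
  - subst k; have := E1; rewrite (@Ssig_cat _ _ 0 j j.+1) ?leqnSn //= Ssig1.
    by move: E2; rewrite /bmul /= => *; congr pair; lia.
  by rewrite /= !addn0 !subn0.
case/orP: olh => [/same //|/andP[li hi2]].
have c1 : lo <= i.+2 <= hi by lia.
have c2 : lo <= i <= i.+2 by lia.
rewrite !(Rsig_cat _ _ c1) !(Rsig_cat _ _ c2).
by rewrite blk !same ?leqnn ?orbT.
Qed.

Lemma fstep_j_Ssig m m2 : valid n m -> fstep n j m m2 ->
  (forall h, m2 h i = m h i /\ m2 h i.+1 = m h i.+1) /\
  (forall lo hi, out lo hi j -> Ssig m2 i lo hi = Ssig m i lo hi).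
Proof.
move=> vm [k kn E1 E2 Em|h hn E1 E2 Em].
  have hi : j.+1 < k by have := vm j.+1 k; case: (m j.+1 k) E1 => // c _ /(_ isT) /andP[].
  split=> [b|lo hi' _]; first by rewrite !Em /shift_root; split; lia.
  by apply: eq_Ssig => b _; rewrite !Em /shift_root; split; lia.
have hj : h < j by have := vm h j; case: (m h j) E1 => // c _ /(_ isT) /andP[].
split=> [b|lo hi olh]; first by rewrite !Em /shift_root; split; lia.
have same a b : (b <= j) || (j.+2 <= a) -> Ssig m2 i a b = Ssig m i a b.
  by move=> ab; apply: eq_Ssig => c cab; rewrite !Em /shift_root; split; lia.
have blk : Ssig m2 i j j.+2 = Ssig m i j j.+2.
  rewrite !Ssig_block !Em /shift_root !eqxx ![j.+1 == j]eq_sym (ltn_eqF (ltnSn j)) /= !andbT !andbF !addn0 !subn0.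
  case: (i =P h) => [ih|_]; case: (i.+1 =P h) => [ih'|_]; first by lia.
  - subst h; have := E1; rewrite (@Rsig_cat _ _ i.+1 i.+2 n) ?leqnSn //=; last by lia.
    by rewrite Rsig1; move: E2; rewrite /bmul /= => *; congr pair; lia.
  - subst h; have := E2; rewrite (@Rsig_cat _ _ 0 i i.+1) ?leqnSn //= Rsig1.
    by move: E1; rewrite /bmul /= => *; congr pair; lia.
  by rewrite /= !addn0 !subn0.
case/orP: olh => [/same //|/andP[lj hj2]].
have c1 : lo <= j.+2 <= hi by lia.
have c2 : lo <= j <= j.+2 by lia.
rewrite !(Ssig_cat _ _ c1) !(Ssig_cat _ _ c2).
by rewrite blk !same ?leqnn ?orbT.
Qed.

(** This criterion and the next three say when a step takes place at a given entry of the block,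
    separating the four block entries from data that the other operator leaves unchanged. *)
Lemma fstar_blockL m : (Ssig m i 0 j).2 < m i.+1 j ->
  m i.+1 j.+1 + ((bmul (Ssig m i j.+2 n) (Rsig m i 0 n)).1 - m i j.+1) <= m i j ->
  fstep n i m (shift_root i.+1 j i j m).
Proof.
move=> E1 E2; apply: (FStar (ltnW jn)) => //.
rewrite (@Ssig_cat _ _ j.+1 j.+2 n) ?leqnSn // Ssig1 -bmulA.
by move: E2; rewrite /bmul /=; lia.
Qed.

Lemma fstar_blockR m : m i j + ((Ssig m i 0 j).2 - m i.+1 j) < m i.+1 j.+1 ->
  (bmul (Ssig m i j.+2 n) (Rsig m i 0 n)).1 <= m i j.+1 ->
  fstep n i m (shift_root i.+1 j.+1 i j.+1 m).
Proof.
move=> E1 E2; apply: (FStar jn) => //.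
rewrite (@Ssig_cat _ _ 0 j j.+1) ?leqnSn //= Ssig1.
by move: E1; rewrite /bmul /=; lia.
Qed.

Lemma fnons_blockL m : (bmul (Ssig m j 0 n) (Rsig m j i.+2 n)).2 < m i.+1 j ->
  m i j + ((Rsig m j 0 i).1 - m i j.+1) <= m i.+1 j.+1 ->
  fstep n j m (shift_root i.+1 j i.+1 j.+1 m).
Proof.
move=> E1 E2; apply: FNons E1 _ _ => //; first by lia.
rewrite (@Rsig_cat _ _ 0 i i.+1) ?leqnSn //= Rsig1.
by move: E2; rewrite /bmul /=; lia.
Qed.

Lemma fnons_blockR m :
  m i.+1 j.+1 + ((bmul (Ssig m j 0 n) (Rsig m j i.+2 n)).2 - m i.+1 j) < m i j ->
  (Rsig m j 0 i).1 <= m i j.+1 ->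
  fstep n j m (shift_root i j i j.+1 m).
Proof.
move=> E1 E2; apply: FNons E2 _ => //; first by lia.
rewrite (@Rsig_cat _ _ i.+1 i.+2 n) ?leqnSn //=; last by lia.
by rewrite Rsig1; move: E1; rewrite /bmul /=; lia.
Qed.

Lemma fstep_eq k m m' m'' : m' =2 m'' -> fstep n k m m' -> fstep n k m m''.
Proof.
move=> E [b|h] H1 H2 H3 H4; [apply: (FStar H1) | apply: (FNons H1)] => // x y; by rewrite -E H4.
Qed.

Lemma fstep_comm m m1 m2 : valid n m -> fstep n i m m1 -> fstep n j m m2 ->
  exists m', fstep n j m1 m' /\ fstep n i m2 m'.
Proof.
move=> vm F1 F2.
have [row1 R1] := fstep_i_Rsig vm F1; have [col2 S2] := fstep_j_Ssig vm F2.
have o0n c : c.+1 < n -> out 0 n c by rewrite /out; lia.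
have R0n : Rsig m1 j 0 n = Rsig m j 0 n by apply: R1; apply: o0n; lia.
have S0n : Ssig m2 i 0 n = Ssig m i 0 n by apply: S2; apply: o0n.
have S1 lo hi : Ssig m1 j lo hi = Ssig m j lo hi.
  by apply: eq_Ssig => b _; have [-> ->] := row1 b.
have R2 lo hi : Rsig m2 i lo hi = Rsig m i lo hi.
  by apply: eq_Rsig => h _; have [-> ->] := col2 h.
case: F1 F2 => [k kn E1 E2 Em1|h hn E1 E2 Em1] [k' kn' E1' E2' Em2|h' hn' E1' E2' Em2].
- have k'P : j.+1 < k' by have := vm j.+1 k'; case: (m j.+1 k') E1' => // c _ /(_ isT) /andP[].
  exists (shift_root j.+1 k' j k' m1); have [r1 r2] := row1 k'; split.
    by apply: (FStar kn'); rewrite ?S1 ?R0n ?r1 ?r2.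
  have S lo hi : Ssig m2 i lo hi = Ssig m i lo hi.
    by apply: eq_Ssig => b _; rewrite !Em2 /shift_root; split; lia.
  apply: (FStar kn); rewrite ?S ?R2 ?Em2; try by rewrite /shift_root; lia.
  move=> x y; rewrite (eq_shift_root _ _ _ _ Em1) (eq_shift_root _ _ _ _ Em2) shift_rootC //; lia.
- have h'j : h' < j by have := vm h' j; case: (m h' j) E1' => // c _ /(_ isT) /andP[].
  have ik : i.+1 < k by have := vm i.+1 k; case: (m i.+1 k) E1 => // c _ /(_ isT) /andP[].
  (* The steps can interact only if [f_i] acts in column j or j+1 and [f_j] acts in row i or i+1. *)
  have [/andP[/orP kb /orP hb]|nblk] :=
      boolP (((k == j) || (k == j.+1)) && ((h' == i) || (h' == i.+1))); last first.
    have C : shift_root h' j h' j.+1 m1 =2 shift_root i.+1 k i k m2.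
      by move=> x y; rewrite (eq_shift_root _ _ _ _ Em1) (eq_shift_root _ _ _ _ Em2) shift_rootC //; lia.
    exists (shift_root h' j h' j.+1 m1); split.
      have [hb|hb] := boolP ((h' == i) || (h' == i.+1)).
        have R lo hi : Rsig m1 j lo hi = Rsig m j lo hi.
          by apply: eq_Rsig => b _; rewrite !Em1 /shift_root; split; lia.
        by apply: (FNons hn'); rewrite ?S1 ?R ?Em1 //; rewrite /shift_root; lia.
      apply: (FNons hn'); rewrite ?S1 ?R1 ?Em1 //; try by rewrite /out; lia.
      - by rewrite /shift_root; lia.
      - by rewrite /shift_root; lia.
    apply: (fstep_eq (fun x y => esym (C x y))).
    have [kb|kb] := boolP ((k == j) || (k == j.+1)).
      have S lo hi : Ssig m2 i lo hi = Ssig m i lo hi.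
        by apply: eq_Ssig => b _; rewrite !Em2 /shift_root; split; lia.
      by apply: (FStar kn); rewrite ?S ?R2 ?Em2 //; rewrite /shift_root; lia.
    apply: (FStar kn); rewrite ?S2 ?R2 ?Em2 //; try by rewrite /out; lia.
    - by rewrite /shift_root; lia.
    - by rewrite /shift_root; lia.
  have oL c : c.+1 < n -> out 0 c c by rewrite /out; lia.
  have oR c : out c.+2 n c by rewrite /out; lia.
  have [Ri Ro] := (R1 0 i (oL i (ltn_trans ij (ltnW jn))), R1 i.+2 n (oR i)).
  have [Si So] := (S2 0 j (oL j jn), S2 j.+2 n (oR j)).
  have e1 a b a' b' : shift_root a b a' b' m1 =2 shift_root a b a' b' (shift_root i.+1 k i k m) by apply: eq_shift_root.
  have e2 a b a' b' : shift_root a b a' b' m2 =2 shift_root a b a' b' (shift_root h' j h' j.+1 m) by apply: eq_shift_root.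
  have cE : k = j.+1 -> m i j + ((Ssig m i 0 j).2 - m i.+1 j) < m i.+1 j.+1.
    by move=> Ek; move: E1; rewrite Ek (@Ssig_cat _ _ 0 j j.+1) ?leqnSn // Ssig1 /bmul /=.
  have cT : k = j -> m i.+1 j.+1 + ((bmul (Ssig m i j.+2 n) (Rsig m i 0 n)).1 - m i j.+1) <= m i j.
    by move=> Ek; move: E2; rewrite Ek (@Ssig_cat _ _ j.+1 j.+2 n) ?leqnSn // Ssig1 -bmulA.
  have cF : h' = i.+1 -> m i j + ((Rsig m j 0 i).1 - m i j.+1) <= m i.+1 j.+1.
    by move=> Eh; move: E2'; rewrite Eh (@Rsig_cat _ _ 0 i i.+1) ?leqnSn // Rsig1 /bmul /=.
  have cG : h' = i -> m i.+1 j.+1 + ((bmul (Ssig m j 0 n) (Rsig m j i.+2 n)).2 - m i.+1 j) < m i j.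
    move=> Eh; move: E1'; rewrite Eh (@Rsig_cat _ _ i.+1 i.+2 n) ?Rsig1 ?bmulA //; lia.
  clear R1 S2 R0n S0n o0n oL oR row1 col2 vm.
  case: kb => /eqP Ek; case: hb => /eqP Eh; subst k h'.
  + have C : shift_root i j i j.+1 m1 =2 shift_root i.+1 j i j m2.
      move=> x y; rewrite e1 e2 shift_rootC //; lia.
    exists (shift_root i j i j.+1 m1); split; last apply: (fstep_eq (fun x y => esym (C x y))).
      apply: fnons_blockR; rewrite ?S1 ?Ro ?Ri ?Em1 //; move: (cT erefl) (cG erefl); rewrite /shift_root; lia.
    apply: fstar_blockL; rewrite ?R2 ?So ?Si ?Em2 //; move: (cT erefl) (cG erefl); rewrite /shift_root; lia.
  (* Both operators want to move the entry (i+1, j). Whichever comes second moves a different root,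
     and in total one unit goes from (i+1, j) to (i, j+1). *)
  + have C : shift_root i j i j.+1 m1 =2 shift_root i.+1 j.+1 i j.+1 m2.
      move=> x y; rewrite e1 e2 /shift_root; move: (cT erefl) (cF erefl).
      have [->|nx] := eqVneq x i; [|have [->|nx'] := eqVneq x i.+1];
      (have [->|ny] := eqVneq y j; [|have [->|ny'] := eqVneq y j.+1]); lia.
    exists (shift_root i j i j.+1 m1); split; last apply: (fstep_eq (fun x y => esym (C x y))).
      apply: fnons_blockR; rewrite ?S1 ?Ro ?Ri ?Em1 //; move: (cT erefl) (cF erefl); rewrite /shift_root; lia.
    apply: fstar_blockR; rewrite ?R2 ?So ?Si ?Em2 //; move: (cT erefl) (cF erefl); rewrite /shift_root; lia.
  (* This combination would require each of the entries (i, j) and (i+1, j+1) to exceed the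
     other. *)
  + by move: (cE erefl) (cG erefl); lia.
  have C : shift_root i.+1 j i.+1 j.+1 m1 =2 shift_root i.+1 j.+1 i j.+1 m2.
    by move=> x y; rewrite e1 e2 shift_rootC //; lia.
  exists (shift_root i.+1 j i.+1 j.+1 m1); split; last apply: (fstep_eq (fun x y => esym (C x y))).
    apply: fnons_blockL; rewrite ?S1 ?Ro ?Ri ?Em1 //; move: (cE erefl) (cF erefl); rewrite /shift_root; lia.
  apply: fstar_blockR; rewrite ?R2 ?So ?Si ?Em2 //; move: (cE erefl) (cF erefl); rewrite /shift_root; lia.
- have k'P : j.+1 < k' by have := vm j.+1 k'; case: (m j.+1 k') E1' => // c _ /(_ isT) /andP[].
  exists (shift_root j.+1 k' j k' m1); have [r1 r2] := row1 k'; split.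
    by apply: (FStar kn'); rewrite ?S1 ?R0n ?r1 ?r2.
  have [c1 c2] := col2 h; apply: (FNons hn); rewrite ?S0n ?R2 ?c1 ?c2 //.
  move=> x y; rewrite (eq_shift_root _ _ _ _ Em1) (eq_shift_root _ _ _ _ Em2) shift_rootC //; lia.
exists (shift_root h' j h' j.+1 m1); split.
  have R lo hi : Rsig m1 j lo hi = Rsig m j lo hi.
    by apply: eq_Rsig => b _; rewrite !Em1 /shift_root; split; lia.
  by apply: (FNons hn'); rewrite ?S1 ?R ?Em1 //; rewrite /shift_root; lia.
have [c1 c2] := col2 h; apply: (FNons hn); rewrite ?S0n ?R2 ?c1 ?c2 //.
move=> x y; rewrite (eq_shift_root _ _ _ _ Em1) (eq_shift_root _ _ _ _ Em2) shift_rootC //; lia.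
Qed.

End Commute.

(** * The braid relation *)

Section RankTwoWord.
Variables (n a : nat).
Hypothesis an : a.+2 < n.
Implicit Types m : nat -> nat -> nat.

Definition rep c (w : seq (nat * nat)) := flatten (nseq c w).

Lemma lsig_rep k c w : (lsig k w).1 + (lsig k w).2 <= 1 ->
  lsig k (rep c w) = (c * (lsig k w).1, c * (lsig k w).2).
Proof.
move=> w1; elim: c => [|c IHc]; first by rewrite /lsig big_nil.
by rewrite /rep /= lsig_cat -/(rep c w) IHc /bmul /=; congr pair; nia.
Qed.

Lemma lsig_nseq k c x : lsig k (nseq c x) = (c * (x.1 == k), c * (x.1 == k.+1)).
Proof.
have -> : nseq c x = rep c [:: x] by rewrite /rep; elim: c => //= c ->.
by rewrite lsig_rep lsig_cons /lsig big_nil /bmul /lsgn /=; [congr pair; lia | case: eqP; lia].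
Qed.

Lemma rep_rcons c w : rep c.+1 w = rep c w ++ w.
Proof. by rewrite /rep -addn1 nseqD flatten_cat /= cats0. Qed.

Lemma nseq_rcons T c (x : T) : nseq c.+1 x = nseq c x ++ [:: x].
Proof. by rewrite -addn1 nseqD. Qed.

Definition rowX m h := nseq (m h a) (0, h) ++ nseq (m h a.+1) (1, h) ++ nseq (m h a.+2) (2, h).

(* A root (c, b) contributes to W^* the dual of the letter c - a, encoded as  *)
(* the two-letter column complementary to it.                                 *)
Definition colY m b := rep (m a.+2 b) [:: (1, b); (0, b)] ++
  rep (m a.+1 b) [:: (2, b); (0, b)] ++ rep (m a b) [:: (2, b); (1, b)].

Definition Xr m lo d := flatten [seq rowX m h | h <- rev (iota lo d)].
Definition Yr m lo d := flatten [seq colY m b | b <- iota lo d].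

(* The roots (a,a+1), (a,a+2), (a+1,a+2) occur in both words. Their letters   *)
(* are replaced by plactically equivalent ones that do not change when the    *)
(* operator acts through the other word.                                      *)
Definition midn m := minn (m a a.+1) (m a.+1 a.+2).
Definition midS m := rep (midn m) [:: (2, a.+1); (1, a.+1)] ++
  rep (m a.+1 a.+2) [:: (2, a.+1); (0, a.+1)] ++
  rep (m a a.+2 + m a a.+1 - midn m) [:: (2, a.+1); (1, a.+1)].
Definition midR m := nseq (midn m) (2, a) ++ nseq (m a a.+1) (1, a) ++
  nseq (m a a.+2 + m a.+1 a.+2 - midn m) (2, a).

Definition rank2_word m := midS m ++ Yr m a.+3 (n - a.+3) ++ midR m ++ Xr m 0 a.

Ltac lsig_simpl := rewrite ?lsig_cat ?lsig_rep ?lsig_nseq ?lsig_cons /lsig ?big_nil /bmul /lsgn //=.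

Lemma lsig_rowX k m h : k < 2 -> lsig k (rowX m h) = (m h (a + k), m h (a + k).+1).
Proof.
by case: k => [|[|//]] _; rewrite ?addn0 ?addn1 /rowX; lsig_simpl; congr pair; lia.
Qed.

Lemma lsig_colY k m b : k < 2 -> lsig k (colY m b) = (m (a + k).+1 b, m (a + k) b).
Proof.
by case: k => [|[|//]] _; rewrite ?addn0 ?addn1 /colY; lsig_simpl; congr pair; lia.
Qed.

Lemma lsig_Xr k m lo d : k < 2 -> lsig k (Xr m lo d) = Rsig m (a + k) lo (lo + d).
Proof.
move=> k2; rewrite /lsig /Xr big_flatten big_map /Rsig /index_iota addKn rev_big_rev.
by apply: eq_bigr => h _; rewrite -/(lsig k _) lsig_rowX.
Qed.

Lemma lsig_Yr k m lo d : k < 2 -> lsig k (Yr m lo d) = Ssig m (a + k) lo (lo + d).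
Proof.
move=> k2; rewrite /lsig /Yr big_flatten big_map /Ssig /index_iota addKn.
by apply: eq_bigr => h _; rewrite -/(lsig k _) lsig_colY.
Qed.

Lemma Ssig0 m i lo hi : (forall b, lo <= b < hi -> m i.+1 b = 0 /\ m i b = 0) ->
  Ssig m i lo hi = (0, 0).
Proof.
by move=> m0; rewrite /Ssig big_nat big1 // => b /m0[-> ->].
Qed.

Lemma Rsig0 m i lo hi : (forall h, lo <= h < hi -> m h i = 0 /\ m h i.+1 = 0) ->
  Rsig m i lo hi = (0, 0).
Proof.
by move=> m0; rewrite /Rsig big_nat big1 // => b /m0[-> ->].
Qed.

(** For k = 0, the - from (a, a+1) in excess of [midn] survive the + from (a+1, a+2), so they may be
    moved past them. For k = 1 the columns with letters 2 and 1 cancel internally. [lsig_midR] rests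
    on the same exchange. *)
Lemma lsig_midS k m : k < 2 -> valid n m -> lsig k (midS m) = Ssig m (a + k) 0 a.+3.
Proof.
move=> k2 vm; rewrite (@Ssig_cat _ _ 0 a.+2) ?leqnSn // Ssig1.
rewrite (@Ssig_cat _ _ 0 a.+1) ?leqnSn // Ssig1 Ssig0 ?bmul1x; last first.
  by move=> b b1; split; apply: (valid0 vm); lia.
have z1 : m a.+1 a.+1 = 0 by apply: (valid0 vm); lia.
have z2 : m a.+2 a.+1 = 0 by apply: (valid0 vm); lia.
have z3 : m a.+2 a.+2 = 0 by apply: (valid0 vm); lia.
rewrite /midS /midn; case: k k2 => [|[|//]] _; rewrite ?addn0 ?addn1 ?z1 ?z2 ?z3;
by lsig_simpl; congr pair; lia.
Qed.

Lemma lsig_midR k m : k < 2 -> valid n m -> lsig k (midR m) = Rsig m (a + k) a n.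
Proof.
move=> k2 vm; rewrite (@Rsig_cat _ _ a a.+2); last by lia.
rewrite (@Rsig_cat _ _ a a.+1) ?leqnSn // !Rsig1 Rsig0 ?bmul1x; last first.
  by move=> b b1; split; apply: (valid0 vm); lia.
have z1 : m a.+1 a.+1 = 0 by apply: (valid0 vm); lia.
have z2 : m a.+1 a = 0 by apply: (valid0 vm); lia.
have z3 : m a a = 0 by apply: (valid0 vm); lia.
rewrite /midR /midn; case: k k2 => [|[|//]] _; rewrite ?addn0 ?addn1 ?z1 ?z2 ?z3;
by lsig_simpl; congr pair; lia.
Qed.

Lemma lsig_rank2_word k m : k < 2 -> valid n m -> lsig k (rank2_word m) = Tsig n (a + k) m.
Proof.
move=> k2 vm; rewrite /rank2_word lsig_cat lsig_midS // lsig_cat lsig_Yr // lsig_cat lsig_midR // lsig_Xr //.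
rewrite add0n subnKC // /Tsig (@Ssig_cat _ _ 0 a.+3 n) // (@Rsig_cat _ _ 0 a n) ?bmulA //.
lia.
Qed.

Lemma letters_rank2_word m : letters (rank2_word m).
Proof.
have Lr c w : letters w -> letters (rep c w).
  by move=> lw; elim: c => //= c; rewrite /letters /rep /= all_cat => ->; rewrite andbT.
have Lf (f : nat -> seq (nat * nat)) s : (forall x, letters (f x)) -> letters (flatten (map f s)).
  by move=> lf; elim: s => //= x s; rewrite /letters all_cat => ->; rewrite andbT; apply: lf.
have Ln c x : x.1 < 3 -> letters (nseq c x) by move=> x3; rewrite /letters all_nseq x3 orbT.
rewrite /letters /rank2_word /midS /midR !all_cat -!/(letters _) !Lr ?Ln //= !Lf // => x.
  by rewrite /rowX /letters !all_cat -!/(letters _) !Ln.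
by rewrite /colY /letters !all_cat -!/(letters _) !Lr.
Qed.

Lemma eq_Xr m m' lo d :
  (forall h, lo <= h < lo + d ->
     [/\ m h a = m' h a, m h a.+1 = m' h a.+1 & m h a.+2 = m' h a.+2]) ->
  Xr m lo d = Xr m' lo d.
Proof.
move=> E; rewrite /Xr; congr flatten; apply/eq_in_map => h.
by rewrite mem_rev mem_iota => /E[E1 E2 E3]; rewrite /rowX E1 E2 E3.
Qed.

Lemma eq_Yr m m' lo d :
  (forall b, lo <= b < lo + d ->
     [/\ m a b = m' a b, m a.+1 b = m' a.+1 b & m a.+2 b = m' a.+2 b]) ->
  Yr m lo d = Yr m' lo d.
Proof.
move=> E; rewrite /Yr; congr flatten; apply/eq_in_map => b.
by rewrite mem_iota => /E[E1 E2 E3]; rewrite /colY E1 E2 E3.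
Qed.

Lemma Yr_split m b : a.+2 < b < n ->
  Yr m a.+3 (n - a.+3) = Yr m a.+3 (b - a.+3) ++ colY m b ++ Yr m b.+1 (n - b.+1).
Proof.
move=> bn; rewrite /Yr; have -> : n - a.+3 = (b - a.+3) + (n - b.+1).+1 by lia.
by rewrite iotaD map_cat flatten_cat subnKC //; case/andP: bn.
Qed.

Lemma Xr_split m h : h < a -> Xr m 0 a = Xr m h.+1 (a - h.+1) ++ rowX m h ++ Xr m 0 h.
Proof.
move=> ha; rewrite /Xr (iota_split ha) rev_cat rev_cons map_cat flatten_cat map_rcons.
by rewrite flatten_rcons -catA.
Qed.

Lemma colY_step k m m' b : k < 2 -> a.+2 < b -> m' =2 shift_root (a + k).+1 b (a + k) b m ->
  0 < m (a + k).+1 b ->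
  exists u v, [/\ colY m b = u ++ (k, b) :: v, colY m' b = u ++ (k.+1, b) :: v,
    lsig k u = ((m (a + k).+1 b).-1, 0) & lsig k v = (0, m (a + k) b)].
Proof.
case: k => [|[|//]] _; rewrite ?addn0 ?addn1 /colY => ab E.
  case Ep: (m a.+1 b) => [//|p] _.
  have -> : m' a.+2 b = m a.+2 b by rewrite E /shift_root; lia.
  have -> : m' a.+1 b = p by rewrite E /shift_root Ep; lia.
  have -> : m' a b = (m a b).+1 by rewrite E /shift_root; lia.
  exists (rep (m a.+2 b) [:: (1, b); (0, b)] ++ rep p [:: (2, b); (0, b)] ++ [:: (2, b)]).
  exists (rep (m a b) [:: (2, b); (1, b)]).
  split; [by rewrite rep_rcons -!catA | by rewrite -!catA | |].
    by lsig_simpl; congr pair; lia.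
  by lsig_simpl; congr pair; lia.
case Ep: (m a.+2 b) => [//|p] _.
have -> : m' a.+2 b = p by rewrite E /shift_root Ep; lia.
have -> : m' a.+1 b = (m a.+1 b).+1 by rewrite E /shift_root; lia.
have -> : m' a b = m a b by rewrite E /shift_root; lia.
exists (rep p [:: (1, b); (0, b)]).
exists ((0, b) :: rep (m a.+1 b) [:: (2, b); (0, b)] ++ rep (m a b) [:: (2, b); (1, b)]).
split; [by rewrite rep_rcons -!catA | by [] | |].
  by lsig_simpl; congr pair; lia.
by rewrite lsig_cons; lsig_simpl; congr pair; lia.
Qed.

Lemma rowX_step k m m' h : k < 2 -> h < a -> m' =2 shift_root h (a + k) h (a + k).+1 m ->
  0 < m h (a + k) ->
  exists u v, [/\ rowX m h = u ++ (k, h) :: v, rowX m' h = u ++ (k.+1, h) :: v,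
    lsig k u = ((m h (a + k)).-1, 0) & lsig k v = (0, m h (a + k).+1)].
Proof.
case: k => [|[|//]] _; rewrite ?addn0 ?addn1 /rowX => ab E.
  case Ep: (m h a) => [//|p] _.
  have -> : m' h a.+2 = m h a.+2 by rewrite E /shift_root; lia.
  have -> : m' h a = p by rewrite E /shift_root Ep; lia.
  have -> : m' h a.+1 = (m h a.+1).+1 by rewrite E /shift_root; lia.
  exists (nseq p (0, h)), (nseq (m h a.+1) (1, h) ++ nseq (m h a.+2) (2, h)).
  split; [by rewrite nseq_rcons -!catA | by [] | |].
    by lsig_simpl; congr pair; lia.
  by lsig_simpl; congr pair; lia.
case Ep: (m h a.+1) => [//|p] _.
have -> : m' h a.+1 = p by rewrite E /shift_root Ep; lia.
have -> : m' h a.+2 = (m h a.+2).+1 by rewrite E /shift_root; lia.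
have -> : m' h a = m h a by rewrite E /shift_root; lia.
exists (nseq (m h a) (0, h) ++ nseq p (1, h)), (nseq (m h a.+2) (2, h)).
split; [by rewrite nseq_rcons -!catA | by rewrite -!catA | |].
  by lsig_simpl; congr pair; lia.
by lsig_simpl; congr pair; lia.
Qed.

Lemma act_pivot_mid k w1 u v w2 t :
  (lsig k u).2 = 0 -> (lsig k w1).2 <= (lsig k u).1 -> (lsig k v).1 = 0 -> (lsig k w2).1 <= (lsig k v).2 ->
  act k (w1 ++ (u ++ (k, t) :: v) ++ w2) = w1 ++ (u ++ (k.+1, t) :: v) ++ w2.
Proof.
move=> u2 w1u v1 w2v; rewrite -!catA !cat_cons [LHS](_ : _ = act k ((w1 ++ u) ++ (k, t) :: v ++ w2)).
  by rewrite act_pivot -?catA // lsig_cat /bmul /=; lia.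
by rewrite -catA.
Qed.

Lemma eq_midS m m' : midn m' = midn m -> m' a.+1 a.+2 = m a.+1 a.+2 ->
  m' a a.+2 + m' a a.+1 = m a a.+2 + m a a.+1 -> midS m' = midS m.
Proof. by rewrite /midS => -> -> ->. Qed.

Lemma eq_midR m m' : midn m' = midn m -> m' a a.+1 = m a a.+1 ->
  m' a a.+2 + m' a.+1 a.+2 = m a a.+2 + m a.+1 a.+2 -> midR m' = midR m.
Proof. by rewrite /midR => -> -> ->. Qed.

(** The step changes one letter k into k+1 in exactly one of the four pieces of the word, and the
    pivot inequalities show that this letter is the one selected by [act]. *)
Lemma rank2_word_act k m m' : k < 2 -> valid n m -> fstep n (a + k) m m' -> rank2_word m' = act k (rank2_word m).
Proof.
move=> k2 vm; case=> [b bn E1 E2 Em|h hn E1 E2 Em].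
  have kb : (a + k).+1 < b.
    by have := vm (a + k).+1 b; case: (m _ b) E1 => // c _ /(_ isT) /andP[].
  have eX : Xr m' 0 a = Xr m 0 a by apply: eq_Xr => h ha; rewrite !Em /shift_root; split; lia.
  have [b3|b3] := ltnP a.+2 b.
    have mb0 : 0 < m (a + k).+1 b by lia.
    have [u [v [e1 e2 pu pv]]] := colY_step k2 b3 Em mb0.
    rewrite /rank2_word !(Yr_split _ (b := b)) ?b3 // e1 e2 eX.
    have -> : midS m' = midS m by apply: eq_midS; rewrite ?/midn !Em /shift_root; lia.
    have -> : midR m' = midR m by apply: eq_midR; rewrite ?/midn !Em /shift_root; lia.
    rewrite !(eq_Yr (m := m') (m' := m)); try by move=> c ?; rewrite !Em /shift_root; split; lia.
    have := lsig_Yr m a.+3 (b - a.+3) k2; have := lsig_Yr m b.+1 (n - b.+1) k2.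
    have := lsig_midS k2 vm; have := lsig_midR k2 vm; have := lsig_Xr m 0 a k2.
    rewrite !subnKC // add0n.
    move: (midS m) (Yr m a.+3 _) (Yr m b.+1 _) (midR m) (Xr m 0 a) => S Y1 Y2 M X pX pM pS pY2 pY1.
    have := @act_pivot_mid k (S ++ Y1) u v (Y2 ++ M ++ X) b.
    rewrite -!catA => -> //; rewrite ?pu ?pv // !lsig_cat ?pS ?pY1 ?pY2 ?pM ?pX.
      by rewrite /bmul /=; move: E1; rewrite (@Ssig_cat _ _ 0 a.+3 b) ?b3 // /bmul /=; lia.
    by rewrite -(@Rsig_cat _ _ 0 a n) //; lia.
  (* The root (a+1, a+2) becomes (a, a+2). The strict inequality [lt_c] keeps [midn] fixed, so
     [midR] does not change although its roots do. *)
  have k0 : k = 0 by lia.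
  subst k; rewrite addn0 in kb E1 E2 Em *; have Eb : b = a.+2 by lia.
  subst b; have lt_c : m a a.+1 < m a.+1 a.+2.
    by move: E1; rewrite (@Ssig_cat _ _ 0 a.+1) ?leqnSn // Ssig1 /bmul /=; lia.
  have eY : Yr m' a.+3 (n - a.+3) = Yr m a.+3 (n - a.+3).
    by apply: eq_Yr => c ?; rewrite !Em /shift_root; split; lia.
  rewrite /rank2_word; have -> : midR m' = midR m by apply: eq_midR; rewrite ?/midn !Em /shift_root; lia.
  rewrite eX eY; have [p Ep] : exists p, m a.+1 a.+2 = p.+1 by exists (m a.+1 a.+2).-1; lia.
  rewrite /midS (_ : midn m' = m a a.+1); last by rewrite /midn !Em /shift_root; lia.
  rewrite (_ : midn m = m a a.+1); last by rewrite /midn; lia.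
  have -> : m' a.+1 a.+2 = p by rewrite Em /shift_root Ep; lia.
  have -> : m' a a.+2 + m' a a.+1 - m a a.+1 = (m a a.+2).+1 by rewrite !Em /shift_root; lia.
  rewrite addnK Ep (rep_rcons p).
  set w1 := rep (m a a.+1) _; set w2 := Yr _ _ _ ++ _.
  have := @act_pivot_mid 0 w1 (rep p [:: (2, a.+1); (0, a.+1)] ++ [:: (2, a.+1)])
    (rep (m a a.+2) [:: (2, a.+1); (1, a.+1)]) w2 a.+1.
  rewrite -!catA /= => -> //.
  - by lsig_simpl; lia.
  - by rewrite /w1; lsig_simpl; lia.
  - by lsig_simpl; lia.
  have -> : lsig 0 (rep (m a a.+2) [:: (2, a.+1); (1, a.+1)]) = (0, m a a.+2).
    by lsig_simpl; congr pair; lia.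
  rewrite /w2 lsig_cat lsig_Yr // lsig_cat lsig_midR // lsig_Xr // add0n addn0 subnKC //.
  by rewrite -(@Rsig_cat _ _ 0 a n) //; lia.
have [ha|ah] := ltnP h a.
  have mh0 : 0 < m h (a + k) by lia.
  have [u [v [e1 e2 pu pv]]] := rowX_step k2 ha Em mh0.
  rewrite /rank2_word !(Xr_split _ ha) e1 e2.
  have -> : midS m' = midS m by apply: eq_midS; rewrite ?/midn !Em /shift_root; lia.
  have -> : midR m' = midR m by apply: eq_midR; rewrite ?/midn !Em /shift_root; lia.
  have -> : Yr m' a.+3 (n - a.+3) = Yr m a.+3 (n - a.+3).
    by apply: eq_Yr => c ?; rewrite !Em /shift_root; split; lia.
  rewrite !(eq_Xr (m := m') (m' := m)); try by move=> c ?; rewrite !Em /shift_root; split; lia.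
  have := lsig_Xr m h.+1 (a - h.+1) k2; have := lsig_Xr m 0 h k2.
  have := lsig_midS k2 vm; have := lsig_midR k2 vm; have := lsig_Yr m a.+3 (n - a.+3) k2.
  rewrite !subnKC // add0n.
  move: (midS m) (Yr m _ _) (Xr m h.+1 _) (midR m) (Xr m 0 h) => S Y X1 M X2 pY pM pS pX2 pX1.
  have := @act_pivot_mid k (S ++ Y ++ M ++ X1) u v X2 h.
  rewrite -!catA => -> //; rewrite ?pu ?pv ?pX2 // !lsig_cat pS pY pM pX1.
  rewrite bmulA -(@Ssig_cat _ _ 0 a.+3 n) // -(@Rsig_cat _ _ h.+1 a n); first by move: E1; rewrite /bmul /=; lia.
  by rewrite ha; lia.
have hk : h < a + k by have := vm h (a + k); case: (m h _) E1 => // c _ /(_ isT) /andP[].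
(* The dual case: (a, a+1) becomes (a, a+2) through [W_{a+1}], and now [midS] is unchanged. *)
have k1 : k = 1 by lia.
subst k; rewrite addn1 in hk E1 E2 Em *; have Eh : h = a by lia.
subst h; have z1 : m a.+1 a.+1 = 0 by apply: (valid0 vm); lia.
have ER : Rsig m a.+1 a.+1 n = (0, m a.+1 a.+2).
  rewrite (@Rsig_cat _ _ a.+1 a.+2 n) ?leqnSn //=; last by lia.
  rewrite Rsig1 Rsig0 ?z1 ?bmul1x // => h ?; split; apply: (valid0 vm); lia.
rewrite ER in E1; have lt_c : m a.+1 a.+2 < m a a.+1 by move: E1; rewrite /bmul /=; lia.
have eY : Yr m' a.+3 (n - a.+3) = Yr m a.+3 (n - a.+3).
  by apply: eq_Yr => c ?; rewrite !Em /shift_root; split; lia.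
have eX : Xr m' 0 a = Xr m 0 a by apply: eq_Xr => h ha; rewrite !Em /shift_root; split; lia.
have eS : midS m' = midS m by apply: eq_midS; rewrite ?/midn !Em /shift_root; lia.
rewrite /rank2_word eX eY eS; have [p Ep] : exists p, m a a.+1 = p.+1 by exists (m a a.+1).-1; lia.
rewrite /midR (_ : midn m' = m a.+1 a.+2); last by rewrite /midn !Em /shift_root; lia.
rewrite (_ : midn m = m a.+1 a.+2); last by rewrite /midn; lia.
have -> : m' a a.+1 = p by rewrite Em /shift_root Ep; lia.
have -> : m' a a.+2 + m' a.+1 a.+2 - m a.+1 a.+2 = (m a a.+2).+1 by rewrite !Em /shift_root; lia.
rewrite addnK Ep (nseq_rcons p).
have := lsig_midS k2 vm; have := lsig_Yr m a.+3 (n - a.+3) k2; have := lsig_Xr m 0 a k2.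
rewrite addn1 subnKC // add0n.
move: (midS m) (Yr _ _ _) (Xr _ _ _) => S Y X pX pY pS.
have := @act_pivot_mid 1 (S ++ Y ++ nseq (m a.+1 a.+2) (2, a))
  (nseq p (1, a)) (nseq (m a a.+2) (2, a)) X a.
have p2 c : lsig 1 (nseq c (2, a)) = (0, c) by lsig_simpl; congr pair; lia.
rewrite -!catA /= => -> //; rewrite ?p2 ?pX //.
- by lsig_simpl; lia.
- rewrite !lsig_cat pS pY p2 bmulA -(@Ssig_cat _ _ 0 a.+3 n) //.
  by move: E1; lsig_simpl; lia.
Qed.

End RankTwoWord.

(** * Recovering the matrix from the three-letter word *)

Section RankTwoInj.
Variables (n a : nat).
Hypothesis an : a.+2 < n.
Implicit Types m : nat -> nat -> nat.

Lemma count_rep c (w : seq (nat * nat)) x :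
  count_mem x (rep c w) = c * count_mem x w.
Proof. by elim: c => //= c IHc; rewrite /rep /= count_cat -/(rep c w) IHc mulSn. Qed.

Lemma all_rep (P : pred (nat * nat)) c w : all P w -> all P (rep c w).
Proof. by move=> Pw; elim: c => //= c; rewrite /rep /= all_cat Pw. Qed.

Lemma count_tagged (f : nat -> seq (nat * nat)) s v t : uniq s ->
  (forall x, all (fun y => y.2 == x) (f x)) ->
  count_mem (v, t) (flatten (map f s)) = if t \in s then count_mem (v, t) (f t) else 0.
Proof.
move=> + ft; elim: s => //= x s IHs /andP[xs us].
rewrite count_cat IHs // inE; have [->|tx] /= := eqVneq t x; first by rewrite (negPf xs) addn0.
suff -> : count_mem (v, t) (f x) = 0 by [].
apply/count_memPn; apply/negP => /(allP (ft x)) /=; by rewrite (negPf tx).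
Qed.

Lemma count_rank2_word m v t : count_mem (v, t) (rank2_word n a m) =
  count_mem (v, t) (midS a m) + (if a.+2 < t < n then count_mem (v, t) (colY a m t) else 0) +
  count_mem (v, t) (midR a m) + (if t < a then count_mem (v, t) (rowX a m t) else 0).
Proof.
rewrite /rank2_word (count_cat _ (midS a m)) (count_cat _ (Yr a m _ _)) (count_cat _ (midR a m)).
rewrite /Yr count_tagged ?iota_uniq // => [|x]; last first.
  by rewrite /colY !all_cat !all_rep //= eqxx.
rewrite /Xr count_tagged ?rev_uniq ?iota_uniq // => [|x]; last first.
  by rewrite /rowX !all_cat !all_nseq /= eqxx !orbT.
by rewrite mem_rev !mem_iota add0n subnKC //= !addnA.
Qed.

Lemma count_midS m v t : t != a.+1 -> count_mem (v, t) (midS a m) = 0.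
Proof.
move=> ta; rewrite /midS !count_cat !count_rep /= !xpair_eqE [a.+1 == t]eq_sym (negPf ta).
by rewrite !andbF !muln0.
Qed.

Lemma count_midR m v t : t != a -> count_mem (v, t) (midR a m) = 0.
Proof.
move=> ta; rewrite /midR !count_cat !count_nseq /= !xpair_eqE [a == t]eq_sym (negPf ta).
by rewrite !andbF !mul0n.
Qed.

Definition far a x := (x < a) || (a.+2 < x).

(** Counting letters with a given tag recovers the multiplicities of roots having an index among a,
    a+1, a+2: tag a+1 gives (a+1, a+2), and then tag a gives (a, a+1) and (a, a+2). The word does
    not see the remaining roots, which have both indices [far]. *)
Lemma rank2_word_inj m m' : valid n m -> valid n m' -> rank2_word n a m = rank2_word n a m' ->
  (forall x y, far a x -> far a y -> m x y = m' x y) -> m =2 m'.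
Proof.
move=> vm vm' E Efar x y.
have [xy|nxy] := boolP (x < y < n); last by rewrite !(valid0 _ nxy).
have C v t : count_mem (v, t) (rank2_word n a m) = count_mem (v, t) (rank2_word n a m') by rewrite E.
have [fx|nfx] := boolP (far a x); have [fy|nfy] := boolP (far a y).
- exact: Efar.
- have xa : x < a by move: fx nfy; rewrite /far; lia.
  move: (C 0 x) (C 1 x) (C 2 x); rewrite !count_rank2_word !count_midS ?count_midR; try by lia.
  have -> : a.+2 < x < n = false by lia.
  rewrite xa.
  rewrite /rowX !count_cat !count_nseq /= !xpair_eqE !eqxx /= => C0 C1 C2.
  have : (y == a) || (y == a.+1) || (y == a.+2) by move: nfy; rewrite /far; lia.
  by case/orP => [/orP[]|] /eqP ->; lia.
- have ya : a.+2 < y by move: fy nfx xy; rewrite /far; lia.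
  move: (C 0 y) (C 1 y) (C 2 y); rewrite !count_rank2_word !count_midS ?count_midR; try by lia.
  have -> : a.+2 < y < n by lia.
  have -> : y < a = false by lia.
  rewrite /colY !count_cat !count_rep /= !xpair_eqE !eqxx /= => C0 C1 C2.
  have : (x == a) || (x == a.+1) || (x == a.+2) by move: nfx; rewrite /far; lia.
  by case/orP => [/orP[]|] /eqP ->; lia.
have E23 : m a.+1 a.+2 = m' a.+1 a.+2.
  move: (C 0 a.+1); rewrite !count_rank2_word !count_midR; try by lia.
  have -> : a.+2 < a.+1 < n = false by lia.
  have -> : a.+1 < a = false by lia.
  by rewrite /midS !count_cat !count_rep /= !xpair_eqE !eqxx /=; lia.
have [E12 E13] : m a a.+1 = m' a a.+1 /\ m a a.+2 = m' a a.+2.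
  move: (C 1 a) (C 2 a); rewrite !count_rank2_word !count_midS; try by lia.
  have -> : a.+2 < a < n = false by lia.
  rewrite ltnn /midR !count_cat !count_nseq /= !xpair_eqE !eqxx /= /midn E23; lia.
have : [|| (x == a) && (y == a.+1), (x == a) && (y == a.+2) | (x == a.+1) && (y == a.+2)].
  by move: nfx nfy xy; rewrite /far; lia.
by case/or3P => /andP[/eqP -> /eqP ->].
Qed.

Lemma fstep_far k m m' : k < 2 -> fstep n (a + k) m m' ->
  forall x y, far a x -> far a y -> m' x y = m x y.
Proof.
by move=> k2 [b _ _ _ Em|h _ _ _ Em] x y; rewrite /far Em /shift_root; lia.
Qed.

End RankTwoInj.

(** * Iterates of the operators, commutation and braid identity *)

Section KostantOps.
Variable n : nat.
Implicit Types (alpha beta gamma : kostant n) (i j : 'I_n.-1).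

Lemma iter_opS op k alpha : iter_op op k.+1 alpha = obind op (@iter_op n op k alpha).
Proof. by []. Qed.

Lemma iter_op_add op k l alpha :
  iter_op op (k + l) alpha = obind (@iter_op n op k) (iter_op op l alpha).
Proof.
elim: k => [|k IHk]; first by case: (iter_op op l alpha).
by rewrite addSn !iter_opS IHk; case: (iter_op op l alpha).
Qed.

Lemma iter_opSr op k alpha : iter_op op k.+1 alpha = obind (@iter_op n op k) (op alpha).
Proof. by rewrite -addn1 iter_op_add. Qed.

Lemma iter_opS_some op k alpha beta : @iter_op n op k.+1 alpha = Some beta ->
  exists2 gamma, iter_op op k alpha = Some gamma & op gamma = Some beta.
Proof. by rewrite iter_opS; case: (iter_op op k alpha) => // gamma; exists gamma. Qed.

Lemma iter_opSr_some op k alpha beta : @iter_op n op k.+1 alpha = Some beta ->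
  exists2 gamma, op alpha = Some gamma & iter_op op k gamma = Some beta.
Proof. by rewrite iter_opSr; case: (op alpha) => // gamma; exists gamma. Qed.

Definition Ksig i alpha := Tsig n i (mult alpha).

Lemma f_op_Ksig i alpha beta : f_op i alpha = Some beta ->
  0 < (Ksig i alpha).1 /\ Ksig i beta = ((Ksig i alpha).1.-1, (Ksig i alpha).2.+1).
Proof. by move/f_opP/(fstep_Tsig (@mult_validP n alpha)). Qed.

Lemma iter_f_op_Ksig i k alpha beta : iter_op (f_op i) k alpha = Some beta ->
  k <= (Ksig i alpha).1 /\ Ksig i beta = ((Ksig i alpha).1 - k, (Ksig i alpha).2 + k).
Proof.
elim: k beta => [|k IHk] beta.
  by case=> <-; rewrite subn0 addn0 -surjective_pairing.
case/iter_opS_some => gamma E /f_op_Ksig[].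
by have [le_k ->] := IHk _ E; rewrite /= => lt0 ->; split; [lia | congr pair; lia].
Qed.

Lemma iter_f_op_ex i k alpha : k <= (Ksig i alpha).1 ->
  exists beta, iter_op (f_op i) k alpha = Some beta.
Proof.
elim: k => [|k IHk] lek; first by exists alpha.
have [gamma Eg] := IHk (ltnW lek); rewrite iter_opS Eg /=.
apply: f_op_ex; rewrite -/(Ksig i gamma); have [_ ->] := iter_f_op_Ksig Eg.
by rewrite /= subn_gt0.
Qed.

Lemma iter_f_op_e_op i k alpha beta :
  iter_op (f_op i) k alpha = Some beta -> iter_op (e_op i) k beta = Some alpha.
Proof.
elim: k alpha beta => [|k IHk] alpha beta; first by case=> ->.
by case/iter_opS_some => gamma /IHk E /f_op_e_op; rewrite iter_opSr => ->.
Qed.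

Lemma iter_f_op_inj i k alpha alpha' beta : iter_op (f_op i) k alpha = Some beta ->
  iter_op (f_op i) k alpha' = Some beta -> alpha = alpha'.
Proof. by move=> /iter_f_op_e_op E /iter_f_op_e_op; rewrite E => -[]. Qed.

Lemma f_op_comm i j alpha beta gamma : i.+1 < j ->
  f_op i alpha = Some beta -> f_op j alpha = Some gamma ->
  exists2 delta, f_op j beta = Some delta & f_op i gamma = Some delta.
Proof.
move=> ij /f_opP Fi /f_opP Fj.
have jn : j.+1 < n by exact: (ltn_ord (hi j)).
have [m' [H1 H2]] := fstep_comm ij jn (@mult_validP n alpha) Fi Fj.
have [d Ed Dm] := f_op_fstep H1; have [d' Ed' Dm'] := f_op_fstep H2.
exists d => //; rewrite Ed'; congr Some; apply: mult_inj => x y.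
by rewrite Dm Dm'.
Qed.

Lemma iter_f_op_comm i j k l alpha beta gamma : i.+1 < j ->
  iter_op (f_op i) k alpha = Some beta -> iter_op (f_op j) l alpha = Some gamma ->
  exists2 delta, iter_op (f_op j) l beta = Some delta & iter_op (f_op i) k gamma = Some delta.
Proof.
move=> ij.
have row a b c : f_op i a = Some b -> iter_op (f_op j) l a = Some c ->
    exists2 d, iter_op (f_op j) l b = Some d & f_op i c = Some d.
  elim: l a b c => [|l' IH] a b c Eab.
    by case=> <-; exists b.
  case/iter_opSr_some => a' Ea' Ea'c.
  have [b' Eb' Ea'b'] := f_op_comm ij Eab Ea'.
  have [d H1 H2] := IH _ _ _ Ea'b' Ea'c; exists d; last by [].
  by rewrite iter_opSr Eb'.
elim: k beta => [|k IHk] beta.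
  by case=> <-; exists gamma.
case/iter_opS_some => beta' E Ebb Eg.
have [d Ed Ed'] := IHk _ E Eg; have [d' H1 H2] := row _ _ _ Ebb Ed.
exists d'; first by [].
by rewrite iter_opS Ed'.
Qed.

Lemma iter_f_op_rank2_word a k i c alpha beta : a.+2 < n -> k < 2 -> i = a + k :> nat ->
  iter_op (f_op i) c alpha = Some beta ->
  rank2_word n a (mult beta) = iter c (act k) (rank2_word n a (mult alpha)) /\
  (forall x y, far a x -> far a y -> mult beta x y = mult alpha x y).
Proof.
move=> an k2 ik; elim: c beta => [|c IHc] beta; first by case=> <-.
case/iter_opS_some => gamma E /f_opP.
rewrite ik => F; have [Ew Ef] := IHc _ E.
split; first by rewrite (rank2_word_act an k2 (@mult_validP n gamma) F) Ew.
by move=> x y fx fy; rewrite (fstep_far an k2 F) ?Ef.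
Qed.

Lemma lsig_rank2_word_Ksig a k i alpha : a.+2 < n -> k < 2 -> i = a + k :> nat ->
  lsig k (rank2_word n a (mult alpha)) = Ksig i alpha.
Proof. by move=> an k2 ik; rewrite /Ksig ik; apply: lsig_rank2_word => //; exact: mult_validP. Qed.

Lemma f_op_braid i j a b alpha b1 b2 b3 c1 c2 c3 : j = i.+1 :> nat ->
  b + (Ksig i alpha).2 <= (Ksig i alpha).1 -> a + (Ksig j alpha).2 <= (Ksig j alpha).1 ->
  iter_op (f_op i) b alpha = Some b1 -> iter_op (f_op j) (a + b) b1 = Some b2 ->
  iter_op (f_op i) a b2 = Some b3 ->
  iter_op (f_op j) a alpha = Some c1 -> iter_op (f_op i) (a + b) c1 = Some c2 ->
  iter_op (f_op j) b c2 = Some c3 -> b3 = c3.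
Proof.
move=> ji wi wj B1 B2 B3 C1 C2 C3.
have an : i.+2 < n by have := ltn_ord (hi j); rewrite /= ji.
have i0 : i = i + 0 :> nat by rewrite addn0.
have j1 : j = i + 1 :> nat by rewrite addn1.
have [eB1 fB1] := iter_f_op_rank2_word an (isT : 0 < 2) i0 B1.
have [eB2 fB2] := iter_f_op_rank2_word an (isT : 1 < 2) j1 B2.
have [eB3 fB3] := iter_f_op_rank2_word an (isT : 0 < 2) i0 B3.
have [eC1 fC1] := iter_f_op_rank2_word an (isT : 1 < 2) j1 C1.
have [eC2 fC2] := iter_f_op_rank2_word an (isT : 0 < 2) i0 C2.
have [eC3 fC3] := iter_f_op_rank2_word an (isT : 1 < 2) j1 C3.
apply: mult_inj; apply: (rank2_word_inj an); try exact: mult_validP; last first.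
  by move=> x y fx fy; rewrite fB3 // fB2 // fB1 // fC3 // fC2 // fC1.
rewrite eB3 eB2 eB1 eC3 eC2 eC1; apply: word_braid.
- exact: letters_rank2_word.
- by rewrite (lsig_rank2_word_Ksig _ an _ i0).
- by rewrite (lsig_rank2_word_Ksig _ an _ j1).
- by rewrite -eB1 (lsig_rank2_word_Ksig _ an _ j1) //; have [] := iter_f_op_Ksig B2.
- by rewrite -eB1 -eB2 (lsig_rank2_word_Ksig _ an _ i0) //; have [] := iter_f_op_Ksig B3.
- by rewrite -eC1 (lsig_rank2_word_Ksig _ an _ i0) //; have [] := iter_f_op_Ksig C2.
- by rewrite -eC1 -eC2 (lsig_rank2_word_Ksig _ an _ j1) //; have [] := iter_f_op_Ksig C3.
Qed.

End KostantOps.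

(** * How often e_i applies *)

(* The number of times e_i applies, when the words W_i and W_i^*, deprived of *)
(* the c copies of the simple root, reduce to (+)^p(-)^q and (+)^p'(-)^q'.    *)
Definition elen (R S : nat * nat) (c : nat) : nat :=
  if c <= R.1 then
    if c <= S.1 then R.2 + (S.2 - (R.1 - c))
    else if S.2 + (c - S.1) <= R.1 - c then R.2 else 0
  else if c <= S.1 then S.2 else 0.

Definition elenm n i m := elen (Rsig m i 0 i) (Ssig m i i.+2 n) (m i i.+1).

Lemma Rsig_ge n i m : valid n m -> i.+1 < n -> Rsig m i i n = (0, m i i.+1).
Proof.
move=> vm iN; rewrite (@Rsig_cat _ _ i i.+1 n) ?Rsig1 ?Rsig0 ?bmul1x; last by lia.
  by rewrite (valid0 vm (a := i) (b := i)) //; lia.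
by move=> h' ?; split; apply: (valid0 vm); lia.
Qed.

Lemma Rsig_simple n i m : valid n m -> i.+1 < n ->
  Rsig m i 0 n = bmul (0, m i i.+1) (Rsig m i 0 i).
Proof.
by move=> vm iN; rewrite (@Rsig_cat _ _ 0 i n) ?Rsig_ge //; lia.
Qed.

Lemma Ssig_simple n i m b : valid n m -> i.+1 < b ->
  Ssig m i 0 b = bmul (0, m i i.+1) (Ssig m i i.+2 b).
Proof.
move=> vm ib; rewrite (@Ssig_cat _ _ 0 i.+2 b) //.
rewrite (@Ssig_cat _ _ 0 i.+1 i.+2) ?leqnSn // Ssig1 Ssig0 ?bmul1x.
  by rewrite (valid0 vm (a := i.+1) (b := i.+1)) //; lia.
by move=> h ?; split; apply: (valid0 vm); lia.
Qed.

Lemma Ssig_split_le m i lo b hi : lo <= b < hi ->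
  Ssig m i lo hi = bmul (Ssig m i lo b) (bmul (m i.+1 b, m i b) (Ssig m i b.+1 hi)).
Proof.
move=> lbh; rewrite (@Ssig_cat _ _ lo b hi) ?(@Ssig_cat _ _ b b.+1 hi) ?Ssig1 //; lia.
Qed.

Lemma estep_fstep n i m m' : valid n m -> estep n i m m' -> fstep n i m' m.
Proof.
move=> vm [b bn nb E1 E2 Em|h hn nh E1 E2 Em].
  have ib : i < b by have := vm i b; case: (m i b) E2 => // k _ /(_ isT) /andP[].
  have ES lo hi : (b < lo) || (hi <= b) -> Ssig m' i lo hi = Ssig m i lo hi.
    by move=> lohi; apply: eq_Ssig => c lhc; rewrite !Em /shift_root; split; lia.
  have ER lo hi : Rsig m' i lo hi = Rsig m i lo hi.
    by apply: eq_Rsig => h _; rewrite !Em /shift_root; split; lia.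
  apply: (@FStar _ _ _ _ b); rewrite ?ES ?ER ?Em ?leqnn ?orbT ?ltnSn //; try by rewrite /shift_root; lia.
  by move=> x y; rewrite (eq_shift_root _ _ _ _ Em) shift_rootK //; lia.
have hi : h < i.+1 by have := vm h i.+1; case: (m h i.+1) E2 => // k _ /(_ isT) /andP[].
have ER lo hi' : (h < lo) || (hi' <= h) -> Rsig m' i lo hi' = Rsig m i lo hi'.
  by move=> lohi; apply: eq_Rsig => c lhc; rewrite !Em /shift_root; split; lia.
have ES lo hi' : Ssig m' i lo hi' = Ssig m i lo hi'.
  by apply: eq_Ssig => c _; rewrite !Em /shift_root; split; lia.
apply: (@FNons _ _ _ _ h); rewrite ?ES ?ER ?Em ?leqnn ?orbT ?ltnSn //; try by rewrite /shift_root; lia.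
by move=> x y; rewrite (eq_shift_root _ _ _ _ Em) shift_rootK //; lia.
Qed.

Lemma bmul_pivot A x y B : A.2 <= x -> B.1 <= y ->
  bmul A (bmul (x, y) B) = (A.1 + (x - A.2), B.2 + (y - B.1)).
Proof. by rewrite /bmul /= => *; congr pair; lia. Qed.

Lemma elen_star p q P Q c : c <= P -> p - c <= Q ->
  elen (p, q) (P, Q.+1) c = (elen (p, q) (P.+1, Q) c).+1.
Proof.
move=> cP pQ; rewrite /elen /= cP (leqW cP).
by case: (leqP c p) => cp //; lia.
Qed.

Lemma elen_nons p q P Q c : c + (Q + (c - P)) <= p ->
  elen (p, q.+1) (P, Q) c = (elen (p.+1, q) (P, Q) c).+1.
Proof.
move=> H; have cp : c <= p by lia.
rewrite /elen /= cp (leqW cp); case: (leqP c P) => cP; first by lia.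
by rewrite !ifT; lia.
Qed.

(** The pivot becomes the leftmost uncancelled - and does not lie below the simple root, so [e_i]
    can first undo this step and then continue as before. *)
Lemma elenm_fstep n i m m' : i.+1 < n -> valid n m -> fstep n i m m' ->
  elenm n i m' = (elenm n i m).+1.
Proof.
move=> iN vm [b bn E1 E2 Em|h hn E1 E2 Em].
  have ib : i.+1 < b by have := vm i.+1 b; case: (m i.+1 b) E1 => // k _ /(_ isT) /andP[].
  have Sb : i.+2 <= b < n by lia.
  move: E1 E2; rewrite (Ssig_simple vm ib) (Rsig_simple vm iN) /elenm !(Ssig_split_le _ _ Sb).
  have -> : Ssig m' i i.+2 b = Ssig m i i.+2 b.
    by apply: eq_Ssig => c lhc; rewrite !Em /shift_root; split; lia.
  have -> : Ssig m' i b.+1 n = Ssig m i b.+1 n.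
    by apply: eq_Ssig => c lhc; rewrite !Em /shift_root; split; lia.
  have -> : Rsig m' i 0 i = Rsig m i 0 i.
    by apply: eq_Rsig => h _; rewrite !Em /shift_root; split; lia.
  have -> : m' i i.+1 = m i i.+1 by rewrite Em /shift_root; lia.
  have -> : m' i.+1 b = (m i.+1 b).-1 by rewrite Em /shift_root; lia.
  have -> : m' i b = (m i b).+1 by rewrite Em /shift_root; lia.
  move: (Ssig _ _ _ b) (Ssig _ _ _ n) (Rsig _ _ _ _) (m i.+1 b) (m i b) (m i i.+1).
  move=> A B [p q] [//|x] y c E1 E2; move: E1 E2.
  rewrite [(bmul (0, c) A).2]/= [(bmul B _).1]/= [x.+1.-1]/= ltnS => E1 E2.
  rewrite !bmul_pivot; try by lia.
  have -> : A.1 + (x.+1 - A.2) = (A.1 + (x - A.2)).+1 by lia.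
  have -> : B.2 + (y.+1 - B.1) = (B.2 + (y - B.1)).+1 by lia.
  by apply: elen_star; lia.
have ih : h < i by have := vm h i; case: (m h i) E1 => // k _ /(_ isT) /andP[].
move: E1 E2; rewrite /elenm !(Rsig_split _ _ ih).
rewrite (@Rsig_cat m i h.+1 i n); last by lia.
rewrite Rsig_ge // (Ssig_simple vm iN).
have -> : Rsig m' i 0 h = Rsig m i 0 h.
  by apply: eq_Rsig => c lhc; rewrite !Em /shift_root; split; lia.
have -> : Rsig m' i h.+1 i = Rsig m i h.+1 i.
  by apply: eq_Rsig => c lhc; rewrite !Em /shift_root; split; lia.
have -> : Ssig m' i i.+2 n = Ssig m i i.+2 n.
  by apply: eq_Ssig => c _; rewrite !Em /shift_root; split; lia.
have -> : m' i i.+1 = m i i.+1 by rewrite Em /shift_root; lia.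
have -> : m' h i = (m h i).-1 by rewrite Em /shift_root; lia.
have -> : m' h i.+1 = (m h i.+1).+1 by rewrite Em /shift_root; lia.
move: (Rsig _ _ _ i) (Rsig _ _ _ h) (Ssig _ _ _ _) (m h i) (m h i.+1) (m i i.+1).
move=> A B [P Q] [//|x] y c E1 E2; move: E1.
rewrite [(bmul (bmul _ _) _).2]/= [x.+1.-1]/= ltnS => E1.
rewrite !bmul_pivot; try by lia.
have -> : A.1 + (x.+1 - A.2) = (A.1 + (x - A.2)).+1 by lia.
have -> : B.2 + (y.+1 - B.1) = (B.2 + (y - B.1)).+1 by lia.
by apply: elen_nons; lia.
Qed.

Lemma Rsig_pivotm m i c k : c <= (Rsig m i 0 k).1 -> 0 < (Rsig m i 0 k).2 ->
  exists2 h, h < k & (bmul (0, c) (Rsig m i h.+1 k)).2 <= m h i /\ (Rsig m i 0 h).1 < m h i.+1.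
Proof.
elim: k c => [|k IHk] c; first by rewrite /Rsig big_geq.
rewrite (@Rsig_cat _ _ 0 k) ?leqnSn // Rsig1 /bmul /= => ck q0.
have [qR|Rq] := leqP (m k i.+1) (Rsig m i 0 k).1; last first.
  exists k => //; split=> //; rewrite /Rsig big_geq //=; lia.
have [||h hk [E1 E2]] := IHk (m k i.+1 + (c - m k i)); [by lia | by lia |].
exists h; first exact: ltnW; split=> //.
by rewrite (@Rsig_cat _ _ h.+1 k) ?Rsig1 ?hk ?leqnSn //; move: E1; rewrite /bmul /=; lia.
Qed.

Lemma Ssig_pivotm m i n T d lo c : lo + d = n ->
  c <= (Ssig m i lo n).1 -> T.1 < (Ssig m i lo n).2 ->
  exists2 b, lo <= b < n & (bmul (0, c) (Ssig m i lo b)).2 <= m i.+1 b /\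
    (bmul (Ssig m i b.+1 n) T).1 < m i b.
Proof.
elim: d lo c => [|d IHd] lo c.
  by rewrite addn0 => ->; rewrite /Ssig big_geq.
move=> En; have ln : lo < n by lia.
rewrite (@Ssig_cat _ _ lo lo.+1 n) ?leqnSn // Ssig1 => c1 c2.
have [qT|Tq] := leqP (m i lo) (bmul (Ssig m i lo.+1 n) T).1; last first.
  exists lo; rewrite ?leqnn //; split=> //; rewrite /Ssig big_geq //=.
  by move: c1 Tq; rewrite /bmul /=; lia.
have [|||b /andP[lb bn] [E1 E2]] := IHd lo.+1 (m i lo + (c - m i.+1 lo)); first by lia.
- by move: c1 c2 qT; rewrite /bmul /=; lia.
- by move: c2 qT; rewrite /bmul /=; lia.
exists b; first by rewrite bn ltnW.
split=> //; rewrite (@Ssig_cat _ _ lo lo.+1 b) ?Ssig1 ?leqnSn //.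
by move: E1; rewrite /bmul /=; lia.
Qed.

Lemma estep_ex n i m : valid n m -> i.+1 < n -> 0 < elenm n i m -> exists m', estep n i m m'.
Proof.
move=> vm iN; pose c := m i i.+1; pose R := Rsig m i 0 i; pose S := Ssig m i i.+2 n.
(* [star] and [nons] treat a leftmost uncancelled - lying in [W_i^*] and in [W_i]; in both, the
   simple roots preceding it are cancelled. *)
have star : c <= S.1 -> R.1 - c < S.2 -> exists m', estep n i m m'.
  move=> cS RS; have [|||b /andP[ib bn] [E1 E2]] := @Ssig_pivotm m i n (Rsig m i 0 n) (n - i.+2) i.+2 c.
  - by lia.
  - exact: cS.
  - by rewrite Rsig_simple // /bmul /=; move: RS; rewrite /R /c add0n.
  exists (shift_root i b i.+1 b m); apply: (EStar bn) => //; first by lia.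
  by rewrite (Ssig_simple vm ib).
have nons : c + (S.2 + (c - S.1)) <= R.1 -> 0 < R.2 -> exists m', estep n i m m'.
  move=> cR R0; have [//|//|h ih [E1 E2]] := @Rsig_pivotm m i (c + (S.2 + (c - S.1))) i.
  exists (shift_root h i.+1 h i m); apply: (@ENons _ _ _ _ h) => //; [by lia | by lia |].
  rewrite (@Rsig_cat m i h.+1 i n); last by lia.
  rewrite Rsig_ge // (Ssig_simple vm iN) -/c -/S.
  by move: E1; rewrite /bmul /=; lia.
rewrite /elenm /elen -/c -/R -/S => e0.
have [RS|SR] := ltnP (R.1 - c) (S.2 + (c - S.1)).
  apply: star; move: e0; rewrite [_ <= R.1 - c]leqNgt RS /=; case: (leqP c R.1) => cR; case: (leqP c S.1) => cS //; lia.
apply: nons; move: e0; rewrite SR; case: (leqP c R.1) => cR; case: (leqP c S.1) => cS //; lia.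
Qed.

(* One symbol + has been added to, or one symbol - removed from, a word.      *)
Definition better (x y : nat * nat) := y = (x.1.+1, x.2) \/ (y.1, y.2.+1) = x.

Lemma better_minus A x y B : better (bmul A (bmul (x, y.+1) B)) (bmul A (bmul (x, y) B)).
Proof.
rewrite /better /bmul /=; case: A B => [a1 a2] [b1 b2] /=.
have [H|H] := leqP b1 y; first by right; congr pair; lia.
have [H2|H2] := leqP a2 (x + (b1 - y.+1)); first by left; congr pair; lia.
by right; congr pair; lia.
Qed.

Lemma better_plus A x y B : better (bmul A (bmul (x, y) B)) (bmul A (bmul (x.+1, y) B)).
Proof.
rewrite /better /bmul /=; case: A B => [a1 a2] [b1 b2] /=.
have [H|H] := leqP a2 (x + (b1 - y)); first by left; congr pair; lia.
by right; congr pair; lia.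
Qed.

Lemma elen_better_R R R' S c : better R R' -> elen R S c <= (elen R' S c).+1.
Proof.
rewrite /elen; case: R R' S => [p q] [p' q'] [P Q] /= [[-> ->]|[<- <-]];
by do ?[case: ifP => ?]; lia.
Qed.

Lemma elen_better_S R S S' c : better S S' -> elen R S c <= (elen R S' c).+1.
Proof.
rewrite /elen; case: S S' R => [p q] [p' q'] [P Q] /= [[-> ->]|[<- <-]];
by do ?[case: ifP => ?]; lia.
Qed.

Lemma elen_worse_R R R' S c : better R' R -> elen R S c.+1 <= (elen R' S c).+1.
Proof.
rewrite /elen; case: R R' S => [p q] [p' q'] [P Q] /= [[-> ->]|[<- <-]];
by do ?[case: ifP => ?]; lia.
Qed.

Lemma elen_worse_S R S S' c : better S' S -> elen R S c.+1 <= (elen R S' c).+1.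
Proof.
rewrite /elen; case: S S' R => [p q] [p' q'] [P Q] /= [[-> ->]|[<- <-]];
by do ?[case: ifP => ?]; lia.
Qed.

(** The step changes the data of [e_i] in one of three ways: a + is added to [W_i^*], a - is removed
    from [W_i], or a simple root (i, i+1) is replaced by (i, i+2). Each costs at most 1.
    [elenm_fstep_pred] is the mirror image. *)
Lemma elenm_fstep_succ n i m m' : i.+2 < n -> valid n m -> fstep n i.+1 m m' ->
  elenm n i m <= (elenm n i m').+1.
Proof.
move=> n2 vm [b bn E1 _ Em|h hn E1 _ Em]; rewrite /elenm.
  have ib : i.+2 < b by have := vm i.+2 b; case: (m i.+2 b) E1 => // k _ /(_ isT) /andP[].
  have -> : Rsig m' i 0 i = Rsig m i 0 i by apply: eq_Rsig => c lhc; rewrite !Em /shift_root; split; lia.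
  have -> : m' i i.+1 = m i i.+1 by rewrite Em /shift_root; lia.
  apply: elen_better_S; have lb : i.+2 <= b < n by lia.
  rewrite !(Ssig_split_le _ _ lb).
  have -> : Ssig m' i i.+2 b = Ssig m i i.+2 b.
    by apply: eq_Ssig => c lhc; rewrite !Em /shift_root; split; lia.
  have -> : Ssig m' i b.+1 n = Ssig m i b.+1 n.
    by apply: eq_Ssig => c lhc; rewrite !Em /shift_root; split; lia.
  have -> : m' i b = m i b by rewrite Em /shift_root; lia.
  have -> : m' i.+1 b = (m i.+1 b).+1 by rewrite Em /shift_root; lia.
  exact: better_plus.
have hi : h < i.+1 by have := vm h i.+1; case: (m h i.+1) E1 => // k _ /(_ isT) /andP[].
have [hi'|hi'] := ltnP h i.
  have -> : Ssig m' i i.+2 n = Ssig m i i.+2 n.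
    by apply: eq_Ssig => c lhc; rewrite !Em /shift_root; split; lia.
  have -> : m' i i.+1 = m i i.+1 by rewrite Em /shift_root; lia.
  apply: elen_better_R; rewrite !(Rsig_split _ _ hi').
  have -> : Rsig m' i 0 h = Rsig m i 0 h by apply: eq_Rsig => c lhc; rewrite !Em /shift_root; split; lia.
  have -> : Rsig m' i h.+1 i = Rsig m i h.+1 i.
    by apply: eq_Rsig => c lhc; rewrite !Em /shift_root; split; lia.
  have -> : m' h i = m h i by rewrite Em /shift_root; lia.
  have -> : m h i.+1 = (m' h i.+1).+1 by rewrite Em /shift_root; lia.
  exact: better_minus.
(* The third way: [c] drops by one while [W_i^*] gains a -. *)
have {hi hi'} Eh : h = i by lia.
subst h; have -> : Rsig m' i 0 i = Rsig m i 0 i by apply: eq_Rsig => c lhc; rewrite !Em /shift_root; split; lia.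
have -> : m i i.+1 = (m' i i.+1).+1 by rewrite Em /shift_root; lia.
apply: elen_worse_S; have lb : i.+2 <= i.+2 < n by rewrite leqnn.
rewrite !(Ssig_split_le _ _ lb).
have -> : Ssig m' i i.+2 i.+2 = Ssig m i i.+2 i.+2.
  by apply: eq_Ssig => c lhc; rewrite !Em /shift_root; split; lia.
have -> : Ssig m' i i.+3 n = Ssig m i i.+3 n.
  by apply: eq_Ssig => c lhc; rewrite !Em /shift_root; split; lia.
have -> : m' i.+1 i.+2 = m i.+1 i.+2 by rewrite Em /shift_root; lia.
have -> : m' i i.+2 = (m i i.+2).+1 by rewrite Em /shift_root; lia.
exact: better_minus.
Qed.

Lemma elenm_fstep_pred n i m m' : valid n m -> fstep n i m m' ->
  elenm n i.+1 m <= (elenm n i.+1 m').+1.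
Proof.
move=> vm [b bn E1 _ Em|h hn E1 _ Em]; rewrite /elenm; last first.
  have hi : h < i by have := vm h i; case: (m h i) E1 => // k _ /(_ isT) /andP[].
  have -> : Ssig m' i.+1 i.+3 n = Ssig m i.+1 i.+3 n.
    by apply: eq_Ssig => c lhc; rewrite !Em /shift_root; split; lia.
  have -> : m' i.+1 i.+2 = m i.+1 i.+2 by rewrite Em /shift_root; lia.
  apply: elen_better_R; rewrite !(Rsig_split _ _ (leqW hi)).
  have -> : Rsig m' i.+1 0 h = Rsig m i.+1 0 h.
    by apply: eq_Rsig => c lhc; rewrite !Em /shift_root; split; lia.
  have -> : Rsig m' i.+1 h.+1 i.+1 = Rsig m i.+1 h.+1 i.+1.
    by apply: eq_Rsig => c lhc; rewrite !Em /shift_root; split; lia.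
  have -> : m' h i.+2 = m h i.+2 by rewrite Em /shift_root; lia.
  have -> : m' h i.+1 = (m h i.+1).+1 by rewrite Em /shift_root; lia.
  exact: better_plus.
have ib : i.+1 < b by have := vm i.+1 b; case: (m i.+1 b) E1 => // k _ /(_ isT) /andP[].
have [ib2|ib2] := ltnP i.+2 b.
  have -> : Rsig m' i.+1 0 i.+1 = Rsig m i.+1 0 i.+1.
    by apply: eq_Rsig => c lhc; rewrite !Em /shift_root; split; lia.
  have -> : m' i.+1 i.+2 = m i.+1 i.+2 by rewrite Em /shift_root; lia.
  apply: elen_better_S; have lb : i.+3 <= b < n by lia.
  rewrite !(Ssig_split_le _ _ lb).
  have -> : Ssig m' i.+1 i.+3 b = Ssig m i.+1 i.+3 b.
    by apply: eq_Ssig => c lhc; rewrite !Em /shift_root; split; lia.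
  have -> : Ssig m' i.+1 b.+1 n = Ssig m i.+1 b.+1 n.
    by apply: eq_Ssig => c lhc; rewrite !Em /shift_root; split; lia.
  have -> : m' i.+2 b = m i.+2 b by rewrite Em /shift_root; lia.
  have -> : m i.+1 b = (m' i.+1 b).+1 by rewrite Em /shift_root; lia.
  exact: better_minus.
have {ib ib2} Eb : b = i.+2 by lia.
subst b; have -> : Ssig m' i.+1 i.+3 n = Ssig m i.+1 i.+3 n.
  by apply: eq_Ssig => c lhc; rewrite !Em /shift_root; split; lia.
have -> : m i.+1 i.+2 = (m' i.+1 i.+2).+1 by rewrite Em /shift_root; lia.
apply: elen_worse_R; rewrite !(Rsig_split _ _ (ltnSn i)).
have -> : Rsig m' i.+1 0 i = Rsig m i.+1 0 i.
  by apply: eq_Rsig => c lhc; rewrite !Em /shift_root; split; lia.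
have -> : Rsig m' i.+1 i.+1 i.+1 = Rsig m i.+1 i.+1 i.+1.
  by apply: eq_Rsig => c lhc; rewrite !Em /shift_root; split; lia.
have -> : m' i i.+1 = m i i.+1 by rewrite Em /shift_root; lia.
have -> : m' i i.+2 = (m i i.+2).+1 by rewrite Em /shift_root; lia.
exact: better_minus.
Qed.

(** * Preimages under powers of [f_i] *)

Section KostantE.
Variable n : nat.
Implicit Types (alpha beta gamma : kostant n) (i j : 'I_n.-1).

Definition elenk i alpha := elenm n i (mult alpha).

Lemma iter_f_op_elenk i k alpha beta : iter_op (f_op i) k alpha = Some beta ->
  k <= elenk i beta.
Proof.
elim: k beta => [//|k IHk] beta /iter_opS_some[gamma /IHk le_k /f_opP F].
by rewrite /elenk (elenm_fstep (ltn_ord (hi i)) (@mult_validP n gamma) F) ltnS.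
Qed.

Lemma iter_f_op_elenk_adj i j k alpha beta : i = j.+1 :> nat \/ j = i.+1 :> nat ->
  iter_op (f_op j) k alpha = Some beta -> elenk i alpha <= elenk i beta + k.
Proof.
move=> ij; elim: k beta => [|k IHk] beta; first by case=> ->; rewrite addn0.
case/iter_opS_some => gamma /IHk le_k /f_opP F; apply: leq_trans le_k _.
rewrite addnS -addSn leq_add2r /elenk; case: ij => E; last first.
  rewrite E in F; apply: elenm_fstep_succ F; last exact: mult_validP.
  by have := ltn_ord (hi j); rewrite /= E.
by rewrite E; exact: (elenm_fstep_pred (@mult_validP n gamma) F).
Qed.

Lemma iter_f_op_pre i k alpha : k <= elenk i alpha ->
  exists beta, iter_op (f_op i) k beta = Some alpha.
Proof.
elim: k alpha => [|k IHk] alpha; first by exists alpha.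
move=> lek; have iN : i.+1 < n := ltn_ord (hi i).
have [|m' Em'] := estep_ex (@mult_validP n alpha) iN; first exact: leq_ltn_trans lek.
have [gamma Eg Mg] := e_op_estep Em'.
have F : fstep n i (mult gamma) (mult alpha).
  apply: estep_fstep; first exact: mult_validP.
  by case: Em' => [b|h] H1 H2 H3 H4 H5; [apply: (EStar H1) | apply: (ENons H1)] => // x y; rewrite Mg H5.
have [|beta Eb] := IHk gamma.
  by move: lek; rewrite /elenk (elenm_fstep iN (@mult_validP n gamma) F) ltnS.
by exists beta; rewrite iter_opS Eb; apply/f_opP.
Qed.

End KostantE.

(** * Weights of Kostant partitions *)

Section Weights.
Variable n : nat.
Implicit Types (alpha beta gamma : kostant n) (i j : 'I_n.-1).
Local Open Scope ring_scope.

Definition root_vec (r : root n) : 'rV[int]_n := eps (fst_ix r) - eps (snd_ix r).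

Lemma kostant_sum1D r alpha : kostant_sum (r +` alpha)%mset = root_vec r + kostant_sum alpha.
Proof.
have P : perm_eq (enum_mset (r +` alpha)%mset) (r :: enum_mset alpha).
  apply/allP => r' _ /=; apply/eqP.
  by rewrite -[LHS]/(count_mem r' (r +` alpha)%mset) count_mem_mset mset1DE count_mem_mset eq_sym.
by rewrite /kostant_sum (perm_big _ P) big_cons.
Qed.

Lemma kostant_sum_replace alpha r (u : 'I_n * 'I_n) : r \in alpha -> (u.1 < u.2)%N ->
  kostant_sum (replace alpha r u) = kostant_sum alpha + (eps u.1 - eps u.2) - root_vec r.
Proof.
move=> ra u12; have := kostant_sum1D r (alpha `\ r)%mset; rewrite (msetB1K ra) => ->.
rewrite /replace kostant_sum1D.
have -> : root_vec (insubd r u) = eps u.1 - eps u.2.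
  by rewrite /root_vec /fst_ix /snd_ix -!/(val (insubd r u)) val_insubd u12.
by rewrite [RHS]addrAC [root_vec r + _]addrC addrK addrC.
Qed.

Lemma f_op_sum i alpha beta : f_op i alpha = Some beta ->
  kostant_sum beta = kostant_sum alpha + simple_root i.
Proof.
rewrite /f_op; have memW r : r \in pluses (reduce (W i alpha)) -> r \in alpha /\ snd_ix r = lo i.
  by rewrite pluses_reduce => /(proj1 (red_sub _ _))/mem_W.
have memS r : r \in pluses (reduce (Wstar i alpha)) -> r \in alpha /\ fst_ix r = hi i.
  by rewrite pluses_reduce => /(proj1 (red_sub _ _))/mem_Wstar.
case: ifP => _.
  case E: (rev _) => [//|r s] [<-].
  have [|ra sr] := memW r; first by rewrite -mem_rev E mem_head.
  rewrite kostant_sum_replace //=; last by have := fst_lt_snd r; rewrite sr => /ltnW.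
  rewrite /root_vec sr /simple_root -addrA; congr (_ + _).
  by rewrite opprB addrC addrA subrK.
case E: (rev _) => [//|r s] [<-].
have [|ra sr] := memS r; first by rewrite -mem_rev E mem_head.
rewrite kostant_sum_replace //=; last by have := fst_lt_snd r; rewrite sr => /ltnW.
rewrite /root_vec sr /simple_root -addrA; congr (_ + _).
by rewrite opprB addrA subrK.
Qed.

Lemma iter_f_op_sum i k alpha beta : iter_op (f_op i) k alpha = Some beta ->
  kostant_sum beta = kostant_sum alpha + simple_root i *+ k.
Proof.
elim: k beta => [|k IHk] beta; first by case=> ->; rewrite mulr0n addr0.
by case/iter_opS_some => gamma /IHk E /f_op_sum ->; rewrite E mulrSr -[LHS]addrA.
Qed.

Lemma big_bmul_balance (p q : nat -> nat) (s : seq nat) :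
  ((\big[bmul/(0, 0)]_(k <- s) (p k, q k)).1 + \sum_(k <- s) q k =
  (\big[bmul/(0, 0)]_(k <- s) (p k, q k)).2 + \sum_(k <- s) p k)%N.
Proof.
elim: s => [|k s IHs]; first by rewrite !big_nil.
rewrite !big_cons; move: IHs; move: (\big[bmul/(0, 0)%N]_(k <- s) _) => [x y].
by rewrite /bmul /=; lia.
Qed.

Lemma sum_mult_row alpha a :
  (\sum_(0 <= b < n) mult alpha a b = count (fun r => fst_ix r == a :> nat) (enum_mset alpha))%N.
Proof.
rewrite /mult; elim: (enum_mset alpha) => [|r s IHs] /=; first by rewrite big1.
rewrite big_split /= IHs; congr (_ + _)%N.
rewrite (big_cat_nat (n := snd_ix r)) //=; last exact: ltnW.
rewrite big_nat big1 => [|b /andP[_ br]]; last by rewrite [_ == b]eq_sym (ltn_eqF br) andbF.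
rewrite big_ltn // eqxx andbT big_nat big1 ?addn0 // => b /andP[rb _].
by rewrite (ltn_eqF rb) andbF.
Qed.

Lemma sum_mult_col alpha b :
  (\sum_(0 <= a < n) mult alpha a b = count (fun r => snd_ix r == b :> nat) (enum_mset alpha))%N.
Proof.
rewrite /mult; elim: (enum_mset alpha) => [|r s IHs] /=; first by rewrite big1.
rewrite big_split /= IHs; congr (_ + _)%N.
rewrite (big_cat_nat (n := fst_ix r)) //=; last exact: ltnW.
rewrite big_nat big1 => [|a /andP[_ ar]]; last by rewrite [_ == a]eq_sym (ltn_eqF ar).
rewrite big_ltn // eqxx /= big_nat big1 ?addn0 // => a /andP[ra _].
by rewrite (ltn_eqF ra).
Qed.

(** Roots below a - pair to +1 and roots below a + to -1, a simple root being counted once in each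
    word; each cancellation removes one symbol of either sign. *)
Lemma pairing_kostant_sum i alpha :
  pairing (kostant_sum alpha) i = (Ksig i alpha).2%:Z - (Ksig i alpha).1%:Z.
Proof.
have -> : pairing (kostant_sum alpha) i =
   (count (fun r => fst_ix r == i :> nat) (enum_mset alpha))%:Z
   + (count (fun r => snd_ix r == i.+1 :> nat) (enum_mset alpha))%:Z
   - (count (fun r => fst_ix r == i.+1 :> nat) (enum_mset alpha))%:Z
   - (count (fun r => snd_ix r == i :> nat) (enum_mset alpha))%:Z.
  rewrite /pairing /kostant_sum; elim: (enum_mset alpha) => [|r s IHs].
    by rewrite big_nil !mxE.
  rewrite big_cons; move: (\sum_(j <- s) _) IHs => X IHs.
  rewrite !mxE /= !natz -!val_eqE /=.
  by move: IHs; lia.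
have B1 := @big_bmul_balance (mult alpha i.+1) (mult alpha i) (index_iota 0 n).
have B2 := @big_bmul_balance ((mult alpha)^~ i) ((mult alpha)^~ i.+1) (rev (index_iota 0 n)).
move: B1 B2; rewrite rev_big_rev !(perm_big _ (permEl (perm_rev _))) /= !sum_mult_row !sum_mult_col.
rewrite -/(Ssig (mult alpha) i 0 n).
rewrite -[\big[_/_]_(i0 <- _) (mult alpha i0 i, mult alpha i0 i.+1)]/(Rsig (mult alpha) i 0 n).
by rewrite /Ksig /Tsig /bmul /=; lia.
Qed.

End Weights.

(** * Inversions and length *)

Import GroupScope Order.TTheory.
Local Open Scope nat_scope.

Section Inversions.
Variable n : nat.
Implicit Types (w u v : 'S_n) (i j : 'I_n.-1) (x y z : 'I_n).

Lemma simple_refl_val i x : simple_refl i x =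
  (if x == i :> nat then i.+1 else if x == i.+1 :> nat then i : nat else x) :> nat.
Proof.
rewrite /simple_refl; case: tpermP => [->|->|] /=; first by rewrite eqxx.
  by rewrite eqxx (gtn_eqF (ltnSn i)).
by move=> /eqP; rewrite -val_eqE /= => /negPf -> /eqP; rewrite -val_eqE /= => /negPf ->.
Qed.

Lemma simple_reflK i w : wmul (simple_refl i) (wmul (simple_refl i) w) = w.
Proof. by rewrite /wmul -mulgA tperm2 mulg1. Qed.

Lemma simple_refl_comm i j w : i.+1 < j ->
  wmul (simple_refl j) (wmul (simple_refl i) w) = wmul (simple_refl i) (wmul (simple_refl j) w).
Proof.
move=> ij; apply/permP => x; apply: val_inj.
rewrite !wmulE /= !simple_refl_val; do ?[case: eqP => //=]; lia.
Qed.

Lemma simple_refl_braid i j w : j = i.+1 :> nat ->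
  wmul (simple_refl i) (wmul (simple_refl j) (wmul (simple_refl i) w)) =
  wmul (simple_refl j) (wmul (simple_refl i) (wmul (simple_refl j) w)).
Proof.
move=> ij; apply/permP => x; apply: val_inj.
rewrite !wmulE /= !simple_refl_val ij; move: (nat_of_ord (w x)) => k.
by do ?[case: eqP => //=]; lia.
Qed.

Definition Inv w := [set p : 'I_n * 'I_n | (p.1 < p.2) && (w p.2 < w p.1)].
Definition descent w i := w^-1%g (hi i) < w^-1%g (lo i).

(** Multiplying by [s_i] on the left exchanges the values i and i+1, which affects the relative
    order only of the two positions carrying them. *)
Lemma Inv_descent w i : descent w i ->
  Inv w = (w^-1%g (hi i), w^-1%g (lo i)) |: Inv (wmul (simple_refl i) w)
  /\ (w^-1%g (hi i), w^-1%g (lo i)) \notin Inv (wmul (simple_refl i) w).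
Proof.
rewrite /descent; set a := w^-1%g (hi i); set b := w^-1%g (lo i) => ab.
have wa : w a = hi i by rewrite permKV.
have wb : w b = lo i by rewrite permKV.
have E x y : w x = y -> x = w^-1%g y by move=> <-; rewrite permK.
split; last first.
  by rewrite inE /= !wmulE wa wb /simple_refl tpermL tpermR /= andbC ltnNge leqnSn.
apply/setP => -[p q]; rewrite !inE /= !wmulE !simple_refl_val xpair_eqE.
have -> : (p == a) = (w p == i.+1 :> nat).
  by rewrite -(inj_eq (@perm_inj _ w)) wa -val_eqE.
have -> : (q == b) = (w q == i :> nat).
  by rewrite -(inj_eq (@perm_inj _ w)) wb -val_eqE.
have pq : w p = w q :> nat -> (p < q) = false by move=> /val_inj/perm_inj ->; rewrite ltnn.
have H1 : w p = i.+1 :> nat -> w q = i :> nat -> p < q.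
  move=> P Q; have -> : p = a by apply: E; apply: val_inj.
  by have -> : q = b by apply: E; apply: val_inj.
have H2 : w p = i :> nat -> w q = i.+1 :> nat -> (p < q) = false.
  move=> P Q; have -> : p = b by apply: E; apply: val_inj.
  have -> : q = a by apply: E; apply: val_inj.
  by apply/negbTE; rewrite -leqNgt ltnW.
move: pq H1 H2; move: (nat_of_ord (w p)) (nat_of_ord (w q)) => P Q.
case: (p < q) => /= pq H1 H2; last by rewrite orbF; case: eqP => //= Pi; case: eqP => //= /(H1 Pi).
have {}pq : P <> Q by move/pq.
have {}H2 : P = i -> Q <> i.+1 by move=> Pi /(H2 Pi).
clear -pq H2; have [Pi|Pi] := eqVneq P i; [|have [Pi'|Pi'] := eqVneq P i.+1];
(have [Qi|Qi] := eqVneq Q i; [|have [Qi'|Qi'] := eqVneq Q i.+1]) => /=; lia.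
Qed.

Lemma simple_refl_descent w i : descent (wmul (simple_refl i) w) i = ~~ descent w i.
Proof.
rewrite /descent /wmul invMg tpermV !permM tpermL tpermR.
have : w^-1%g (lo i) != w^-1%g (hi i) by rewrite (inj_eq perm_inj) -val_eqE /= (ltn_eqF (ltnSn i)).
by rewrite -val_eqE /=; case: ltngtP.
Qed.

Lemma card_Inv_descent w i : descent w i -> #|Inv w| = #|Inv (wmul (simple_refl i) w)|.+1.
Proof. by case/Inv_descent => -> nI; rewrite cardsU1 nI. Qed.

Lemma card_Inv_leq w i : #|Inv (wmul (simple_refl i) w)| <= #|Inv w|.+1.
Proof.
have [/card_Inv_descent ->|nd] := boolP (descent w i); first by rewrite leqW.
have d : descent (wmul (simple_refl i) w) i by rewrite simple_refl_descent.
by rewrite (card_Inv_descent d) simple_reflK.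
Qed.

(** Without descents the inverse of w is increasing, hence so is w; an increasing self-map of an
    initial segment lies above the identity, and two mutually inverse ones are the identity. *)
Lemma descent_ex w : w != 1%g -> exists i, descent w i.
Proof.
move=> w1; have [/existsP//|nd] := boolP [exists i, descent w i].
have inc1 (p : 'S_n) : (forall i, p (lo i) < p (hi i)) -> forall x y, x < y -> p x < p y.
  move=> H x y xy; have [d] : exists d, y = x + d.+1 :> nat by exists (y - x).-1; lia.
  elim: d y {xy} => [|d IHd] y Ey.
    have xn : x < n.-1 by have := ltn_ord y; lia.
    have -> : x = lo (Ordinal xn) by apply: val_inj.
    have -> : y = hi (Ordinal xn) by apply: val_inj; rewrite /= Ey addn1.
    exact: H.
  have xn : x + d.+1 < n.-1 by have := ltn_ord y; lia.
  have -> : y = hi (Ordinal xn) by apply: val_inj; rewrite /= Ey addnS.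
  by apply: ltn_trans (H _); apply: IHd.
have inc2 (p : 'S_n) : (forall x y, x < y -> p x < p y) -> forall x, x <= p x.
  move=> H [k kn]; elim: k kn => [//|k IHk] kn.
  have kn' : k < n by lia.
  by apply: leq_ltn_trans (IHk kn') _; apply: H.
have incV : forall x y, x < y -> w^-1%g x < w^-1%g y.
  move: nd; rewrite negb_exists => /forallP nd; apply: inc1 => i.
  have : w^-1%g (lo i) != w^-1%g (hi i).
    by rewrite (inj_eq perm_inj) -val_eqE /= (ltn_eqF (ltnSn i)).
  by move: (nd i); rewrite /descent -val_eqE /=; case: ltngtP.
case/eqP: w1; apply: invg_inj; rewrite invg1; apply/permP => x; rewrite perm1.
have incw : forall x y, x < y -> w x < w y.
  move=> y z yz; have [//|lt_w|/val_inj/perm_inj E] := ltngtP (w y) (w z).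
    by have := incV _ _ lt_w; rewrite !permK ltnNge (ltnW yz).
  by rewrite E ltnn in yz.
apply/val_inj/eqP; rewrite eqn_leq inc2 // andbT.
by have := inc2 _ incw (w^-1%g x); rewrite permKV.
Qed.

End Inversions.

(** * Length as the number of inversions *)

Section Length.
Variable n : nat.
Implicit Types (w u v : 'S_n) (i j : 'I_n.-1).

Lemma prod_rcons (s : seq 'I_n.-1) i :
  (\prod_(j <- rcons s i) simple_refl j)%g = wmul (simple_refl i) (\prod_(j <- s) simple_refl j)%g.
Proof. by rewrite -cats1 big_cat big_seq1. Qed.

Lemma wlength_leq (s : seq 'I_n.-1) : wlength (\prod_(j <- s) simple_refl j)%g <= size s.
Proof.
rewrite /wlength; case: ex_minnP => k _; apply; apply/existsP.
by exists (in_tuple s).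
Qed.

Lemma wlength_word w : exists2 s : seq 'I_n.-1,
  size s = wlength w & w = (\prod_(j <- s) simple_refl j)%g.
Proof.
rewrite /wlength; case: ex_minnP => k /existsP[s /eqP ws] _.
by exists s; rewrite ?size_tuple.
Qed.

Lemma Inv1 : Inv (1%g : 'S_n) = set0.
Proof.
by apply/setP => p; rewrite !inE !perm1; case: ltngtP.
Qed.

Lemma wlength_simple_leq w i : wlength (wmul (simple_refl i) w) <= (wlength w).+1.
Proof.
have [s sw Ew] := wlength_word w; rewrite {1}Ew -prod_rcons -sw.
by apply: leq_trans (wlength_leq _) _; rewrite size_rcons.
Qed.

Lemma wlengthE w : wlength w = #|Inv w|.
Proof.
apply/eqP; rewrite eqn_leq; apply/andP; split.
  have [k] := ubnP #|Inv w|; elim: k w => // k IHk w le_k.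
  have [->|/descent_ex[i di]] := eqVneq w 1%g.
    by have := wlength_leq [::]; rewrite big_nil Inv1 cards0.
  have := wlength_simple_leq (wmul (simple_refl i) w) i.
  rewrite simple_reflK => /leq_trans; apply; move: le_k.
  by rewrite (card_Inv_descent di) !ltnS; apply: IHk.
have [s <- ->] := wlength_word w; elim/last_ind: s => [|s i IHs].
  by rewrite big_nil Inv1 cards0.
by rewrite prod_rcons size_rcons; apply: leq_trans (card_Inv_leq _ _) _.
Qed.

End Length.

(** * The graph of the phi_i *)

Section Graph.
Variables (n : nat) (lambda mu : 'rV[int]_n).
Hypotheses (hlambda : dominant lambda) (hmu : dominant mu).
Implicit Types (x y z : vertex n) (w : 'S_n) (i j : 'I_n.-1).
Local Open Scope ring_scope.

Notation k_ := (k_ix lambda).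
Notation sr := simple_refl.

Lemma pairingD (v v' : 'rV[int]_n) i : pairing (v + v') i = pairing v i + pairing v' i.
Proof. by rewrite /pairing !mxE opprD addrACA. Qed.

Lemma pairingN (v : 'rV[int]_n) i : pairing (- v) i = - pairing v i.
Proof. by rewrite /pairing !mxE opprB opprK addrC. Qed.

Lemma pairing_eqL (v v' : 'rV[int]_n) i : v =L v' -> pairing v i = pairing v' i.
Proof.
case=> c Ec; apply/eqP; rewrite -subr_eq0 -pairingN -pairingD Ec.
by rewrite /pairing !mxE subrr.
Qed.

Lemma pairing_rho i : pairing (rho n) i = 1.
Proof.
rewrite /pairing !mxE /=; have := ltn_ord i; lia.
Qed.

Lemma lambda_rho_lt (a b : 'I_n) : (a < b)%N -> (lambda + rho n) 0 b < (lambda + rho n) 0 a.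
Proof.
move=> ab; have [d] : exists d, (b = a + d.+1 :> nat)%N by exists (b - a).-1; lia.
have step i : (lambda + rho n) 0 (hi i) < (lambda + rho n) 0 (lo i).
  rewrite -subr_gt0 -[X in 0 < X]/(pairing _ i) pairingD pairing_rho; have := hlambda i; lia.
elim: d b {ab} => [|d IHd] b Eb.
  have an : (a < n.-1)%N by have := ltn_ord b; lia.
  have -> : b = hi (Ordinal an) by apply: val_inj; rewrite /= Eb addn1.
  by have {2}-> : a = lo (Ordinal an) by apply: val_inj.
have an : (a + d.+1 < n.-1)%N by have := ltn_ord b; lia.
have -> : b = hi (Ordinal an) by apply: val_inj; rewrite /= Eb !addnS.
by apply: lt_trans (step _) _; apply: IHd.
Qed.

Definition coord w (c : 'I_n) : int := (lambda + rho n) 0 (w^-1%g c).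

Lemma k_ixE w i : k_ w i = coord w (lo i) - coord w (hi i).
Proof. by rewrite /k_ix /coord /pairing !mxE. Qed.

Lemma coord_simple w i c : coord (wmul (sr i) w) c = coord w (sr i c).
Proof. by rewrite /coord /wmul invMg tpermV permM. Qed.

Lemma k_descent w i : (k_ w i < 0) = descent w i.
Proof.
rewrite k_ixE subr_lt0 /coord /descent; have [lt_w|gt_w|/val_inj E] := ltngtP (w^-1%g (hi i)) (w^-1%g (lo i)).
- by rewrite lambda_rho_lt.
- by apply/negbTE; rewrite -leNgt ltW // lambda_rho_lt.
by move/perm_inj: E => /(congr1 val) /= /eqP; rewrite (gtn_eqF (ltnSn i)).
Qed.

Lemma k_simple w i : k_ (wmul (sr i) w) i = - k_ w i.
Proof. by rewrite !k_ixE !coord_simple tpermL tpermR opprB. Qed.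

Lemma k_neq0 w i : k_ w i != 0.
Proof.
have := k_descent w i; have := k_descent (wmul (sr i) w) i.
rewrite k_simple simple_refl_descent; case: (descent w i) => /=; lia.
Qed.

Lemma k_adj w i j : j = i.+1 :> nat -> k_ (wmul (sr i) w) j = k_ w i + k_ w j /\
  k_ (wmul (sr j) w) i = k_ w i + k_ w j.
Proof.
move=> ji; have E : lo j = hi i by apply: val_inj; rewrite /= ji.
rewrite !k_ixE !coord_simple -E tpermL E tpermR.
rewrite !tpermD; first by split; lia.
all: by rewrite -val_eqE /= ?ji; lia.
Qed.

Lemma k_far w i j : (i.+1 < j)%N -> k_ (wmul (sr i) w) j = k_ w j /\
  k_ (wmul (sr j) w) i = k_ w i.
Proof.
move=> ij; rewrite !k_ixE !coord_simple.
by rewrite !tpermD // -val_eqE /=; lia.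
Qed.

Lemma in_S_Ksig x i : in_S lambda mu x ->
  (Ksig i x.2).2%:Z + pairing mu i + 1 = (Ksig i x.2).1%:Z + k_ x.1 i.
Proof.
move/(pairing_eqL i); rewrite pairing_kostant_sum pairingD pairingN pairingD pairing_rho.
by rewrite -/(k_ x.1 i); lia.
Qed.

(** By [in_S_Ksig] the surplus of + over - equals -k_i plus the pairing of [mu + rho], which is
    positive as [mu] is dominant. Hence f_i^(-k_i) is defined, and the braid identity applies. *)
Lemma in_S_weight x i : in_S lambda mu x -> k_ x.1 i < 0 ->
  (`|k_ x.1 i|%N + (Ksig i x.2).2 <= (Ksig i x.2).1)%N.
Proof. by move=> /(in_S_Ksig i); have := hmu i; lia. Qed.

Lemma wact_simple w i : wact (wmul (sr i) w) (lambda + rho n) =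
  wact w (lambda + rho n) - (k_ w i) *: simple_root i.
Proof.
rewrite wact_mul /k_ix; move: (wact w _) => v; apply/rowP => c.
rewrite /pairing !mxE tpermV /= ![c == _]eq_sym.
have [<-|ne] := eqVneq (lo i) c.
  by rewrite tpermL eq_sym (negbTE (_ : lo i != hi i)) ?lo_hi //; lia.
have [<-|ne'] := eqVneq (hi i) c; first by rewrite tpermR; lia.
by rewrite tpermD //; lia.
Qed.

Lemma subr_shift (G : zmodType) (a b c d : G) : a + b - (c + b - d) = a - (c - d).
Proof. by rewrite [c + b - d]addrAC opprD addrACA subrr addr0. Qed.

(** Both sides of the equation defining the vertex set change by -k_i times the simple root. *)
Lemma arrow_intro x i beta : in_S lambda mu x -> k_ x.1 i < 0 ->
  iter_op (f_op i) `|k_ x.1 i|%N x.2 = Some beta ->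
  phi_arrow lambda mu i x (wmul (sr i) x.1, beta).
Proof.
move=> xS ki E; split=> //; have [c Ec] := xS; exists c.
have km : - k_ x.1 i = `|k_ x.1 i|%N%:R by rewrite natz; lia.
rewrite -Ec (iter_f_op_sum E) wact_simple -scaleNr km scaler_nat /=.
exact: subr_shift.
Qed.

Lemma in_S_up x i beta : in_S lambda mu x -> 0 < k_ x.1 i ->
  iter_op (f_op i) `|k_ x.1 i|%N beta = Some x.2 ->
  phi_arrow lambda mu i (wmul (sr i) x.1, beta) x.
Proof.
move=> xS ki E; have [c Ec] := xS.
have E' : kostant_sum beta = kostant_sum x.2 - k_ x.1 i *: simple_root i.
  have km : k_ x.1 i = `|k_ x.1 i|%N%:R by rewrite natz; lia.
  by rewrite (iter_f_op_sum E) {2}km scaler_nat addrK.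
split=> //=; rewrite ?simple_reflK ?k_simple ?abszN //; last by rewrite oppr_lt0.
exists c; rewrite -Ec E' wact_simple.
exact: subr_shift.
Qed.

Lemma down_ex x i : in_S lambda mu x -> k_ x.1 i < 0 ->
  exists2 y, phi_arrow lambda mu i x y & y.1 = wmul (sr i) x.1.
Proof.
move=> xS ki; have := in_S_weight xS ki => wt.
have [beta Eb] := iter_f_op_ex (leq_trans (leq_addr _ _) wt).
by exists (wmul (sr i) x.1, beta) => //; apply: arrow_intro.
Qed.

Lemma arrow_fun i x y z : phi_arrow lambda mu i x y -> phi_arrow lambda mu i x z -> y = z.
Proof.
case=> _ _ _ y1 Ey [_ _ _ z1]; rewrite Ey => -[Ez].
by rewrite [y]surjective_pairing [z]surjective_pairing y1 z1 Ez.
Qed.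

Lemma arrow_inj i x y z : phi_arrow lambda mu i x z -> phi_arrow lambda mu i y z ->
  x.1 = y.1 -> x = y.
Proof.
case=> _ _ _ _ Ex [_ _ _ _ Ey] xy; rewrite [x]surjective_pairing [y]surjective_pairing xy.
by rewrite xy in Ex; rewrite (iter_f_op_inj Ex Ey).
Qed.

Definition rank x := #|Inv x.1|.

Lemma arrow_rank i x y : phi_arrow lambda mu i x y -> rank x = (rank y).+1.
Proof.
by case=> _ _; rewrite k_descent => di y1 _; rewrite /rank y1 -card_Inv_descent.
Qed.

Inductive descends : vertex n -> vertex n -> Prop :=
| Descends0 x : descends x x
| DescendsS i x y z : phi_arrow lambda mu i x y -> descends y z -> descends x z.

Lemma descends_trans x y z : descends x y -> descends y z -> descends x z.
Proof. by elim=> // i a b c ab _ IH /IH; apply: DescendsS ab. Qed.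

Lemma descends1 i x y : phi_arrow lambda mu i x y -> descends x y.
Proof. by move=> xy; apply: DescendsS xy (Descends0 _). Qed.

Lemma descends_source x : in_S lambda mu x -> exists alpha, descends x (1%g, alpha).
Proof.
have [k] := ubnP (rank x); elim: k x => // k IHk x le_k xS.
have [x1|/descent_ex[i]] := eqVneq x.1 1%g.
  by exists x.2; rewrite -x1 -surjective_pairing; apply: Descends0.
rewrite -k_descent => /(down_ex xS)[y xy _]; have [_ yS _ _ _] := xy.
have [|a Da] := IHk y _ yS; first by move: le_k; rewrite (arrow_rank xy).
by exists a; apply: DescendsS xy Da.
Qed.

Lemma confluence_far i j x y z : (i.+1 < j)%N ->
  phi_arrow lambda mu i x y -> phi_arrow lambda mu j x z ->
  exists t, descends y t /\ descends z t.
Proof.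
move=> ij [xS yS ki y1 Ey] [_ zS kj z1 Ez].
have [t Et Et'] := iter_f_op_comm ij Ey Ez.
have [kjy kiz] := k_far x.1 ij.
have kyj : k_ y.1 j = k_ x.1 j by rewrite y1.
have kzi : k_ z.1 i = k_ x.1 i by rewrite z1.
exists (wmul (sr j) y.1, t); split.
  by apply: (@descends1 j); apply: arrow_intro; rewrite ?kyj.
have -> : wmul (sr j) y.1 = wmul (sr i) z.1 by rewrite y1 z1 simple_refl_comm.
by apply: (@descends1 i); apply: arrow_intro; rewrite ?kzi.
Qed.

(** Along the two sides of the braid hexagon the values of k are k_i, k_i + k_j, k_j and k_j, k_i +
    k_j, k_i: these are the exponents in [f_op_braid], with b = -k_i and a = -k_j. *)
Lemma confluence_adj i j x y z : j = i.+1 :> nat ->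
  phi_arrow lambda mu i x y -> phi_arrow lambda mu j x z ->
  exists t, descends y t /\ descends z t.
Proof.
move=> ji xy xz; have [xS yS ki y1 Ey] := xy; have [_ zS kj z1 Ez] := xz.
have [kyj kzi] := k_adj x.1 ji; rewrite -y1 in kyj; rewrite -z1 in kzi.
have [|y2 yy2 y21] := @down_ex y j yS; first by rewrite kyj; lia.
have [_ y2S _ _ Ey2] := yy2.
have [|z2 zz2 z21] := @down_ex z i zS; first by rewrite kzi; lia.
have [_ z2S _ _ Ez2] := zz2.
have ky2i : k_ y2.1 i = k_ x.1 j.
  have [_] := k_adj y.1 ji; rewrite -y21 => ->; rewrite kyj y1 k_simple; lia.
have kz2j : k_ z2.1 j = k_ x.1 i.
  have [] := k_adj z.1 ji; rewrite -z21 => -> _; rewrite kzi z1 k_simple; lia.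
have [|y3 yy3 y31] := @down_ex y2 i y2S; first by rewrite ky2i.
have [|z3 zz3 z31] := @down_ex z2 j z2S; first by rewrite kz2j.
have [_ _ _ _ Ey3] := yy3; have [_ _ _ _ Ez3] := zz3.
rewrite ky2i in Ey3; rewrite kz2j in Ez3.
have E1 : `|k_ y.1 j|%N = (`|k_ x.1 j| + `|k_ x.1 i|)%N by rewrite kyj; lia.
have E2 : `|k_ z.1 i|%N = (`|k_ x.1 j| + `|k_ x.1 i|)%N by rewrite kzi; lia.
rewrite E1 in Ey2; rewrite E2 in Ez2.
have E3 := f_op_braid ji (in_S_weight xS ki) (in_S_weight xS kj) Ey Ey2 Ey3 Ez Ez2 Ez3.
exists y3; split; first exact: DescendsS yy2 (descends1 yy3).
have -> : y3 = z3; last exact: DescendsS zz2 (descends1 zz3).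
rewrite [y3]surjective_pairing [z3]surjective_pairing E3 y31 z31 y21 z21 y1 z1.
by rewrite simple_refl_braid.
Qed.

Lemma confluence i j x y z :
  phi_arrow lambda mu i x y -> phi_arrow lambda mu j x z ->
  exists t, descends y t /\ descends z t.
Proof.
move=> xy xz; have [lt_ij|lt_ji|/val_inj ij] := ltngtP i j.
- have [eji|ne] := eqVneq (j : nat) i.+1; first exact: confluence_adj xy xz.
  by apply: confluence_far xy xz; lia.
- have [eij|ne] := eqVneq (i : nat) j.+1.
    by have [t [? ?]] := confluence_adj eij xz xy; exists t.
  by have [|t [? ?]] := confluence_far (_ : j.+1 < i)%N xz xy; [lia | exists t].
by exists y; split; [| rewrite -ij in xz; rewrite (arrow_fun xz xy)]; apply: Descends0.
Qed.

Lemma descends_S x y : descends x y -> in_S lambda mu x -> in_S lambda mu y.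
Proof. by elim=> // i a b c [_ bS _ _ _] _ IH _; apply: IH. Qed.

Lemma no_arrow1 i alpha y : ~ phi_arrow lambda mu i (1%g, alpha) y.
Proof. by move/arrow_rank; rewrite /rank Inv1 cards0. Qed.

Lemma descends_inv x z : descends x z ->
  x = z \/ exists i y, phi_arrow lambda mu i x y /\ descends y z.
Proof. by case=> [y|i a y b ay yb]; [left | right; exists i, y]. Qed.

(** Newman's lemma, by induction on the length of the first entry: descend from a common vertex
    below the two first steps. *)
Lemma source_uniq x alpha beta : in_S lambda mu x ->
  descends x (1%g, alpha) -> descends x (1%g, beta) -> alpha = beta.
Proof.
have [k] := ubnP (rank x); elim: k x alpha beta => // k IHk x alpha beta le_k xS.
case/descends_inv => [->|[i [y [xy ya]]]].
  by case/descends_inv => [[]|[i [y [/no_arrow1]]]].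
case/descends_inv => [xb|[j [z [xz zb]]]].
  by rewrite xb in xy; case: (no_arrow1 xy).
have [_ yS _ _ _] := xy; have [_ zS _ _ _] := xz.
have [t [yt zt]] := confluence xy xz.
have [gamma tg] := descends_source (descends_S yt yS).
have ry : (rank y < k)%N by move: le_k; rewrite (arrow_rank xy).
have rz : (rank z < k)%N by move: le_k; rewrite (arrow_rank xz).
rewrite (IHk y alpha gamma ry yS ya (descends_trans yt tg)).
by rewrite (IHk z beta gamma rz zS zb (descends_trans zt tg)).
Qed.

(** * The structure of one component *)

Section OneComponent.
Variable x0 : vertex n.
Hypothesis x0S : in_S lambda mu x0.
Notation C := (component (phi_graph lambda mu) x0).

Lemma vertC_S x : vert C x -> in_S lambda mu x.
Proof. by case. Qed.

Lemma vertC_edge i x y : phi_adj lambda mu i x y -> vert C x -> vert C y.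
Proof.
move=> xy [_ rx]; split; first by have [] := phi_adj_vert xy.
by apply: rt_trans rx _; apply: rt_step; exists i.
Qed.

Lemma vertC_descends x y : descends x y -> vert C x -> vert C y.
Proof. by elim=> // i a b c ab _ IH Ca; apply: IH; apply: vertC_edge Ca; left; exact: ab. Qed.

Lemma reachable_source x y alpha :
  clos_refl_trans _ (fun a b => exists i, edge (phi_graph lambda mu) i a b) x y ->
  in_S lambda mu x -> (descends x (1%g, alpha) <-> descends y (1%g, alpha)).
Proof.
elim=> {x y} [x y [i /= xy] _|x xS //|x y z xy IH1 yz IH2 xS]; last first.
  have yS : in_S lambda mu y.
    elim: xy xS => {x y IH1 yz IH2} [a b [i /phi_adj_vert[]] //|//|a b c _ h _ h' aS].
    exact/h'/h.
  by rewrite IH1 // IH2.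
have arrow a b : phi_arrow lambda mu i a b ->
    (descends a (1%g, alpha) <-> descends b (1%g, alpha)).
  move=> ab; split=> [da|]; last exact: DescendsS ab.
  have [aS bS _ _ _] := ab; have [beta db] := descends_source bS.
  by rewrite (source_uniq aS da (DescendsS ab db)).
by case: xy => /arrow // ->.
Qed.

Lemma vertC_source x alpha : vert C x -> descends x0 (1%g, alpha) -> descends x (1%g, alpha).
Proof. by case=> _ rx; have [] := reachable_source alpha rx x0S. Qed.

(** Whether i is a descent depends on the first entry only, so both vertices have an arrow with the
    same label; the targets agree by induction, and [f_i] is injective. *)
Lemma vertC_inj x y : vert C x -> vert C y -> x.1 = y.1 -> x = y.
Proof.
have [alpha x0a] := descends_source x0S.
have [k] := ubnP (rank x); elim: k x y => // k IHk x y le_k Cx Cy xy.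
have xa := vertC_source Cx x0a; have ya := vertC_source Cy x0a.
case/descends_inv: (xa) => [xE|[i [x' [xx' _]]]].
  case/descends_inv: (ya) => [->//|[i [y' [yy' _]]]].
  by move/arrow_rank: yy'; rewrite /rank -xy xE Inv1 cards0.
have [_ _ ki x'1 Ex'] := xx'.
have [|y' yy' y'1] := @down_ex y i (vertC_S Cy); first by rewrite -xy.
have x'y' : x' = y'.
  apply: IHk; first by move: le_k; rewrite (arrow_rank xx').
  - by apply: vertC_edge Cx; left; exact: xx'.
  - by apply: vertC_edge Cy; left; exact: yy'.
  by rewrite x'1 y'1 xy.
by rewrite -x'y' in yy'; apply: arrow_inj xx' yy' xy.
Qed.

Variable alpha : kostant n.
Hypothesis x0a : descends x0 (1%g, alpha).

Lemma vertC_alpha : vert C (1%g, alpha).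
Proof. by apply: vertC_descends x0a _; split=> //; apply: rt_refl. Qed.

Lemma source_labelsP i beta w : phi_arrow lambda mu i (w, beta) (1%g, alpha) ->
  i \in source_labels lambda alpha.
Proof.
case=> _ _ /= ki w1 E.
have {}w1 : w = wmul (sr i) 1%g by rewrite w1 simple_reflK.
rewrite w1 k_simple in ki E; rewrite inE /phi /=.
rewrite ltNge ltW /=; last by rewrite -oppr_lt0.
by rewrite abszN in E; rewrite (iter_f_op_e_op E).
Qed.

(** By induction on the length of x.1, an arrow labelled i is replaced by one with a shorter tail,
    until it ends at the source. Let j be the label of an arrow from y to z. *)
Lemma arrow_label i x y : vert C x -> phi_arrow lambda mu i x y ->
  i \in source_labels lambda alpha.
Proof.
have [k] := ubnP (rank x); elim: k i x y => // k IHk i x y le_k Cx xy.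
have [xS yS ki y1 Ey] := xy; have Cy : vert C y by apply: vertC_edge Cx; left; exact: xy.
have kyi : k_ y.1 i = - k_ x.1 i by rewrite y1 k_simple.
have ry : (rank y < k)%N by move: le_k; rewrite (arrow_rank xy).
case/descends_inv: (vertC_source Cy x0a) => [E|[j [z [yz _]]]].
  by rewrite E in xy; apply: (@source_labelsP i x.2 x.1); rewrite -surjective_pairing.
have [_ zS kj z1 Ez] := yz.
have Cz : vert C z by apply: vertC_edge Cy; left; exact: yz.
have rz : ((rank z).+1 < k)%N by rewrite -(arrow_rank yz).
(* If i and j are orthogonal, descend from x along j first and then use the label i. *)
have far : k_ y.1 j = k_ x.1 j -> k_ (wmul (sr j) x.1) i = k_ x.1 i ->
    i \in source_labels lambda alpha.
  move=> kj' ki'; have [|x' xx' x'1] := @down_ex x j xS; first by rewrite -kj'.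
  have [_ x'S _ _ _] := xx'; have [|y' x'y' _] := @down_ex x' i x'S; first by rewrite x'1 ki'.
  apply: (IHk i x' y') => //; first by move: le_k; rewrite (arrow_rank xx').
  by apply: vertC_edge Cx; left; exact: xx'.
have adj : (i = j.+1 :> nat \/ j = i.+1 :> nat) -> k_ z.1 i = k_ y.1 i + k_ y.1 j ->
    i \in source_labels lambda alpha.
  move=> ij kzi; have [kz0|kz0] := ltP (k_ z.1 i) 0.
    have [t zt _] := down_ex zS kz0; apply: (IHk i z t) => //; exact: ltnW.
  (* [e_i] applies at least k_i(y) times at y, and passing to z costs at most -k_j(y). So it applies
     k_i(z) = k_i(y) + k_j(y) times at z, which yields an arrow labelled i ending at z. *)
  have kz0' : 0 < k_ z.1 i by rewrite lt_def k_neq0.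
  have L1 := iter_f_op_elenk Ey; have L2 := iter_f_op_elenk_adj ij Ez.
  have [|beta Eb] := @iter_f_op_pre n i `|k_ z.1 i|%N z.2; first by lia.
  have uz := in_S_up zS kz0' Eb.
  apply: (IHk i _ z _ _ uz); first by rewrite (arrow_rank uz).
  by apply: vertC_edge Cz; right; exact: uz.
have [lt_ij|lt_ji|/val_inj ij] := ltngtP i j.
- have [eji|ne] := eqVneq (j : nat) i.+1.
    by apply: adj; [right | have [_] := k_adj y.1 eji; rewrite -z1].
  have [|f1 f2] := @k_far x.1 i j; first by lia.
  by apply: far => //; rewrite y1.
- have [eij|ne] := eqVneq (i : nat) j.+1.
    by apply: adj; [left | have [+ _] := k_adj y.1 eij; rewrite -z1 addrC].
  have [|f1 f2] := @k_far x.1 j i; first by lia.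
  by apply: far => //; rewrite y1.
by move: kj; rewrite -ij kyi; lia.
Qed.

Lemma vertC_parabolic x : vert C x -> x.1 \in parabolic (source_labels lambda alpha).
Proof.
have [k] := ubnP (rank x); elim: k x => // k IHk x le_k Cx.
case/descends_inv: (vertC_source Cx x0a) => [->|[i [y [xy _]]]]; first exact: group1.
have iJ := arrow_label Cx xy; have [_ _ _ y1 _] := xy.
have -> : x.1 = wmul (sr i) y.1 by rewrite y1 simple_reflK.
rewrite groupM //; last by apply: mem_gen; apply: imset_f.
apply: IHk; first by move: le_k; rewrite (arrow_rank xy).
by apply: vertC_edge Cx; left; exact: xy.
Qed.

Lemma vertC_weak_le x u : vert C x -> weak_le u x.1 -> exists2 y, vert C y & y.1 = u.
Proof.
move=> Cx [v]; have [s <- ->] := wlength_word v.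
elim/last_ind: s x Cx => [|s i IHs] x Cx.
  by rewrite big_nil /wmul mulg1 => x1 _; exists x.
rewrite prod_rcons size_rcons => x1 lx; pose v' := (\prod_(j <- s) sr j)%g.
have {}x1 : x.1 = wmul (sr i) (wmul v' u) by rewrite x1 /wmul mulgA.
have x1' : wmul (sr i) x.1 = wmul v' u by rewrite x1 simple_reflK.
have lv : (wlength (wmul v' u) <= size s + wlength u)%N.
  have [t tu Eu] := wlength_word u; rewrite {1}Eu /wmul -big_cat.
  by apply: leq_trans (wlength_leq _) _; rewrite size_cat tu addnC.
(* Otherwise [s_i] x.1 would be longer than x.1, whereas it is a product of fewer simple
   reflections. *)
have ki : k_ x.1 i < 0.
  rewrite k_descent; apply/negPn/negP => nd.
  have d : descent (wmul (sr i) x.1) i by rewrite simple_refl_descent.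
  have := card_Inv_descent d; rewrite simple_reflK -!wlengthE x1'; lia.
have [y xy y1] := down_ex (vertC_S Cx) ki.
apply: (IHs y); first by apply: vertC_edge Cx; left; exact: xy.
  by rewrite y1.
apply/eqP; rewrite eqn_leq y1 x1' lv /= -ltnS -addSn -lx x1.
exact: wlength_simple_leq.
Qed.

Definition image_vert w := exists2 x, vert C x & x.1 = w.
Definition image_edge i w w' := exists x y, [/\ edge C i x y, x.1 = w & y.1 = w'].

Lemma image_edge_sym i w w' : image_edge i w w' -> image_edge i w' w.
Proof. by case=> x [y [xy xw yw]]; exists y, x; split=> //; apply: edge_sym. Qed.

Lemma image_edge_vert i w w' : image_edge i w w' -> image_vert w /\ image_vert w'.
Proof.
by case=> x [y [xy xw yw]]; have [Cx Cy] := edge_vert xy; split; [exists x | exists y].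
Qed.

Lemma component_iso :
  is_iso (fun x : vertex n => x.1) C (LGraph image_edge_sym image_edge_vert).
Proof.
split=> [x Cx|x y|w [x Cx xw]|i x y Cx Cy].
- by exists x.
- exact: vertC_inj.
- by exists x.
split=> [xy|[x' [y' [xy xx' yy']]]]; first by exists x, y.
have [Cx' Cy'] := edge_vert xy.
by rewrite -(vertC_inj Cx' Cx xx') -(vertC_inj Cy' Cy yy').
Qed.

Lemma component_subgraph :
  subgraph (LGraph image_edge_sym image_edge_vert) (cayley (source_labels lambda alpha)).
Proof.
split=> [w [x Cx <-]|i w w' [x [y [xy <- <-]]]]; first exact: vertC_parabolic.
have [adj Cx Cy] := xy; split; last 2 first.
- exact: vertC_parabolic.
- by case: adj => -[_ _ _ -> _] //; rewrite simple_reflK.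
by case: adj => [/(arrow_label Cx)|/(arrow_label Cy)].
Qed.

Lemma component_source : is_source C alpha.
Proof.
split=> [|beta Cb]; first exact: vertC_alpha.
by have [[]|[i [y [/no_arrow1]]]] := descends_inv (vertC_source Cb x0a).
Qed.

End OneComponent.
End Graph.

Local Open Scope ring_scope.

Theorem corollary6p3 (n : nat) (hn : (2 <= n)%N) (lambda mu : 'rV[int]_n)
    (hlambda : dominant lambda) (hmu : dominant mu) (hle : root_ge lambda mu)
    (C : lgraph 'I_n.-1 (vertex n))
    (hC : is_component (phi_graph lambda mu) C) :
  exists2 alpha : kostant n, is_source C alpha &
  exists Gamma : lgraph 'I_n.-1 'S_n,
    [/\ subgraph Gamma (cayley (source_labels lambda alpha)),
        is_iso (fun x : vertex n => x.1) C Gamma &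
        forall w u : 'S_n, vert Gamma w -> weak_le u w -> vert Gamma u].
Proof.
have [x0 x0S ->] := hC.
have [alpha x0a] := descends_source hlambda hmu x0S.
exists alpha; first exact: component_source.
(* Gamma is the image of the component under the first projection, edges included, so the
   isomorphism amounts to injectivity on vertices. *)
exists (LGraph (@image_edge_sym n lambda mu x0) (@image_edge_vert n lambda mu x0)); split.
- exact: component_subgraph.
- exact: component_iso.
by move=> w u [x Cx <-]; apply: vertC_weak_le.
Qed.
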